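(* The promise problem $\textsc{N-Free}(\mathrm{Succinct},\mathrm{PO})$ is $\mathbf{PP}$-hard under polynomial-time many-one reductions.
   Context: Poset game on a finite poset $P$: players alternate; a move chooses a point $x$ of the current poset $Q$ and replaces $Q$ by $\{y\in Q: x\not\le y\}$; the first player unable to move loses; $P$ is an $\exists$-game if the first player has a winning strategy. An ''N'' in a poset is a set of four elements $a,b,c,d$ with $a<b$, $c<d$, $c<b$, and the pairs $\{a,c\},\{a,d\},\{b,d\}$ incomparable; a poset is N-free if it contains no N as an induced subposet. $\textsc{N-Free}(\mathrm{Succinct},\mathrm{PO})$ is the promise problem: Input: a Boolean circuit $C$ with one output bit and two $n$-bit inputs (possibly with an auxiliary membership circuit specifying the point set as a subset of $\{0,1\}^n$). Promise: the relation $\{(y,z): C(y,z)=1\}$ is a partial order on the point set, and this poset $P$ is N-free. Question: is $P$ an $\exists$-game? $\mathbf{PP}$ is probabilistic polynomial time (majority acceptance). *)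

(* Defs.v *)
From Stdlib Require Import List Arith NArith Bool.
Import ListNotations.
Open Scope bool_scope.

Fixpoint all_bits (n : nat) : list (list bool) :=
  match n with
  | 0 => [ [] ]
  | S m => map (cons false) (all_bits m) ++ map (cons true) (all_bits m)
  end.

(* A circuit is a straight-line list of gates; gate number i may refer to
   input variables (GVar v) or to earlier gates j < i.  The output is the
   value of the last gate.  Dangling references evaluate to false. *)
Inductive gate : Type :=
| GVar   : nat -> gate
| GConst : bool -> gate
| GNot   : nat -> gate
| GAnd   : nat -> nat -> gate
| GOr    : nat -> nat -> gate.

Definition circuit := list gate.

Definition gate_val (inp : list bool) (vals : list bool) (g : gate) : bool :=
  let ref j := if j <? length vals then nth j vals false else false in
  match g with
  | GVar v => nth v inp false
  | GConst b => b
  | GNot i => negb (ref i)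
  | GAnd i j => ref i && ref j
  | GOr i j => ref i || ref j
  end.

Definition circ_vals (C : circuit) (inp : list bool) : list bool :=
  fold_left (fun vals g => vals ++ [gate_val inp vals g]) C [].

Definition eval_circ (C : circuit) (inp : list bool) : bool :=
  last (circ_vals C inp) false.

(* An instance of N-Free(Succinct,PO): bit length n, the order circuit C
   (2n inputs: y then z) and the membership circuit D (n inputs). *)
Record instance : Type := mkInstance {
  inst_n : nat;
  inst_C : circuit;
  inst_D : circuit }.

Definition le_rel (I : instance) (y z : list bool) : bool :=
  eval_circ (inst_C I) (y ++ z).

Definition points (I : instance) : list (list bool) :=
  filter (fun y => eval_circ (inst_D I) y) (all_bits (inst_n I)).

Fixpoint pos_bits (p : positive) : list bool :=
  match p with
  | xH => [true]
  | xO q => false :: pos_bits q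
  | xI q => true :: pos_bits q
  end.

Definition nat_bits (n : nat) : list bool :=
  match N.of_nat n with N0 => [] | Npos p => pos_bits p end.

(* self-delimiting: each bit b becomes 1 b, terminated by 0 *)
Definition enc_nat (n : nat) : list bool :=
  flat_map (fun b => [true; b]) (nat_bits n) ++ [false].

Definition enc_gate (g : gate) : list bool :=
  match g with
  | GVar v => [false; false; false] ++ enc_nat v
  | GConst b => [false; false; true; b]
  | GNot i => [false; true; false] ++ enc_nat i
  | GAnd i j => [false; true; true] ++ enc_nat i ++ enc_nat j
  | GOr i j => [true; false; false] ++ enc_nat i ++ enc_nat j
  end.

Definition enc_circ (C : circuit) : list bool :=
  enc_nat (length C) ++ flat_map enc_gate C.

Definition enc_instance (I : instance) : list bool :=
  enc_nat (inst_n I) ++ enc_circ (inst_C I) ++ enc_circ (inst_D I).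

Definition is_partial_order (I : instance) : Prop :=
  (forall x, In x (points I) -> le_rel I x x = true) /\
  (forall x y, In x (points I) -> In y (points I) ->
     le_rel I x y = true -> le_rel I y x = true -> x = y) /\
  (forall x y z, In x (points I) -> In y (points I) -> In z (points I) ->
     le_rel I x y = true -> le_rel I y z = true -> le_rel I x z = true).

Definition lt_rel (I : instance) (x y : list bool) : Prop :=
  le_rel I x y = true /\ x <> y.

Definition incomparable (I : instance) (x y : list bool) : Prop :=
  le_rel I x y = false /\ le_rel I y x = false.

Definition N_free (I : instance) : Prop :=
  ~ exists a b c d,
      In a (points I) /\ In b (points I) /\ In c (points I) /\ In d (points I) /\
      lt_rel I a b /\ lt_rel I c d /\ lt_rel I c b /\
      incomparable I a c /\ incomparable I a d /\ incomparable I b d.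

Definition promise (I : instance) : Prop := is_partial_order I /\ N_free I.

Inductive FirstWins (le : list bool -> list bool -> bool)
  : list (list bool) -> Prop :=
| fw_move : forall Q x, In x Q ->
    FirstLoses le (filter (fun y => negb (le x y)) Q) -> FirstWins le Q
with FirstLoses (le : list bool -> list bool -> bool)
  : list (list bool) -> Prop :=
| fl_all : forall Q,
    (forall x, In x Q -> FirstWins le (filter (fun y => negb (le x y)) Q)) ->
    FirstLoses le Q.

Definition exists_game (I : instance) : Prop := FirstWins (le_rel I) (points I).

Definition NFree_yes (s : list bool) : Prop :=
  exists I, s = enc_instance I /\ promise I /\ exists_game I.
Definition NFree_no (s : list bool) : Prop :=
  exists I, s = enc_instance I /\ promise I /\ ~ exists_game I.

Definition sym := option bool.   (* None = blank *)
Inductive dir := DL | DR | DS.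

Definition sym_eqb (a b : sym) : bool :=
  match a, b with
  | None, None => true
  | Some x, Some y => Bool.eqb x y
  | _, _ => false
  end.

(* A rule (q, s, q', w, d): in state q reading s, write w, go to q', move d. *)
Record rule := mkRule { r_q : nat; r_s : sym; r_q' : nat; r_w : sym; r_d : dir }.
(* A TM is a finite table of rules; start state 0; halts when no rule applies. *)
Definition TM := list rule.

Record config := mkConfig {
  c_q : nat; c_left : list sym (* nearest cell first *);
  c_head : sym; c_right : list sym }.

Definition step (M : TM) (c : config) : option config :=
  match find (fun r => Nat.eqb (r_q r) (c_q c) && sym_eqb (r_s r) (c_head c)) M with
  | None => None
  | Some r =>
      let q := r_q' r in
      let w := r_w r in
      match r_d r with
      | DS => Some (mkConfig q (c_left c) w (c_right c))
      | DL => match c_left c with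
              | [] => Some (mkConfig q [] None (w :: c_right c))
              | s :: l => Some (mkConfig q l s (w :: c_right c))
              end
      | DR => match c_right c with
              | [] => Some (mkConfig q (w :: c_left c) None [])
              | s :: rr => Some (mkConfig q (w :: c_left c) s rr)
              end
      end
  end.

Fixpoint run (M : TM) (t : nat) (c : config) : option config :=
  match step M c with
  | None => Some c
  | Some c' => match t with 0 => None | S t' => run M t' c' end
  end.

Definition init (inp : list sym) : config :=
  mkConfig 0 [] (hd None inp) (tl inp).

Fixpoint take_bits (l : list sym) : list bool :=
  match l with
  | Some b :: l' => b :: take_bits l'
  | _ => []
  end.

Definition output (c : config) : list bool := take_bits (c_head c :: c_right c).

Definition poly (c k n : nat) : nat := c * n ^ k + c.

Definition accepts_within (M : TM) (t : nat) (inp : list sym) : bool :=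
  match run M t (init inp) with
  | Some cfg => match output cfg with true :: _ => true | _ => false end
  | None => false
  end.

Definition pair_input (x r : list bool) : list sym :=
  map Some x ++ None :: map Some r.

Definition InPP (L : list bool -> Prop) : Prop :=
  exists (M : TM) (a b c k : nat),
    (forall x r, length r = poly a b (length x) ->
       run M (poly c k (length x)) (init (pair_input x r)) <> None) /\
    (forall x,
       L x <->
       2 * length (filter (fun r => accepts_within M (poly c k (length x)) (pair_input x r))
                          (all_bits (poly a b (length x))))
         > 2 ^ poly a b (length x)).

Definition PolyTimeComputable (f : list bool -> list bool) : Prop :=
  exists (M : TM) (c k : nat), forall x,
    exists cfg, run M (poly c k (length x)) (init (map Some x)) = Some cfg /\
                output cfg = f x.

Definition PolyReduces (L : list bool -> Prop)
    (Yes No : list bool -> Prop) : Prop :=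
  exists f, PolyTimeComputable f /\
    forall x, (L x -> Yes (f x)) /\ (~ L x -> No (f x)).

Definition PP_hard (Yes No : list bool -> Prop) : Prop :=
  forall L, InPP L -> PolyReduces L Yes No.

(* Main.v *)
Require Import Defs.
From Stdlib Require Import List Arith NArith.
From Stdlib Require Import ZArith Bool Lia FunctionalExtensionality.
Import ListNotations.

(** With A accepting coin strings among the 2^m of length m, put
    B = 2A + 2^m - 1 and T = 2^(m+1); then 2A > 2^m iff B >= T.  Nim with heaps
    B, T and B + T is won by the first player iff B >= T, since B xor T = B + T
    exactly when B < T (as B < 2T), and Nim is the poset game on a disjoint union of
    chains, which is N-free.  The points of the three chains are strings of four
    tag bits followed by coin tosses; membership is decided by a circuit running
    the PP machine, and the order compares strings as binary numbers inside one
    chain.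

    The machine is unrolled along a helix: the configurations are written one
    after another as a single sequence of equally long gate blocks, and block p
    depends only on blocks p-W-1, p-W, p-W+1 and p-1, where W is the row width.
    All blocks are thus shifts of one template, so the encoding of the circuit is
    printed by loops over unary counters.  Such a loop program is compiled to a
    machine with finitely many stacks, which are laid out in interleaved tracks of
    the single tape; every step costs one sweep over the tape, hence
    polynomial time overall. *)

(** The threshold has to be a power of two, for only there does a comparison show in a nim sum. The
    term 2^m - 1 shifts the strict majority to such a threshold, and A <= 2^m gives B < 2T, so B >=
    T says just that the bit of weight T of B is set. The summands are counted by tag patterns: A
    twice, the coin strings that are not all zero once, and T as two full copies of the coin space.
    So besides the verdict the circuit must carry only one more bit: whether some coin is 1. These
    chains meet the promise for every acceptance predicate, hence no input leads outside the
    promise. The helix has a price: at the ends of a row the neighbouring blocks belong to other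
    rows. Blank margins wider than the running time keep the head away from the row ends, and a cell
    without the head influences none of its neighbours. Equally long blocks require padding to a
    common length; as a block reads a number of bits fixed by the machine, this length is a
    constant, however wasteful the circuit inside. *)

Definition lookup (M : TM) (q : nat) (s : sym) : option rule :=
  find (fun r => Nat.eqb (r_q r) q && sym_eqb (r_s r) s) M.

(** * Configurations as tapes indexed by the integers *)

Definition zupd (T : Z -> sym) (p : Z) (w : sym) : Z -> sym :=
  fun z => if Z.eqb z p then w else T z.

Definition move (d : dir) (p : Z) : Z :=
  match d with DL => p - 1 | DR => p + 1 | DS => p end%Z.

(** Both lists are read through [nth] with a blank default, so configurations that differ only in
    trailing blanks show the same tape and need no normal form. *)
Definition shows (c : config) (q : nat) (p : Z) (T : Z -> sym) : Prop :=
  c_q c = q /\ c_head c = T p /\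
  (forall i, nth i (c_left c) None = T (p - 1 - Z.of_nat i)%Z) /\
  (forall i, nth i (c_right c) None = T (p + 1 + Z.of_nat i)%Z).

Definition word_tape (l : list sym) (z : Z) : sym :=
  if (0 <=? z)%Z then nth (Z.to_nat z) l None else None.

Lemma zupd_same T p w : zupd T p w p = w.
Proof. unfold zupd; now rewrite Z.eqb_refl. Qed.

Lemma zupd_other T p w z : z <> p -> zupd T p w z = T z.
Proof. unfold zupd; intro H; destruct (Z.eqb_spec z p); congruence. Qed.

Lemma zupd_id T p : zupd T p (T p) = T.
Proof.
  apply functional_extensionality; intro z; unfold zupd.
  destruct (Z.eqb_spec z p); congruence.
Qed.

Lemma nth0 {A} (l : list A) d : nth 0 l d = hd d l.
Proof. now destruct l. Qed.

Lemma nth_tl {A} (l : list A) d i : nth i (tl l) d = nth (S i) l d.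
Proof. destruct l; [now destruct i|easy]. Qed.

Lemma shows_step M c q p T : shows c q p T ->
  match lookup M q (T p) with
  | None => step M c = None
  | Some r => exists c', step M c = Some c' /\
      shows c' (r_q' r) (move (r_d r) p) (zupd T p (r_w r))
  end.
Proof.
  intros (Hq & Hh & Hl & Hr). unfold step, lookup. rewrite Hq, Hh.
  destruct (find _ M) as [r|]; [|reflexivity].
  destruct (r_d r) eqn:Ed; simpl.
  (* [hd] and [tl] treat the blank supplied at the end of the list like a stored symbol. *)
  - replace (match c_left c with [] => _ | _ :: _ => _ end)
      with (Some (mkConfig (r_q' r) (tl (c_left c)) (hd None (c_left c)) (r_w r :: c_right c)))
      by now destruct (c_left c).
    eexists; split; [reflexivity|]. split; [reflexivity|]; cbn [c_head c_left c_right move].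
    split; [|split].
    + rewrite zupd_other, <- nth0, Hl by lia. f_equal; lia.
    + intro i. rewrite zupd_other, nth_tl, Hl by lia. f_equal; lia.
    + intros [|i]; simpl nth.
      * replace (p - 1 + 1 + Z.of_nat 0)%Z with p by lia. now rewrite zupd_same.
      * rewrite zupd_other, Hr by lia. f_equal; lia.
  - replace (match c_right c with [] => _ | _ :: _ => _ end)
      with (Some (mkConfig (r_q' r) (r_w r :: c_left c) (hd None (c_right c)) (tl (c_right c))))
      by now destruct (c_right c).
    eexists; split; [reflexivity|]. split; [reflexivity|]; cbn [c_head c_left c_right move].
    split; [|split].
    + rewrite zupd_other, <- nth0, Hr by lia. f_equal; lia.
    + intros [|i]; simpl nth.
      * replace (p + 1 - 1 - Z.of_nat 0)%Z with p by lia. now rewrite zupd_same.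
      * rewrite zupd_other, Hl by lia. f_equal; lia.
    + intro i. rewrite zupd_other, nth_tl, Hr by lia. f_equal; lia.
  - eexists; split; [reflexivity|]. split; [reflexivity|split; [|split]]; simpl.
    + now rewrite zupd_same.
    + intro i. now rewrite zupd_other by lia.
    + intro i. now rewrite zupd_other by lia.
Qed.

Lemma init_shows l q : q = 0 -> shows (init l) q 0 (word_tape l).
Proof.
  intros ->. unfold init, word_tape. split; [reflexivity|]. split; [|split]; cbn [c_head c_left c_right].
  - now destruct l.
  - intro i. destruct (Z.leb_spec 0 (0 - 1 - Z.of_nat i)); [lia|]. now destruct i.
  - intro i. destruct (Z.leb_spec 0 (0 + 1 + Z.of_nat i)); [|lia].
    rewrite nth_tl. f_equal. lia.
Qed.

(** Unlike [run], this counts exactly and fails on an early halt, so that step counts add up. *)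
Fixpoint steps (M : TM) (t : nat) (c : config) : option config :=
  match t with
  | 0 => Some c
  | S t' => match step M c with None => None | Some c' => steps M t' c' end
  end.

Lemma steps_add M t u c c' c'' :
  steps M t c = Some c' -> steps M u c' = Some c'' -> steps M (t + u) c = Some c''.
Proof.
  revert c. induction t as [|t IH]; simpl; intros c H1 H2.
  - congruence.
  - destruct (step M c); [eauto|discriminate].
Qed.

Lemma steps_run M t u c c' : steps M t c = Some c' -> run M (t + u) c = run M u c'.
Proof.
  revert c. induction t as [|t IH]; simpl; intros c H1.
  - congruence.
  - destruct (step M c); [eauto|discriminate].
Qed.

Lemma run_halted M t c : step M c = None -> run M t c = Some c.
Proof. intro H; destruct t; simpl; now rewrite H. Qed.

(** * Rule tables from transition functions *)

Section FiniteControl.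
Variable Q : Type.
Variable Q_dec : forall a b : Q, {a = b} + {a <> b}.
Variable qs : list Q.
Variable delta : Q -> sym -> option (Q * sym * dir).

Fixpoint index_in (l : list Q) (q : Q) : nat :=
  match l with
  | [] => 0
  | a :: l' => if Q_dec a q then 0 else S (index_in l' q)
  end.

Definition state_code (q : Q) : nat := index_in qs q.

Definition rules_of (q : Q) (s : sym) : list rule :=
  match delta q s with
  | Some (q', w, d) => [mkRule (state_code q) s (state_code q') w d]
  | None => []
  end.

Definition tm_of_delta : TM :=
  flat_map (fun q => flat_map (rules_of q) [None; Some false; Some true]) qs.

Lemma index_in_inj l a b : In a l -> In b l -> index_in l a = index_in l b -> a = b.
Proof.
  induction l as [|c l IH]; simpl; [easy|].
  intros Ha Hb. destruct (Q_dec c a), (Q_dec c b); try congruence.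
  intro H. injection H as H. apply IH; auto; tauto.
Qed.

Lemma find_unique {A} (f : A -> bool) l r0 :
  In r0 l -> f r0 = true -> (forall r, In r l -> f r = true -> r = r0) ->
  find f l = Some r0.
Proof.
  intros H1 H2 H3. destruct (find f l) as [r|] eqn:E.
  - apply find_some in E. f_equal. apply H3; tauto.
  - pose proof (find_none _ _ E _ H1). congruence.
Qed.

Lemma sym_eqb_eq a b : sym_eqb a b = true <-> a = b.
Proof. destruct a as [[]|], b as [[]|]; simpl; split; congruence. Qed.

Lemma in_tm_of_delta r : In r tm_of_delta <->
  exists q s q' w d, In q qs /\ delta q s = Some (q', w, d) /\
    r = mkRule (state_code q) s (state_code q') w d.
Proof.
  unfold tm_of_delta. rewrite in_flat_map. split.
  - intros (q & Hq & H). apply in_flat_map in H. destruct H as (s & _ & H).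
    unfold rules_of in H. destruct (delta q s) as [[[q' w] d]|] eqn:E; [|easy].
    destruct H as [H|[]]. exists q, s, q', w, d. auto.
  - intros (q & s & q' & w & d & Hq & E & ->). exists q; split; [easy|].
    apply in_flat_map. exists s. split; [destruct s as [[]|]; simpl; tauto|].
    unfold rules_of. rewrite E. now left.
Qed.

(** Each pair of state and symbol yields at most one rule, and codes are injective on [qs]; so
    [find] has a single match, whatever the order of the table. *)
Lemma lookup_tm_of_delta q s : In q qs ->
  lookup tm_of_delta (state_code q) s =
  match delta q s with
  | Some (q', w, d) => Some (mkRule (state_code q) s (state_code q') w d)
  | None => None
  end.
Proof.
  intro Hq. unfold lookup.
  assert (Hall : forall r, In r tm_of_delta ->
    (r_q r =? state_code q) && sym_eqb (r_s r) s = true ->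
    exists q' w d, delta q s = Some (q', w, d) /\
      r = mkRule (state_code q) s (state_code q') w d).
  { intros r Hr Hf. apply in_tm_of_delta in Hr.
    destruct Hr as (q1 & s1 & q' & w & d & Hq1 & E & ->).
    apply andb_prop in Hf. simpl in Hf. destruct Hf as [Hf1 Hf2].
    apply Nat.eqb_eq in Hf1. apply sym_eqb_eq in Hf2. subst s1.
    apply index_in_inj in Hf1; auto. subst q1. eauto 10. }
  destruct (delta q s) as [[[q' w] d]|] eqn:E.
  - apply find_unique.
    + apply in_tm_of_delta. eauto 10.
    + simpl. rewrite Nat.eqb_refl. now apply sym_eqb_eq.
    + intros r Hr Hf. destruct (Hall r Hr Hf) as (? & ? & ? & H & ->). congruence.
  - destruct (find _ _) as [r|] eqn:F; [|easy].
    apply find_some in F. destruct F as [F1 F2].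
    destruct (Hall r F1 F2) as (? & ? & ? & H & _). congruence.
Qed.
End FiniteControl.

Arguments state_code {Q}.
Arguments tm_of_delta {Q}.

(** * Machines that jump over several cells at once *)

Section Jumps.
Variable Ph : Type.
Variable Ph_dec : forall a b : Ph, {a = b} + {a <> b}.
Variable phs : list Ph.
Variable J : nat.
Variable jdelta : Ph -> sym -> option (Ph * sym * Z).
Hypothesis jdelta_ok : forall ph s ph' w off, In ph phs ->
  jdelta ph s = Some (ph', w, off) -> In ph' phs /\ (Z.abs off <= Z.of_nat J)%Z.

Definition jstate_dec (a b : Ph * Z) : {a = b} + {a <> b}.
Proof. decide equality. apply Z.eq_dec. Defined.

Definition joffs : list Z :=
  map Z.of_nat (seq 0 (S J)) ++ map (fun i => (- Z.of_nat i)%Z) (seq 0 (S J)).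

Definition jstates : list (Ph * Z) := list_prod phs joffs.

(* The integer component is the number of cells still to be crossed. *)
Definition junit (a : Ph * Z) (s : sym) : option ((Ph * Z) * sym * dir) :=
  let (ph, j) := a in
  match j with
  | Z0 => match jdelta ph s with
          | Some (ph', w, off) => Some ((ph', off), w, DS)
          | None => None
          end
  | Zpos _ => Some ((ph, j - 1)%Z, s, DR)
  | Zneg _ => Some ((ph, j + 1)%Z, s, DL)
  end.

Definition jtm : TM := tm_of_delta jstate_dec jstates junit.
Definition jcode (a : Ph * Z) : nat := state_code jstate_dec jstates a.

Lemma in_jstates ph j : In ph phs -> (Z.abs j <= Z.of_nat J)%Z -> In (ph, j) jstates.
Proof.
  intros H1 H2. apply in_prod; [easy|]. apply in_or_app.
  destruct (Z_le_dec 0 j).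
  - left. apply in_map_iff. exists (Z.to_nat j). split; [lia|]. apply in_seq. lia.
  - right. apply in_map_iff. exists (Z.to_nat (- j)). split; [lia|]. apply in_seq. lia.
Qed.

(** Only moments with no pending jump (integer component 0) are observed. The number [t] is an upper
    bound, so estimates may be rounded up. *)
Definition reach (t : nat) (ph : Ph) (p : Z) (T : Z -> sym)
    (ph' : Ph) (p' : Z) (T' : Z -> sym) : Prop :=
  forall c, shows c (jcode (ph, 0%Z)) p T ->
  exists t' c', t' <= t /\ steps jtm t' c = Some c' /\ shows c' (jcode (ph', 0%Z)) p' T'.

Lemma reach_refl ph p T : reach 0 ph p T ph p T.
Proof. intros c H. exists 0, c. simpl. auto. Qed.

Lemma reach_trans t u ph p T ph' p' T' ph'' p'' T'' :
  reach t ph p T ph' p' T' -> reach u ph' p' T' ph'' p'' T'' ->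
  reach (t + u) ph p T ph'' p'' T''.
Proof.
  intros H1 H2 c Hc. destruct (H1 c Hc) as (t1 & c1 & L1 & S1 & R1).
  destruct (H2 c1 R1) as (t2 & c2 & L2 & S2 & R2).
  exists (t1 + t2), c2. split; [lia|]. split; [|easy]. eapply steps_add; eauto.
Qed.

Lemma reach_le t u ph p T ph' p' T' : t <= u ->
  reach t ph p T ph' p' T' -> reach u ph p T ph' p' T'.
Proof.
  intros H H1 c Hc. destruct (H1 c Hc) as (t1 & c1 & L1 & S1 & R1).
  exists t1, c1. split; [lia|auto].
Qed.

Lemma glide n : forall ph j p T c, In ph phs -> (Z.abs j <= Z.of_nat J)%Z ->
  Z.abs_nat j = n -> shows c (jcode (ph, j)) p T ->
  exists c', steps jtm n c = Some c' /\ shows c' (jcode (ph, 0%Z)) (p + j) T.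
Proof.
  induction n as [|n IH]; intros ph j p T c Hph Hj Hn Hc.
  - assert (j = 0%Z) by lia. subst j. exists c. split; [easy|]. now rewrite Z.add_0_r.
  - pose proof (shows_step jtm c _ p T Hc) as Hs.
    unfold jtm at 1, jcode in Hs. rewrite lookup_tm_of_delta in Hs by now apply in_jstates.
    destruct j as [|j|j]; simpl in Hs; [lia| |].
    + destruct Hs as (c1 & E1 & R1). rewrite zupd_id in R1. simpl move in R1.
      destruct (IH ph (Zpos j - 1)%Z (p + 1)%Z T c1) as (c2 & E2 & R2); auto; try lia.
      exists c2. split; [simpl; now rewrite E1|]. replace (p + Z.pos j)%Z with (p + 1 + (Z.pos j - 1))%Z by lia. easy.
    + destruct Hs as (c1 & E1 & R1). rewrite zupd_id in R1. simpl move in R1.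
      destruct (IH ph (Zneg j + 1)%Z (p - 1)%Z T c1) as (c2 & E2 & R2); auto; try lia.
      exists c2. split; [simpl; now rewrite E1|]. replace (p + Z.neg j)%Z with (p - 1 + (Z.neg j + 1))%Z by lia. easy.
Qed.

Lemma reach_jump ph p T ph' w off : In ph phs ->
  jdelta ph (T p) = Some (ph', w, off) ->
  reach (S J) ph p T ph' (p + off) (zupd T p w).
Proof.
  intros Hph E c Hc. destruct (jdelta_ok _ _ _ _ _ Hph E) as [Hph' Hoff].
  pose proof (shows_step jtm c _ p T Hc) as Hs.
  unfold jtm at 1, jcode in Hs. rewrite lookup_tm_of_delta in Hs by (apply in_jstates; [easy|lia]).
  simpl in Hs. rewrite E in Hs. destruct Hs as (c1 & E1 & R1). simpl in R1.
  destruct (glide _ ph' off p _ c1 Hph' Hoff eq_refl R1) as (c2 & E2 & R2).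
  exists (S (Z.abs_nat off)), c2. split; [lia|]. split; [|easy]. simpl. now rewrite E1.
Qed.

Lemma reach_jump_keep ph p T ph' off : In ph phs ->
  jdelta ph (T p) = Some (ph', T p, off) ->
  reach (S J) ph p T ph' (p + off) T.
Proof. intros. rewrite <- (zupd_id T p) at 2. now apply reach_jump. Qed.

Lemma shows_halted ph p T c : In ph phs -> jdelta ph (T p) = None ->
  shows c (jcode (ph, 0%Z)) p T -> step jtm c = None.
Proof.
  intros Hph E Hc. pose proof (shows_step jtm c _ p T Hc) as Hs.
  unfold jtm at 1, jcode in Hs. rewrite lookup_tm_of_delta in Hs by (apply in_jstates; [easy|lia]).
  simpl in Hs. now rewrite E in Hs.
Qed.
End Jumps.

Arguments reach {Ph}.

(** * Stack machines on a single tape *)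

(** The last argument of [IPush] is the next address. [IPop] names three: for an empty stack, a
    popped [false] and a popped [true]. *)
Inductive instr : Type :=
| IPush : nat -> bool -> nat -> instr
| IPop  : nat -> nat -> nat -> nat -> instr.

Definition stacks := nat -> list bool.

Definition supd (S : stacks) (i : nat) (l : list bool) : stacks :=
  fun j => if j =? i then l else S j.

Definition fstep (P : list instr) (x : nat * stacks) : option (nat * stacks) :=
  let (pc, S) := x in
  match nth_error P pc with
  | None => None
  | Some (IPush i b l) => Some (l, supd S i (b :: S i))
  | Some (IPop i le lf lt) =>
      match S i with
      | [] => Some (le, S)
      | b :: t => Some (if b then lt else lf, supd S i t)
      end
  end.

Fixpoint fsteps (P : list instr) (t : nat) (x : nat * stacks) : option (nat * stacks) :=
  match t with
  | 0 => Some x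
  | S t' => match fstep P x with None => None | Some y => fsteps P t' y end
  end.

Lemma fsteps_add P t u x y z :
  fsteps P t x = Some y -> fsteps P u y = Some z -> fsteps P (t + u) x = Some z.
Proof.
  revert x. induction t as [|t IH]; simpl; intros x H1 H2; [congruence|].
  destruct (fstep P x); [eauto|discriminate].
Qed.

Definition instr_reg (i : instr) : nat :=
  match i with IPush r _ _ => r | IPop r _ _ _ => r end.
Definition instr_labels (i : instr) : list nat :=
  match i with IPush _ _ l => [l] | IPop _ a b c => [a; b; c] end.

Section Layout.
Variable P : list instr.

(* Stack 0 is written from cell 0 rightwards, bottom first.  Left of it, the
   cells at and below [origin] are grouped into blocks of [width] cells; the
   first cell of block 0 carries a mark, and the [i]-th further cell of block
   [p] holds the [p]-th element (from the bottom) of stack [i].  The blank gap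
   between [origin] and 0 is where a head leaving the bottom of a stack lands. *)
Definition nreg : nat := list_max (map instr_reg P).
Definition maxlab : nat := list_max (flat_map instr_labels P).
Definition width : Z := Z.of_nat (S nreg).
Definition origin : Z := (- (width + 2))%Z.

#[local] Arguments width : simpl never.
#[local] Arguments origin : simpl never.

Definition nsym (l : list bool) (p : nat) : sym := nth p (map Some l) None.

(** Position -1 also makes sense: for every track it lies in the blank gap, which is where a pop of
    an empty stack is detected. *)
Definition cell (i : nat) (p : Z) : Z :=
  match i with 0 => p | _ => (origin - width * p - Z.of_nat i)%Z end.
Definition stride (i : nat) : Z := match i with 0 => 1%Z | _ => (- width)%Z end.

Definition tape_of (S : stacks) (z : Z) : sym :=
  if (0 <=? z)%Z then nsym (rev (S 0)) (Z.to_nat z)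
  else
    let u := (origin - z)%Z in
    if (u <? 0)%Z then None
    else
      let i := Z.to_nat (u mod width) in
      match i with
      | 0 => if Z.eqb (u / width) 0 then Some true else None
      | _ => nsym (rev (S i)) (Z.to_nat (u / width))
      end.

Lemma width_pos : (0 < width)%Z.
Proof. unfold width. lia. Qed.

Lemma nsym_app l b p : p <> length l -> nsym (l ++ [b]) p = nsym l p.
Proof.
  intro H. unfold nsym. rewrite map_app.
  destruct (Nat.lt_ge_cases p (length l)).
  - apply app_nth1. now rewrite length_map.
  - rewrite app_nth2 by (rewrite length_map; lia). rewrite length_map.
    rewrite (nth_overflow (map Some l)) by (rewrite length_map; lia).
    apply nth_overflow. simpl. lia.
Qed.

Lemma nsym_last l b : nsym (l ++ [b]) (length l) = Some b.
Proof.
  unfold nsym. rewrite map_app, app_nth2 by (rewrite length_map; lia).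
  now rewrite length_map, Nat.sub_diag.
Qed.

Lemma nsym_end l p : length l <= p -> nsym l p = None.
Proof. intro. unfold nsym. apply nth_overflow. now rewrite length_map. Qed.

Lemma nsym_some l p : p < length l -> exists b, nsym l p = Some b.
Proof.
  intro. exists (nth p l false). unfold nsym.
  rewrite (nth_indep _ None (Some false)) by now rewrite length_map.
  now rewrite map_nth.
Qed.

Lemma track_div i p : i <= nreg -> (0 <= p)%Z ->
  ((width * p + Z.of_nat i) / width = p /\ (width * p + Z.of_nat i) mod width = Z.of_nat i)%Z.
Proof.
  intros Hi Hp. pose proof width_pos.
  assert (0 <= Z.of_nat i < width)%Z by (unfold width; lia).
  rewrite Z.mul_comm. rewrite Z.div_add_l, Z.div_small by lia.
  rewrite (Z.add_comm (p * width)), Z.mod_add, Z.mod_small by lia. lia.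
Qed.

Lemma tape_of_cell S i p : i <= nreg -> tape_of S (cell i (Z.of_nat p)) = nsym (rev (S i)) p.
Proof.
  intro Hi. unfold tape_of, cell. destruct i as [|i].
  - destruct (Z.leb_spec 0 (Z.of_nat p)); [|lia]. now rewrite Nat2Z.id.
  - pose proof width_pos. assert (0 <= width * Z.of_nat p)%Z by nia.
    destruct (Z.leb_spec 0 (origin - width * Z.of_nat p - Z.of_nat (Datatypes.S i))); [unfold origin in *; lia|].
    destruct (Z.ltb_spec (origin - (origin - width * Z.of_nat p - Z.of_nat (Datatypes.S i))) 0); [lia|].
    replace (origin - (origin - width * Z.of_nat p - Z.of_nat (Datatypes.S i)))%Z
      with (width * Z.of_nat p + Z.of_nat (Datatypes.S i))%Z by lia.
    destruct (track_div (Datatypes.S i) (Z.of_nat p) Hi) as [E1 E2]; [lia|].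
    rewrite E1, E2, !Nat2Z.id. reflexivity.
Qed.

Lemma tape_of_mark S p : tape_of S (origin - width * Z.of_nat p) = if p =? 0 then Some true else None.
Proof.
  unfold tape_of. pose proof width_pos. assert (0 <= width * Z.of_nat p)%Z by nia.
  destruct (Z.leb_spec 0 (origin - width * Z.of_nat p)); [unfold origin in *; lia|].
  destruct (Z.ltb_spec (origin - (origin - width * Z.of_nat p)) 0); [lia|].
  replace (origin - (origin - width * Z.of_nat p))%Z with (width * Z.of_nat p + Z.of_nat 0)%Z by lia.
  destruct (track_div 0 (Z.of_nat p)) as [E1 E2]; [lia|lia|].
  rewrite E1, E2. cbn -[Z.eqb]. destruct p; reflexivity.
Qed.

Lemma tape_of_gap S z : (origin < z < 0)%Z -> tape_of S z = None.
Proof.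
  intro H. unfold tape_of. destruct (Z.leb_spec 0 z); [lia|].
  destruct (Z.ltb_spec (origin - z) 0); [easy|lia].
Qed.

Lemma tape_of_other S i b l z : z <> cell i (Z.of_nat (length l)) ->
  tape_of (supd S i (b :: l)) z = tape_of (supd S i l) z.
Proof.
  intro H. unfold tape_of. pose proof width_pos.
  destruct (Z.leb_spec 0 z).
  - unfold supd. destruct (Nat.eqb_spec 0 i) as [<-|]; [|easy].
    simpl. apply nsym_app. rewrite length_rev. unfold cell in H. lia.
  - destruct (Z.ltb_spec (origin - z) 0); [easy|].
    destruct (Z.to_nat ((origin - z) mod width)) as [|j] eqn:E; [easy|].
    unfold supd. destruct (Nat.eqb_spec (Datatypes.S j) i) as [<-|]; [|easy].
    cbn [rev]. apply nsym_app. rewrite length_rev. intro E2. apply H.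
    unfold cell.
    (* Quotient and remainder recover the position and the track from [z], so agreement in both
       forces [z] to be the excluded cell. *)
    pose proof (Z.div_mod (origin - z) width ltac:(lia)) as H3.
    pose proof (Z.mod_pos_bound (origin - z) width ltac:(lia)) as H4.
    pose proof (Z.div_pos (origin - z) width ltac:(lia) ltac:(lia)) as H5.
    rewrite <- E2, <- E. rewrite (Z2Nat.id _ H5), (Z2Nat.id _ (proj1 H4)).
    lia.
Qed.

Lemma supd_id S i : supd S i (S i) = S.
Proof.
  apply functional_extensionality; intro j. unfold supd.
  destruct (Nat.eqb_spec j i); congruence.
Qed.

Lemma supd_same S i l : supd S i l i = l.
Proof. unfold supd. now rewrite Nat.eqb_refl. Qed.

Lemma tape_push S i b : i <= nreg ->
  zupd (tape_of S) (cell i (Z.of_nat (length (S i)))) (Some b) = tape_of (supd S i (b :: S i)).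
Proof.
  intro Hi. apply functional_extensionality; intro z. unfold zupd.
  destruct (Z.eqb_spec z (cell i (Z.of_nat (length (S i))))) as [->|Hz].
  - rewrite tape_of_cell, supd_same by easy. simpl. rewrite <- (length_rev (S i)).
    now rewrite nsym_last.
  - rewrite tape_of_other by easy. now rewrite supd_id.
Qed.

Lemma tape_pop S i b t : i <= nreg -> S i = b :: t ->
  zupd (tape_of S) (cell i (Z.of_nat (length t))) None = tape_of (supd S i t).
Proof.
  intros Hi E. apply functional_extensionality; intro z. unfold zupd.
  destruct (Z.eqb_spec z (cell i (Z.of_nat (length t)))) as [->|Hz].
  - rewrite tape_of_cell, supd_same by easy. rewrite nsym_end; [easy|]. now rewrite length_rev.
  - rewrite <- (tape_of_other S i b t) by easy. now rewrite <- E, supd_id.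
Qed.

(** One instruction is one round trip. [Disp] jumps from the origin to the bottom of the stack and
    [Scan] climbs to the first blank. There a push writes, while a pop steps back and reads in
    [Take]. The way home differs: [RetR] walks left along stack 0 until the blank gap, [RetT] goes
    by whole blocks until the mark. *)
Inductive phase : Type :=
| Boot | Mark | Fin
| Disp (pc : nat) | Scan (pc : nat) | Take (pc : nat) | RetR (l : nat) | RetT (l : nat).

Definition phase_dec (a b : phase) : {a = b} + {a <> b}.
Proof. decide equality; apply Nat.eq_dec. Defined.

Definition phases : list phase :=
  [Boot; Mark; Fin] ++
  flat_map (fun l => [Disp l; Scan l; Take l; RetR l; RetT l]) (seq 0 (S maxlab)).

Definition ret (i l : nat) : phase := match i with 0 => RetR l | _ => RetT l end.
(** On a track, adding [i] leads to the first cell of the same block, the column that contains only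
    the mark. *)
Definition ret_off (i : nat) : Z := match i with 0 => (-1)%Z | _ => Z.of_nat i end.

Definition pdelta (ph : phase) (s : sym) : option (phase * sym * Z) :=
  match ph with
  | Boot => Some (Mark, s, origin)
  | Mark => Some (Disp 0, Some true, 0%Z)
  | Fin => None
  | Disp pc =>
      match nth_error P pc with
      | None => Some (Fin, s, (- origin)%Z)
      | Some ins => Some (Scan pc, s, (cell (instr_reg ins) 0 - origin)%Z)
      end
  | Scan pc =>
      match nth_error P pc with
      | None => None
      | Some ins =>
          match s with
          | Some _ => Some (Scan pc, s, stride (instr_reg ins))
          | None =>
              match ins with
              | IPush i b l => Some (ret i l, Some b, ret_off i)
              | IPop i _ _ _ => Some (Take pc, s, (- stride i)%Z)
              end
          end
      end
  | Take pc =>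
      match nth_error P pc with
      | Some (IPop i le lf lt) =>
          match s with
          | None => Some (Disp le, s, (origin - cell i (-1))%Z)
          | Some b => Some (ret i (if b then lt else lf), None, ret_off i)
          end
      | _ => None
      end
  | RetR l =>
      match s with
      | Some _ => Some (RetR l, s, (-1)%Z)
      | None => Some (Disp l, s, (origin + 1)%Z)
      end
  | RetT l =>
      match s with
      | None => Some (RetT l, s, width)
      | Some _ => Some (Disp l, s, 0%Z)
      end
  end.

(** This is [width + 2], the distance between the origin and cell 0, which is the longest jump. *)
Definition jump_bound : nat := nreg + 3.

Lemma list_max_in l x : In x l -> x <= list_max l.
Proof.
  intro H. pose proof (proj1 (list_max_le l (list_max l)) (Nat.le_refl _)) as F.
  rewrite Forall_forall in F. auto.
Qed.

Lemma reg_bound pc ins : nth_error P pc = Some ins -> instr_reg ins <= nreg.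
Proof. intro H. apply list_max_in, in_map, (nth_error_In _ _ H). Qed.

Lemma label_bound pc ins l : nth_error P pc = Some ins -> In l (instr_labels ins) -> l <= maxlab.
Proof.
  intros H Hl. apply list_max_in, in_flat_map. exists ins. split; [|easy].
  eapply nth_error_In; eauto.
Qed.

Lemma in_phases ph :
  match ph with
  | Boot | Mark | Fin => True
  | Disp l | Scan l | Take l | RetR l | RetT l => l <= maxlab
  end -> In ph phases.
Proof.
  intro H. unfold phases.
  destruct ph; try (simpl; tauto);
    (apply in_or_app; right; apply in_flat_map; eexists; split; [apply in_seq; split; [apply Nat.le_0_l|]; apply le_n_S; exact H | simpl; tauto]).
Qed.

Lemma phases_bound ph : In ph phases ->
  match ph with
  | Boot | Mark | Fin => True
  | Disp l | Scan l | Take l | RetR l | RetT l => l <= maxlab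
  end.
Proof.
  unfold phases. intro H. apply in_app_or in H. destruct H as [H|H].
  - simpl in H. repeat destruct H as [<-|H]; easy.
  - apply in_flat_map in H. destruct H as (l & Hl & H). apply in_seq in Hl.
    simpl in H. repeat destruct H as [<-|H]; try lia; easy.
Qed.

(* [injection] would also reduce the integer components. *)
Lemma some_triple {A B C} (a a' : A) (b b' : B) (c c' : C) :
  Some (a, b, c) = Some (a', b', c') -> a = a' /\ b = b' /\ c = c'.
Proof. intro H. inversion H. auto. Qed.

Lemma pdelta_ok ph s ph' w off : In ph phases -> pdelta ph s = Some (ph', w, off) ->
  In ph' phases /\ (Z.abs off <= Z.of_nat jump_bound)%Z.
Proof.
  intros Hph E. apply phases_bound in Hph.
  assert (HJ : Z.of_nat jump_bound = (width + 2)%Z) by (unfold jump_bound, width; lia).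
  pose proof width_pos as Hw. rewrite HJ.
  destruct ph as [| | |pc|pc|pc|l|l]; cbn [pdelta] in E.
  - apply some_triple in E; destruct E as (<- & <- & <-). split; [now apply in_phases|unfold origin; lia].
  - apply some_triple in E; destruct E as (<- & <- & <-). split; [apply in_phases; lia|lia].
  - discriminate.
  - destruct (nth_error P pc) as [ins|] eqn:F; apply some_triple in E; destruct E as (<- & <- & <-).
    + split; [now apply in_phases|]. apply reg_bound in F.
      unfold cell, origin, width in *. destruct (instr_reg ins); lia.
    + split; [now apply in_phases|unfold origin; lia].
  - destruct (nth_error P pc) as [ins|] eqn:F; [|discriminate].
    pose proof (reg_bound _ _ F) as Hr. pose proof (fun l => label_bound _ _ l F) as Hl.
    assert (Hs : (Z.abs (stride (instr_reg ins)) <= width + 2)%Z).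
    { unfold stride. destruct (instr_reg ins); lia. }
    destruct s as [b|]; [apply some_triple in E; destruct E as (<- & <- & <-); split; [now apply in_phases|easy]|].
    destruct ins as [i b l|i le lf lt]; cbn [instr_reg instr_labels In] in *.
    + apply some_triple in E; destruct E as (<- & <- & <-). specialize (Hl l (or_introl eq_refl)).
      unfold ret, ret_off, width in *. destruct i; (split; [now apply in_phases|lia]).
    + apply some_triple in E; destruct E as (<- & <- & <-). split; [now apply in_phases|lia].
  - destruct (nth_error P pc) as [[|i le lf lt]|] eqn:F; try discriminate.
    pose proof (reg_bound _ _ F) as Hr. pose proof (fun l => label_bound _ _ l F) as Hl.
    cbn [instr_reg instr_labels In] in *.
    destruct s as [b|]; apply some_triple in E; destruct E as (<- & <- & <-).
    + assert (Hb : (if b then lt else lf) <= maxlab) by (destruct b; auto).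
      unfold ret, ret_off, width in *. destruct i; (split; [now apply in_phases|lia]).
    + split; [apply in_phases; auto|]. unfold cell, origin, width in *. destruct i; lia.
  - destruct s; apply some_triple in E; destruct E as (<- & <- & <-); (split; [now apply in_phases|unfold origin; lia]).
  - destruct s; apply some_triple in E; destruct E as (<- & <- & <-); (split; [now apply in_phases|lia]).
Qed.

Definition stack_tm : TM := jtm phase phase_dec phases jump_bound pdelta.

Notation reach' := (reach phase_dec phases jump_bound pdelta).
Notation "'JB'" := (S jump_bound) (only parsing).

Lemma jump_keep ph p T ph' off : In ph phases ->
  pdelta ph (T p) = Some (ph', T p, off) -> reach' JB ph p T ph' (p + off)%Z T.
Proof. apply reach_jump_keep, pdelta_ok. Qed.

Lemma jump_write ph p T ph' w off : In ph phases ->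
  pdelta ph (T p) = Some (ph', w, off) -> reach' JB ph p T ph' (p + off)%Z (zupd T p w).
Proof. apply reach_jump, pdelta_ok. Qed.

Lemma cell_stride i p : (cell i p + stride i = cell i (p + 1))%Z.
Proof. unfold cell, stride. destruct i; lia. Qed.

Lemma scan_up S pc ins n : nth_error P pc = Some ins -> pc <= maxlab ->
  forall p, p + n = length (S (instr_reg ins)) ->
  reach' (n * JB) (Scan pc) (cell (instr_reg ins) (Z.of_nat p)) (tape_of S)
    (Scan pc) (cell (instr_reg ins) (Z.of_nat (length (S (instr_reg ins))))) (tape_of S).
Proof.
  intros F Hpc. pose proof (reg_bound _ _ F) as Hr.
  induction n as [|n IH]; intros p Hp.
  - rewrite <- Hp, Nat.add_0_r. apply reach_refl.
  - destruct (nsym_some (rev (S (instr_reg ins))) p) as [b Hb]; [rewrite length_rev; lia|].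
    change (Datatypes.S n * JB) with (JB + n * JB).
    eapply reach_trans.
    + eapply jump_keep; [now apply in_phases|].
      rewrite tape_of_cell, Hb by easy. simpl. rewrite F. reflexivity.
    + rewrite cell_stride. replace (Z.of_nat p + 1)%Z with (Z.of_nat (p + 1)) by lia.
      apply IH. lia.
Qed.

Lemma return_raw S l n : l <= maxlab -> n <= length (S 0) ->
  reach' ((n + 1) * JB) (RetR l) (Z.of_nat n - 1)%Z (tape_of S) (Disp l) origin (tape_of S).
Proof.
  intros Hl. induction n as [|n IH]; intro Hn.
  - rewrite Nat.mul_1_l. replace origin with (Z.of_nat 0 - 1 + (origin + 1))%Z by lia.
    apply jump_keep; [now apply in_phases|].
    rewrite tape_of_gap by (pose proof width_pos; unfold origin; lia). reflexivity.
  - change ((Datatypes.S n + 1) * JB) with (JB + (n + 1) * JB).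
    destruct (nsym_some (rev (S 0)) n) as [b Hb]; [rewrite length_rev; lia|].
    eapply reach_trans; [|apply IH; lia].
    replace (Z.of_nat n - 1)%Z with (Z.of_nat (Datatypes.S n) - 1 + -1)%Z by lia.
    apply jump_keep; [now apply in_phases|].
    replace (Z.of_nat (Datatypes.S n) - 1)%Z with (cell 0 (Z.of_nat n)) by (unfold cell; lia).
    rewrite tape_of_cell, Hb by lia. reflexivity.
Qed.

Lemma return_track S l n : l <= maxlab ->
  reach' ((n + 1) * JB) (RetT l) (origin - width * Z.of_nat n)%Z (tape_of S)
    (Disp l) origin (tape_of S).
Proof.
  intros Hl. induction n as [|n IH].
  - rewrite Nat.mul_1_l.
    replace origin with (origin - width * Z.of_nat 0 + 0)%Z at 2 by lia.
    apply jump_keep; [now apply in_phases|].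
    rewrite tape_of_mark. reflexivity.
  - change ((Datatypes.S n + 1) * JB) with (JB + (n + 1) * JB).
    eapply reach_trans; [|exact IH].
    replace (origin - width * Z.of_nat n)%Z
      with (origin - width * Z.of_nat (Datatypes.S n) + width)%Z by lia.
    apply jump_keep; [now apply in_phases|].
    rewrite tape_of_mark. reflexivity.
Qed.

Lemma return_any S i l n : i <= nreg -> l <= maxlab -> n <= length (S i) ->
  reach' ((n + 1) * JB) (ret i l) (cell i (Z.of_nat n) + ret_off i)%Z (tape_of S)
    (Disp l) origin (tape_of S).
Proof.
  intros Hi Hl Hn. destruct i as [|i]; unfold ret, cell, ret_off.
  - now apply return_raw.
  - rewrite Z.sub_add.
    now apply return_track.
Qed.

Lemma cell_below S i : i <= nreg -> tape_of S (cell i (-1)) = None.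
Proof.
  intro H. apply tape_of_gap. pose proof width_pos. unfold cell, origin, width in *.
  destruct i; lia.
Qed.

(** The cost is one climb and one return over at most [L] elements, plus a constant number of
    jumps. *)
Lemma reach_fstep S pc S' pc' L : pc <= maxlab -> fstep P (pc, S) = Some (pc', S') ->
  (forall i, length (S i) <= L) ->
  pc' <= maxlab /\
  reach' ((2 * L + 4) * JB) (Disp pc) origin (tape_of S) (Disp pc') origin (tape_of S').
Proof.
  intros Hpc E HL. simpl in E. destruct (nth_error P pc) as [ins|] eqn:F; [|discriminate].
  pose proof (reg_bound _ _ F) as Hr. pose proof (fun l => label_bound _ _ l F) as Hl.
  assert (R0 : reach' (JB + length (S (instr_reg ins)) * JB) (Disp pc) origin (tape_of S)
     (Scan pc) (cell (instr_reg ins) (Z.of_nat (length (S (instr_reg ins))))) (tape_of S)).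
  { eapply reach_trans.
    - apply jump_keep; [now apply in_phases|]. simpl. rewrite F. reflexivity.
    - replace (origin + (cell (instr_reg ins) 0 - origin))%Z with (cell (instr_reg ins) (Z.of_nat 0)) by (change (Z.of_nat 0) with 0%Z; lia).
      now apply scan_up. }
  destruct ins as [i b l|i le lf lt]; simpl in Hr, R0, Hl.
  - injection E as <- <-. specialize (Hl l (or_introl eq_refl)). split; [easy|].
    eapply reach_le; [|eapply reach_trans; [exact R0|eapply reach_trans]].
    2:{ apply jump_write; [now apply in_phases|].
        rewrite tape_of_cell, nsym_end by (try rewrite length_rev; lia). simpl. rewrite F. reflexivity. }
    2:{ rewrite tape_push by easy. apply return_any; auto. rewrite supd_same. simpl. lia. }
    specialize (HL i). nia.
  - assert (R1 : reach' (JB + length (S i) * JB + JB) (Disp pc) origin (tape_of S)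
     (Take pc) (cell i (Z.of_nat (length (S i)) - 1)) (tape_of S)).
    { eapply reach_trans; [exact R0|].
      replace (cell i (Z.of_nat (length (S i)) - 1)) with (cell i (Z.of_nat (length (S i))) + (- stride i))%Z
        by (pose proof (cell_stride i (Z.of_nat (length (S i)) - 1)) as Hc; rewrite Z.sub_add in Hc; lia).
      apply jump_keep; [now apply in_phases|].
      rewrite tape_of_cell, nsym_end by (try rewrite length_rev; lia). simpl. rewrite F. reflexivity. }
    destruct (S i) as [|b t] eqn:Ei.
    + injection E as <- <-. split; [auto|].
      assert (R2 : reach' JB (Take pc) (cell i (-1)) (tape_of S) (Disp le) origin (tape_of S)).
      { replace origin with (cell i (-1) + (origin - cell i (-1)))%Z by lia.
        apply jump_keep; [now apply in_phases|].
        rewrite cell_below by easy. simpl. rewrite F. reflexivity. }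
      eapply reach_le; [|eapply reach_trans; [exact R1|exact R2]].
      simpl length. nia.
    + injection E as <- <-. assert (Hb : (if b then lt else lf) <= maxlab) by (destruct b; auto).
      split; [easy|].
      replace (Z.of_nat (length (b :: t)) - 1)%Z with (Z.of_nat (length t)) in R1 by (simpl length; lia).
      eapply reach_le; [|eapply reach_trans; [exact R1|eapply reach_trans]].
      2:{ apply jump_write; [now apply in_phases|].
          rewrite tape_of_cell, Ei by lia. simpl rev. rewrite <- (length_rev t), nsym_last.
          simpl. rewrite F. reflexivity. }
      2:{ rewrite (tape_pop S i b t) by easy. apply return_any; auto. rewrite supd_same. lia. }
      specialize (HL i). rewrite Ei in HL. simpl length in *. nia.
Qed.

Lemma fstep_length pc S pc' S' L : fstep P (pc, S) = Some (pc', S') ->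
  (forall i, length (S i) <= L) -> forall i, length (S' i) <= Datatypes.S L.
Proof.
  intros E HL i. simpl in E. pose proof (HL i).
  destruct (nth_error P pc) as [[j b l|j le lf lt]|]; [| |discriminate].
  - injection E as <- <-. unfold supd. destruct (i =? j); [|lia]. simpl. apply le_n_S, HL.
  - specialize (HL j). destruct (S j); injection E as <- <-; [lia|].
    unfold supd. destruct (i =? j); simpl in *; lia.
Qed.

(** An instruction lengthens a stack by at most one element, so [L + t] bounds all stacks throughout
    and the total cost is quadratic. *)
Lemma reach_fsteps t : forall pc S pc' S' L, pc <= maxlab ->
  fsteps P t (pc, S) = Some (pc', S') -> (forall i, length (S i) <= L) ->
  pc' <= maxlab /\
  reach' (t * ((2 * (L + t) + 4) * JB)) (Disp pc) origin (tape_of S) (Disp pc') origin (tape_of S').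
Proof.
  induction t as [|t IH]; intros pc S pc' S' L Hpc E HL.
  - simpl in E. injection E as <- <-. split; [easy|apply reach_refl].
  - cbn [fsteps] in E. destruct (fstep P (pc, S)) as [[pc1 S1]|] eqn:E1; [|discriminate].
    destruct (reach_fstep _ _ _ _ L Hpc E1 HL) as [H1 R1].
    destruct (IH pc1 S1 pc' S' (Datatypes.S L) H1 E (fstep_length _ _ _ _ _ E1 HL)) as [H2 R2].
    split; [easy|]. eapply reach_le; [|eapply reach_trans; [exact R1|exact R2]].
    replace (2 * (Datatypes.S L + t) + 4) with (2 * (L + Datatypes.S t) + 4) by lia.
    nia.
Qed.

Lemma take_bits_nsym l : forall bs, (forall i, nth i l None = nsym bs i) -> take_bits l = bs.
Proof.
  induction l as [|s l IH]; intros bs H.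
  - destruct bs as [|b bs]; [easy|]. specialize (H 0). discriminate.
  - pose proof (H 0) as H0. simpl in H0. destruct bs as [|b bs]; subst s; simpl; [easy|].
    f_equal. apply IH. intro i. apply (H (S i)).
Qed.

(** The initial tape already is a layout: the input written from cell 0 is stack 0 with the last bit
    on top. Only the mark is missing. *)
Definition start_stacks (x : list bool) : stacks := fun i => match i with 0 => rev x | _ => [] end.

Lemma tape_of_start x z : z <> origin -> tape_of (start_stacks x) z =
  if (0 <=? z)%Z then nsym x (Z.to_nat z) else None.
Proof.
  intro Hz. unfold tape_of. change (start_stacks x 0) with (rev x). rewrite rev_involutive.
  destruct (0 <=? z)%Z; [easy|]. pose proof width_pos.
  destruct (Z.ltb_spec (origin - z) 0); [easy|].
  destruct (Z.to_nat ((origin - z) mod width)) as [|i] eqn:E.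
  - destruct (Z.eqb_spec ((origin - z) / width) 0); [|easy].
    pose proof (Z.div_mod (origin - z) width ltac:(lia)).
    pose proof (Z.mod_pos_bound (origin - z) width ltac:(lia)). nia.
  - now rewrite nsym_end by apply Nat.le_0_l.
Qed.

Lemma stack_tm_run x t pc' S' out :
  fsteps P t (0, start_stacks x) = Some (pc', S') -> nth_error P pc' = None -> S' 0 = rev out ->
  exists cfg, run stack_tm (JB * (3 + t * (2 * (length x + t) + 4))) (init (map Some x)) = Some cfg /\
    output cfg = out.
Proof.
  intros E Hpc' Hout. pose proof width_pos as Hw.
  set (T0 := word_tape (map Some x)).
  (* [Boot] with offset 0 heads the list of states, so its code computes to the start state 0. *)
  pose proof (init_shows (map Some x) (jcode phase phase_dec phases jump_bound (Boot, 0%Z)) eq_refl) as Hinit.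
  assert (R0 : reach' (JB + JB) Boot 0 T0 (Disp 0) origin (tape_of (start_stacks x))).
  { eapply reach_trans.
    - apply jump_keep; [now apply in_phases|]. reflexivity.
    - replace (tape_of (start_stacks x)) with (zupd T0 origin (Some true)).
      + replace origin with (origin + 0)%Z at 2 by lia.
        apply jump_write; [now apply in_phases|]. reflexivity.
      + apply functional_extensionality; intro z. unfold zupd.
        destruct (Z.eqb_spec z origin) as [->|Hz].
        * pose proof (tape_of_mark (start_stacks x) 0) as Hm.
          change (Z.of_nat 0) with 0%Z in Hm. rewrite Z.mul_0_r, Z.sub_0_r in Hm. now rewrite Hm.
        * now rewrite tape_of_start. }
  destruct (reach_fsteps t 0 (start_stacks x) pc' S' (length x) ltac:(lia) E) as [H1 R1].
  { intros [|i]; simpl; [now rewrite length_rev|lia]. }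
  assert (R2 : reach' JB (Disp pc') origin (tape_of S') Fin (origin + - origin) (tape_of S')).
  { apply jump_keep; [now apply in_phases|]. simpl. now rewrite Hpc'. }
  rewrite Z.add_opp_diag_r in R2.
  assert (R : reach' (JB + JB + t * (2 * (length x + t) + 4) * JB + JB) Boot 0%Z T0 Fin 0%Z (tape_of S')).
  { eapply reach_trans; [eapply reach_trans; [exact R0|]|exact R2]. now rewrite <- Nat.mul_assoc. }
  destruct (R _ Hinit) as (t' & c' & Ht & Hs & Hc).
  exists c'. split.
  - replace (JB * (3 + t * (2 * (length x + t) + 4))) with (t' + (JB * (3 + t * (2 * (length x + t) + 4)) - t')) by nia.
    erewrite steps_run by exact Hs. apply run_halted.
    eapply (shows_halted _ _ _ _ _ Fin 0%Z); [now apply in_phases|reflexivity|exact Hc].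
  - unfold output. apply take_bits_nsym. destruct Hc as (_ & Hh & _ & Hr).
    assert (HT : forall i, tape_of S' (Z.of_nat i) = nsym out i).
    { intro i. change (Z.of_nat i) with (cell 0 (Z.of_nat i)). rewrite tape_of_cell by lia.
      now rewrite Hout, rev_involutive. }
    intros [|i]; simpl.
    + rewrite Hh. apply (HT 0).
    + rewrite Hr. rewrite <- HT. f_equal. lia.
Qed.
End Layout.

(** * Polynomial bounds *)

(** The base [n + 1] is positive, so raising the exponent never lowers the bound; this makes closure
    under sums immediate. *)
Definition poly_bounded (f : nat -> nat) : Prop :=
  exists c k, forall n, f n <= c * (n + 1) ^ k.

Lemma poly_bounded_const a : poly_bounded (fun _ => a).
Proof. exists a, 0. intro n. simpl. lia. Qed.

Lemma poly_bounded_id : poly_bounded (fun n => n).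
Proof. exists 1, 1. intro n. simpl. lia. Qed.

Lemma poly_bounded_add f g :
  poly_bounded f -> poly_bounded g -> poly_bounded (fun n => f n + g n).
Proof.
  intros (c & k & Hf) (d & l & Hg). exists (c + d), (k + l). intro n.
  specialize (Hf n). specialize (Hg n). rewrite Nat.pow_add_r.
  assert ((n + 1) ^ k <> 0) by (apply Nat.pow_nonzero; lia).
  assert ((n + 1) ^ l <> 0) by (apply Nat.pow_nonzero; lia).
  assert ((n + 1) ^ k <= (n + 1) ^ k * (n + 1) ^ l) by nia.
  assert ((n + 1) ^ l <= (n + 1) ^ k * (n + 1) ^ l) by nia.
  nia.
Qed.

Lemma poly_bounded_mul f g :
  poly_bounded f -> poly_bounded g -> poly_bounded (fun n => f n * g n).
Proof.
  intros (c & k & Hf) (d & l & Hg). exists (c * d), (k + l). intro n.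
  rewrite Nat.pow_add_r.
  replace (c * d * ((n + 1) ^ k * (n + 1) ^ l)) with (c * (n + 1) ^ k * (d * (n + 1) ^ l)) by ring.
  now apply Nat.mul_le_mono.
Qed.

Lemma poly_bounded_pow f k : poly_bounded f -> poly_bounded (fun n => f n ^ k).
Proof.
  intro H. induction k as [|k IH]; simpl.
  - apply poly_bounded_const.
  - now apply poly_bounded_mul.
Qed.

Lemma poly_bounded_poly c k : poly_bounded (fun n => poly c k n).
Proof.
  unfold poly. apply poly_bounded_add; [|apply poly_bounded_const].
  apply poly_bounded_mul; [apply poly_bounded_const|].
  apply poly_bounded_pow, poly_bounded_id.
Qed.

(** For positive n, (n + 1)^k is at most 2^k n^k; the additive constant of [poly] takes care of n =
    0. *)
Lemma poly_bounded_le_poly f : poly_bounded f -> exists c k, forall n, f n <= poly c k n.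
Proof.
  intros (c & k & H). exists (c * 2 ^ k), k. intro n. eapply Nat.le_trans; [apply H|].
  unfold poly. assert (2 ^ k <> 0) by (apply Nat.pow_nonzero; lia).
  destruct n as [|n].
  - simpl. rewrite Nat.pow_1_l. nia.
  - assert ((S n + 1) ^ k <= 2 ^ k * S n ^ k).
    { rewrite <- Nat.pow_mul_l. apply Nat.pow_le_mono_l. lia. }
    nia.
Qed.

Lemma run_mono M t : forall u c c', run M t c = Some c' -> t <= u -> run M u c = Some c'.
Proof.
  induction t as [|t IH]; intros u c c' H Hu; simpl in H; destruct u as [|u]; simpl;
    destruct (step M c); try easy; try lia. eapply IH; eauto. lia.
Qed.

Lemma stack_program_computable P f tb :
  (forall x, exists t pc S, t <= tb (length x) /\
     fsteps P t (0, start_stacks x) = Some (pc, S) /\ nth_error P pc = None /\ S 0 = rev (f x)) ->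
  poly_bounded tb -> PolyTimeComputable f.
Proof.
  intros H Htb.
  destruct (poly_bounded_le_poly
    (fun n => S (jump_bound P) * (3 + tb n * (2 * (n + tb n) + 4)))) as (c & k & Hck).
  { repeat first [apply poly_bounded_mul | apply poly_bounded_add | apply poly_bounded_const
                 | apply poly_bounded_id | exact Htb]. }
  exists (stack_tm P), c, k. intro x. destruct (H x) as (t & pc & S & Ht & E & E1 & E2).
  destruct (stack_tm_run P x t pc S (f x) E E1 E2) as (cfg & R & O).
  exists cfg. split; [|easy]. eapply run_mono; [exact R|].
  eapply Nat.le_trans; [|apply Hck]. apply Nat.mul_le_mono_l, Nat.add_le_mono_l.
  apply Nat.mul_le_mono; [easy|lia].
Qed.

(** * A language of unary counters *)

Record hstate : Type := mkH { hr : nat -> nat; hx : list bool; ho : list bool }.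

Definition setr (s : hstate) (r v : nat) : hstate :=
  mkH (fun j => if j =? r then v else hr s j) (hx s) (ho s).
Definition out (s : hstate) (l : list bool) : hstate := mkH (hr s) (hx s) (ho s ++ l).

(* [Loop] is a while loop: it decrements [r] before each run of the body, which
   may itself change [r].  [CaseX] consumes an input bit. *)
Inductive cmd : Type :=
| Skip | Inc (r : nat) | Emit (b : bool) | Seq (c1 c2 : cmd)
| Loop (r : nat) (c : cmd) | IfZ (r : nat) (c1 c2 : cmd) | CaseX (c0 c1 : cmd).

(* [ev c s s' t]: within [t] steps, [c] takes [s] to [s']. *)
Inductive ev : cmd -> hstate -> hstate -> nat -> Prop :=
| ev_skip s : ev Skip s s 0
| ev_inc r s : ev (Inc r) s (setr s r (S (hr s r))) 1
| ev_emit b s : ev (Emit b) s (out s [b]) 1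
| ev_seq c1 c2 s s1 s2 t1 t2 : ev c1 s s1 t1 -> ev c2 s1 s2 t2 -> ev (Seq c1 c2) s s2 (t1 + t2)
| ev_loop0 r c s : hr s r = 0 -> ev (Loop r c) s s 1
| ev_loopS r c s n s1 s2 t1 t2 : hr s r = S n -> ev c (setr s r n) s1 t1 ->
    ev (Loop r c) s1 s2 t2 -> ev (Loop r c) s s2 (1 + t1 + t2)
| ev_ifz r c1 c2 s s' t : hr s r = 0 -> ev c1 s s' t -> ev (IfZ r c1 c2) s s' (1 + t)
| ev_ifs r c1 c2 s s' t : hr s r <> 0 -> ev c2 s s' t -> ev (IfZ r c1 c2) s s' (2 + t)
| ev_casex c0 c1 s b l s' t : hx s = b :: l ->
    ev (if b then c1 else c0) (mkH (hr s) l (ho s)) s' t -> ev (CaseX c0 c1) s s' (1 + t)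
| ev_le c s s' t u : ev c s s' t -> t <= u -> ev c s s' u.

(* Code for [c] placed at address [a] and continuing at [ex]: entry point and instructions. *)
Fixpoint comp (c : cmd) (a ex : nat) : nat * list instr :=
  match c with
  | Skip => (ex, [])
  | Inc r => (a, [IPush (r + 2) true ex])
  | Emit b => (a, [IPush 0 b ex])
  | Seq c1 c2 =>
      let (e2, k2) := comp c2 a ex in
      let (e1, k1) := comp c1 (a + length k2) e2 in (e1, k2 ++ k1)
  | Loop r c =>
      let (e, k) := comp c (a + 1) a in (a, IPop (r + 2) ex e e :: k)
  | IfZ r c1 c2 =>
      let (e1, k1) := comp c1 (a + 2) ex in
      let (e2, k2) := comp c2 (a + 2 + length k1) ex in
      (a, IPop (r + 2) e1 (a + 1) (a + 1) :: IPush (r + 2) true e2 :: k1 ++ k2)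
  | CaseX c0 c1 =>
      let (e0, k0) := comp c0 (a + 1) ex in
      let (e1, k1) := comp c1 (a + 1 + length k0) ex in
      (a, IPop 1 ex e0 e1 :: k0 ++ k1)
  end.

(** The output stack has the latest bit on top, so on the tape it reads from left to right starting
    at cell 0. Registers are unary. *)
Definition stacks_of (s : hstate) : stacks := fun i =>
  match i with 0 => rev (ho s) | 1 => hx s | S (S r) => repeat true (hr s r) end.

Definition code_at (P : list instr) (a : nat) (k : list instr) : Prop :=
  forall i ins, nth_error k i = Some ins -> nth_error P (a + i) = Some ins.

Lemma code_at_cons P a i k : code_at P a (i :: k) ->
  nth_error P a = Some i /\ code_at P (a + 1) k.
Proof.
  intro H. split.
  - rewrite <- (Nat.add_0_r a). now apply H.
  - intros j ins Hj. rewrite <- Nat.add_assoc. now apply H.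
Qed.

Lemma code_at_app P a k1 k2 : code_at P a (k1 ++ k2) ->
  code_at P a k1 /\ code_at P (a + length k1) k2.
Proof.
  intro H. split.
  - intros j ins Hj. apply H. rewrite nth_error_app1; [easy|].
    apply nth_error_Some. congruence.
  - intros j ins Hj. rewrite <- Nat.add_assoc. apply H.
    rewrite nth_error_app2 by lia. now rewrite Nat.add_comm, Nat.add_sub.
Qed.

Lemma stacks_of_setr s r v : stacks_of (setr s r v) = supd (stacks_of s) (r + 2) (repeat true v).
Proof.
  apply functional_extensionality; intro i. unfold supd.
  destruct (Nat.eqb_spec i (r + 2)) as [->|Hi].
  - rewrite Nat.add_comm. simpl. now rewrite Nat.eqb_refl.
  - destruct i as [|[|i]]; try easy. simpl. destruct (Nat.eqb_spec i r); [lia|easy].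
Qed.

Lemma stacks_of_reg s r : stacks_of s (r + 2) = repeat true (hr s r).
Proof. now rewrite Nat.add_comm. Qed.

Lemma fsteps_S P t x y z : fstep P x = Some y -> fsteps P t y = Some z -> fsteps P (S t) x = Some z.
Proof. intros H1 H2. simpl. now rewrite H1. Qed.

Lemma setr_id s r : setr s r (hr s r) = s.
Proof.
  destruct s as [f x o]. unfold setr. simpl. f_equal.
  apply functional_extensionality; intro i. destruct (Nat.eqb_spec i r); congruence.
Qed.

Lemma setr_setr s r v w : setr (setr s r v) r w = setr s r w.
Proof.
  unfold setr. simpl. f_equal. apply functional_extensionality; intro i.
  now destruct (i =? r).
Qed.

Lemma setr_same s r v : hr (setr s r v) r = v.
Proof. simpl. now rewrite Nat.eqb_refl. Qed.

Lemma setr_other s r v q : q <> r -> hr (setr s r v) q = hr s q.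
Proof. intro H. simpl. destruct (Nat.eqb_spec q r); congruence. Qed.

Lemma comp_correct P c s s' t : ev c s s' t ->
  forall a ex e k, comp c a ex = (e, k) -> code_at P a k ->
  exists t', t' <= t /\ fsteps P t' (e, stacks_of s) = Some (ex, stacks_of s').
Proof.
  induction 1 as [s|r s|b s|c1 c2 s s1 s2 t1 t2 H1 IH1 H2 IH2|r c s E|r c s n s1 s2 t1 t2 E H1 IH1 H2 IH2
    |r c1 c2 s s' t E H IH|r c1 c2 s s' t E H IH|c0 c1 s b l s' t E H IH|c s s' t u H IH Hu];
    intros a ex e k Hc HP; simpl in Hc.
  - injection Hc as <- <-. exists 0. auto.
  - injection Hc as <- <-. apply code_at_cons in HP. destruct HP as [HP _].
    exists 1. split; [easy|]. simpl. rewrite HP. now rewrite stacks_of_setr, stacks_of_reg.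
  - injection Hc as <- <-. apply code_at_cons in HP. destruct HP as [HP _].
    exists 1. split; [easy|]. simpl. rewrite HP. do 2 f_equal.
    apply functional_extensionality; intro i. unfold supd, out.
    destruct i as [|[|i]]; simpl; try easy. now rewrite rev_app_distr.
  - destruct (comp c2 a ex) as [e2 k2] eqn:E2.
    destruct (comp c1 (a + length k2) e2) as [e1 k1] eqn:E1. injection Hc as <- <-.
    apply code_at_app in HP. destruct HP as [HP2 HP1].
    destruct (IH1 _ _ _ _ E1 HP1) as (u1 & L1 & F1). destruct (IH2 _ _ _ _ E2 HP2) as (u2 & L2 & F2).
    exists (u1 + u2). split; [lia|]. eapply fsteps_add; eauto.
  - destruct (comp c (a + 1) a) as [e1 k1]. injection Hc as <- <-.
    apply code_at_cons in HP. destruct HP as [HP _].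
    exists 1. split; [easy|]. simpl. rewrite HP. now rewrite stacks_of_reg, E.
  - pose proof Hc as Hc'. destruct (comp c (a + 1) a) as [e1 k1] eqn:E1. injection Hc as <- <-.
    pose proof HP as HP'. apply code_at_cons in HP. destruct HP as [HP HP1].
    destruct (IH1 _ _ _ _ E1 HP1) as (u1 & L1 & F1).
    destruct (IH2 a ex a (IPop (r + 2) ex e1 e1 :: k1)) as (u2 & L2 & F2); [simpl; now rewrite E1|easy|].
    exists (S (u1 + u2)). split; [lia|]. eapply fsteps_S; [|eapply fsteps_add; eauto].
    simpl. rewrite HP. rewrite stacks_of_reg, E. simpl. now rewrite stacks_of_setr.
  - destruct (comp c1 (a + 2) ex) as [e1 k1] eqn:E1.
    destruct (comp c2 (a + 2 + length k1) ex) as [e2 k2] eqn:E2. injection Hc as <- <-.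
    apply code_at_cons in HP. destruct HP as [HPa HP]. apply code_at_cons in HP. destruct HP as [HPb HP].
    rewrite <- Nat.add_assoc in HP. apply code_at_app in HP. destruct HP as [HP1 HP2].
    destruct (IH _ _ _ _ E1 HP1) as (u1 & L1 & F1).
    exists (S u1). split; [lia|]. eapply fsteps_S; [|exact F1].
    simpl. rewrite HPa. now rewrite stacks_of_reg, E.
  - destruct (comp c1 (a + 2) ex) as [e1 k1] eqn:E1.
    destruct (comp c2 (a + 2 + length k1) ex) as [e2 k2] eqn:E2. injection Hc as <- <-.
    apply code_at_cons in HP. destruct HP as [HPa HP]. apply code_at_cons in HP. destruct HP as [HPb HP].
    rewrite <- Nat.add_assoc in HP. apply code_at_app in HP. destruct HP as [HP1 HP2].
    destruct (IH _ _ _ _ E2 HP2) as (u1 & L1 & F1).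
    exists (S (S u1)). split; [lia|].
    (* Testing a nonzero register pops one unit; the instruction at [a + 1] pushes it back. *)
    destruct (hr s r) as [|v] eqn:Ev; [easy|].
    apply fsteps_S with (y := (a + 1, supd (stacks_of s) (r + 2) (repeat true v))).
    { simpl. rewrite HPa. rewrite stacks_of_reg, Ev. reflexivity. }
    eapply fsteps_S; [|exact F1]. simpl. rewrite HPb.
    rewrite <- stacks_of_setr, stacks_of_reg, setr_same.
    change (true :: repeat true v) with (repeat true (S v)).
    now rewrite <- stacks_of_setr, setr_setr, <- Ev, setr_id.
  - destruct (comp c0 (a + 1) ex) as [e0 k0] eqn:E0.
    destruct (comp c1 (a + 1 + length k0) ex) as [e1 k1] eqn:E1. injection Hc as <- <-.
    apply code_at_cons in HP. destruct HP as [HPa HP]. apply code_at_app in HP. destruct HP as [HP0 HP1].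
    assert (HI : exists t', t' <= t /\ fsteps P t' (if b then e1 else e0, stacks_of (mkH (hr s) l (ho s))) = Some (ex, stacks_of s')).
    { destruct b; eapply IH; eauto. }
    destruct HI as (u1 & L1 & F1). exists (S u1). split; [lia|].
    eapply fsteps_S; [|exact F1]. simpl. rewrite HPa. simpl. rewrite E. do 2 f_equal.
    apply functional_extensionality; intro i. unfold supd. now destruct i as [|[|i]].
  - destruct (IH _ _ _ _ Hc HP) as (u1 & L1 & F1). exists u1. split; [lia|easy].
Qed.

Fixpoint csize (c : cmd) : nat :=
  match c with
  | Skip => 0
  | Inc _ | Emit _ => 1
  | Seq c1 c2 => csize c2 + csize c1
  | Loop _ c => S (csize c)
  | IfZ _ c1 c2 => S (S (csize c1 + csize c2))
  | CaseX c1 c2 => S (csize c1 + csize c2)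
  end.

Lemma comp_length c : forall a ex, length (snd (comp c a ex)) = csize c.
Proof.
  induction c as [|r|b|c1 IH1 c2 IH2|r c IH|r c1 IH1 c2 IH2|c1 IH1 c2 IH2]; intros a ex; simpl; try easy.
  - specialize (IH2 a ex). destruct (comp c2 a ex) as [e2 k2]. simpl in IH2.
    specialize (IH1 (a + length k2) e2). destruct (comp c1 _ _) as [e1 k1]. simpl in *.
    rewrite length_app. lia.
  - specialize (IH (a + 1) a). destruct (comp c _ _). simpl in *. lia.
  - specialize (IH1 (a + 2) ex). destruct (comp c1 _ _) as [e1 k1]. simpl in IH1.
    specialize (IH2 (a + 2 + length k1) ex). destruct (comp c2 _ _) as [e2 k2]. simpl in *.
    rewrite length_app. lia.
  - specialize (IH1 (a + 1) ex). destruct (comp c1 _ _) as [e1 k1]. simpl in IH1.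
    specialize (IH2 (a + 1 + length k1) ex). destruct (comp c2 _ _) as [e2 k2]. simpl in *.
    rewrite length_app. lia.
Qed.

(* Moves the input bits from stack 0 to stack 1 and counts them in register [r]. *)
Definition with_prelude (r : nat) (c : cmd) : list instr :=
  let (e, k) := comp c 4 (4 + csize c) in
  [IPop 0 e 1 2; IPush 1 false 3; IPush 1 true 3; IPush (r + 2) true 0] ++ k.

Definition input_state (r : nat) (x : list bool) : hstate :=
  mkH (fun j => if j =? r then length x else 0) x [].

(** Stack 0 yields the input from its last bit on, so moving it to stack 1 leaves the first bit on
    top. The part [y] already moved is generalised for the induction. *)
Lemma prelude_loop r c e k : comp c 4 (4 + csize c) = (e, k) ->
  forall l y, fsteps (with_prelude r c) (3 * length l + 1)
     (0, fun i => match i with 0 => l | _ => stacks_of (input_state r y) i end) =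
  Some (e, stacks_of (input_state r (rev l ++ y))).
Proof.
  intros E. unfold with_prelude. rewrite E.
  induction l as [|b l IH]; intro y.
  - simpl. do 2 f_equal. apply functional_extensionality; intro i. now destruct i as [|[|]].
  - replace (3 * length (b :: l) + 1) with (3 + (3 * length l + 1)) by (simpl; lia).
    eapply fsteps_add; [|simpl rev; rewrite <- app_assoc; apply (IH (b :: y))].
    destruct b; simpl; do 2 f_equal;
      (apply functional_extensionality; intro i; unfold supd, input_state; simpl;
       destruct i as [|[|i]]; simpl;
       [destruct (r + 2) as [|[|]] eqn:Er; [lia|lia|easy]
       |destruct (r + 2) as [|[|]] eqn:Er; [lia|lia|easy]
       |destruct (r + 2) as [|[|r']] eqn:Er; [lia|lia|]; assert (r' = r) by lia; subst r'; simpl;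
        rewrite Nat.eqb_refl; destruct (Nat.eqb_spec i r); [subst; easy|easy]]).
Qed.

Lemma cmd_computable r c f tb :
  (forall x, exists s t, ev c (input_state r x) s t /\ t <= tb (length x) /\ ho s = f x) ->
  poly_bounded tb -> PolyTimeComputable f.
Proof.
  intros H Htb.
  apply (stack_program_computable (with_prelude r c) f (fun n => 3 * n + 1 + tb n)).
  2:{ repeat first [exact Htb | apply poly_bounded_add | apply poly_bounded_mul
                   | apply poly_bounded_const | apply poly_bounded_id]. }
  intro x. destruct (H x) as (s & t & Hev & Ht & Hs).
  destruct (comp c 4 (4 + csize c)) as [e k] eqn:E.
  assert (HP : code_at (with_prelude r c) 4 k).
  { unfold with_prelude. rewrite E. intros i ins Hi. exact Hi. }
  destruct (comp_correct _ _ _ _ _ Hev _ _ _ _ E HP) as (t' & Ht' & F).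
  pose proof (prelude_loop r c e k E (rev x) []) as F0.
  rewrite rev_involutive, app_nil_r, length_rev in F0.
  exists (3 * length x + 1 + t'), (4 + csize c), (stacks_of s).
  split; [lia|]. split; [|split].
  - eapply fsteps_add; [|exact F]. rewrite <- F0. do 2 f_equal.
    apply functional_extensionality; intro i. destruct i as [|[|i]]; try easy.
    simpl. now destruct (i =? r).
  - apply nth_error_None. unfold with_prelude. rewrite E. rewrite length_app.
    pose proof (comp_length c 4 (4 + csize c)) as L. rewrite E in L. simpl in *. lia.
  - simpl. now rewrite Hs.
Qed.

(** * Circuit templates *)

(* Gate operands are given relative to movable bases: [SU] is the base of the
   previous block, [SE] that of a block one tableau row earlier, [SV] and [SZ]
   are positions of input variables. *)
Inductive src : Type := SU | SE | SV | SZ | S0.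
Definition operand : Type := src * nat.
Definition oval (env : src -> nat) (o : operand) : nat := env (fst o) + snd o.

Inductive tgate : Type :=
| TVar (o : operand) | TConst (b : bool) | TNot (o : operand)
| TOp (and : bool) (o1 o2 : operand).

Definition inst (env : src -> nat) (t : tgate) : gate :=
  match t with
  | TVar o => GVar (oval env o)
  | TConst b => GConst b
  | TNot o => GNot (oval env o)
  | TOp true o1 o2 => GAnd (oval env o1) (oval env o2)
  | TOp false o1 o2 => GOr (oval env o1) (oval env o2)
  end.

Definition ext (inp vals : list bool) (C : circuit) : list bool :=
  fold_left (fun vals g => vals ++ [gate_val inp vals g]) C vals.

Lemma ext_app inp vals C D : ext inp vals (C ++ D) = ext inp (ext inp vals C) D.
Proof. apply fold_left_app. Qed.

Lemma eval_circ_ext C inp : eval_circ C inp = last (ext inp [] C) false.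
Proof. reflexivity. Qed.

Lemma gate_val_nth inp vals g : gate_val inp vals g =
  match g with
  | GVar v => nth v inp false
  | GConst b => b
  | GNot i => negb (nth i vals false)
  | GAnd i j => nth i vals false && nth j vals false
  | GOr i j => nth i vals false || nth j vals false
  end.
Proof.
  assert (H : forall j, (if j <? length vals then nth j vals false else false) = nth j vals false).
  { intro j. destruct (Nat.ltb_spec j (length vals)); [easy|]. now rewrite nth_overflow. }
  unfold gate_val. now destruct g; rewrite ?H.
Qed.

Inductive bexp : Type :=
| BRef (o : operand) | BVar (o : operand) | BConst (b : bool)
| BNot (e : bexp) | BOp (and : bool) (e1 e2 : bexp).

Definition bop (and x y : bool) : bool := if and then x && y else x || y.

Fixpoint beval (env : src -> nat) (inp vals : list bool) (e : bexp) : bool :=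
  match e with
  | BRef o => nth (oval env o) vals false
  | BVar o => nth (oval env o) inp false
  | BConst b => b
  | BNot e => negb (beval env inp vals e)
  | BOp op e1 e2 => bop op (beval env inp vals e1) (beval env inp vals e2)
  end.

Fixpoint refs_below (env : src -> nat) (n : nat) (e : bexp) : Prop :=
  match e with
  | BRef o => oval env o < n
  | BVar _ | BConst _ => True
  | BNot e => refs_below env n e
  | BOp _ e1 e2 => refs_below env n e1 /\ refs_below env n e2
  end.

Lemma refs_below_le env n m e : n <= m -> refs_below env n e -> refs_below env m e.
Proof. intro H. induction e; simpl; intuition lia. Qed.

Lemma beval_app env inp vals new e : refs_below env (length vals) e ->
  beval env inp (vals ++ new) e = beval env inp vals e.
Proof.
  induction e; simpl; intro H; try easy.
  - now apply app_nth1.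
  - now rewrite IHe.
  - now rewrite IHe1, IHe2.
Qed.

Fixpoint bsize (e : bexp) : nat :=
  match e with
  | BRef _ => 0
  | BVar _ | BConst _ => 1
  | BNot e => S (bsize e)
  | BOp _ e1 e2 => S (bsize e1 + bsize e2)
  end.

(* [b + j] is the offset of the next gate from the base [SU]; the result is the
   operand holding the value, with the gates that compute it. *)
Fixpoint bcomp (b : nat) (e : bexp) (j : nat) : operand * list tgate :=
  match e with
  | BRef o => (o, [])
  | BVar o => ((SU, b + j), [TVar o])
  | BConst c => ((SU, b + j), [TConst c])
  | BNot e =>
      let (o, gs) := bcomp b e j in ((SU, b + (j + bsize e)), gs ++ [TNot o])
  | BOp op e1 e2 =>
      let (o1, gs1) := bcomp b e1 j in
      let (o2, gs2) := bcomp b e2 (j + bsize e1) in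
      ((SU, b + (j + bsize e1 + bsize e2)), gs1 ++ gs2 ++ [TOp op o1 o2])
  end.

Lemma bcomp_length b e : forall j, length (snd (bcomp b e j)) = bsize e.
Proof.
  induction e; intro j; simpl; try easy.
  - specialize (IHe j). destruct (bcomp b e j). simpl in *. rewrite length_app. simpl. lia.
  - specialize (IHe1 j). specialize (IHe2 (j + bsize e1)).
    destruct (bcomp b e1 j), (bcomp b e2 _). simpl in *. rewrite !length_app. simpl. lia.
Qed.

Definition computes (env : src -> nat) (inp vals : list bool) (e : bexp) (o : operand) (gs : list tgate) : Prop :=
  exists new, ext inp vals (map (inst env) gs) = vals ++ new /\ length new = bsize e /\
    nth (oval env o) (vals ++ new) false = beval env inp vals e /\
    oval env o < length (vals ++ new).

Lemma bcomp_correct b env inp e : forall j vals, length vals = env SU + b + j ->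
  refs_below env (length vals) e ->
  computes env inp vals e (fst (bcomp b e j)) (snd (bcomp b e j)).
Proof.
  induction e as [o|o|d|e IH|op e1 IH1 e2 IH2]; intros j vals Hl Hr; simpl in Hr;
    unfold computes; cbn [bcomp bsize].
  - exists []. simpl. rewrite app_nil_r. auto.
  - exists [nth (oval env o) inp false]. simpl. split; [easy|]. split; [easy|].
    unfold oval; cbn [fst snd]. rewrite length_app, app_nth2 by lia. simpl.
    replace (env SU + _ - _) with 0 by lia. split; [easy|lia].
  - exists [d]. simpl. split; [easy|]. split; [easy|].
    unfold oval; cbn [fst snd]. rewrite length_app, app_nth2 by lia. simpl.
    replace (env SU + _ - _) with 0 by lia. split; [easy|lia].
  - destruct (IH j vals Hl Hr) as (n1 & E1 & L1 & V1 & B1).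
    destruct (bcomp b e j) as [o1 g1]. cbn [fst snd] in *.
    exists (n1 ++ [negb (beval env inp vals e)]).
    rewrite map_app, ext_app, E1. simpl map. cbn [ext fold_left]. rewrite gate_val_nth. cbn [inst].
    rewrite V1. unfold oval; cbn [fst snd]. rewrite app_assoc, !length_app in *. simpl length.
    split; [easy|]. split; [lia|]. split; [|lia].
    rewrite app_nth2 by (rewrite !length_app; lia).
    replace (env SU + _ - _) with 0 by (rewrite !length_app; lia). reflexivity.
  - destruct Hr as [H1 H2].
    destruct (IH1 j vals Hl H1) as (n1 & E1 & L1 & V1 & B1).
    assert (Hl1 : length (vals ++ n1) = env SU + b + (j + bsize e1)) by (rewrite length_app; lia).
    destruct (IH2 (j + bsize e1) (vals ++ n1) Hl1) as (n2 & E2 & L2 & V2 & B2).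
    { eapply refs_below_le; [|exact H2]. rewrite length_app. lia. }
    destruct (bcomp b e1 j) as [o1 g1], (bcomp b e2 _) as [o2 g2]. cbn [fst snd] in *.
    exists (n1 ++ n2 ++ [bop op (beval env inp vals e1) (beval env inp vals e2)]).
    rewrite !map_app, !ext_app, E1, E2. simpl map. cbn [ext fold_left].
    replace (gate_val inp _ _) with (bop op (beval env inp vals e1) (beval env inp vals e2)).
    2:{ rewrite gate_val_nth. rewrite beval_app in V2 by easy. rewrite <- V1, <- V2.
        rewrite <- (app_nth1 (vals ++ n1) n2 false B1). now destruct op. }
    unfold oval; cbn [fst snd]. rewrite !app_assoc, !length_app in *. simpl length.
    split; [easy|]. split; [lia|]. split; [|lia].
    rewrite app_nth2 by (rewrite !length_app; lia).
    replace (env SU + _ - _) with 0 by (rewrite !length_app; lia). reflexivity.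
Qed.

Fixpoint bcomps (b : nat) (es : list bexp) (j : nat) : list operand * list tgate :=
  match es with
  | [] => ([], [])
  | e :: es' =>
      let (o, gs) := bcomp b e j in
      let (os, gs') := bcomps b es' (j + bsize e) in (o :: os, gs ++ gs')
  end.

Definition bsizes (es : list bexp) : nat := list_sum (map bsize es).

Lemma bcomps_length b es : forall j,
  length (fst (bcomps b es j)) = length es /\ length (snd (bcomps b es j)) = bsizes es.
Proof.
  induction es as [|e es IH]; intro j; [easy|]. simpl.
  pose proof (bcomp_length b e j) as H. destruct (bcomp b e j) as [o gs].
  specialize (IH (j + bsize e)). destruct (bcomps b es _). simpl in *.
  rewrite length_app. unfold bsizes in *. simpl. lia.
Qed.

Lemma bcomps_correct b env inp es : forall j vals, length vals = env SU + b + j ->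
  Forall (refs_below env (length vals)) es ->
  exists new, ext inp vals (map (inst env) (snd (bcomps b es j))) = vals ++ new /\
    length new = bsizes es /\
    map (fun o => nth (oval env o) (vals ++ new) false) (fst (bcomps b es j)) = map (beval env inp vals) es /\
    Forall (fun o => oval env o < length (vals ++ new)) (fst (bcomps b es j)).
Proof.
  induction es as [|e es IH]; intros j vals Hl Hr.
  - exists []. simpl. rewrite app_nil_r. auto.
  - inversion_clear Hr as [|? ? He Hes].
    destruct (bcomp_correct b env inp e j vals Hl He) as (n1 & E1 & L1 & V1 & B1).
    destruct (IH (j + bsize e) (vals ++ n1)) as (n2 & E2 & L2 & V2 & B2).
    { rewrite length_app. lia. }
    { eapply Forall_impl; [|exact Hes]. intros a. apply refs_below_le. rewrite length_app. lia. }
    simpl. destruct (bcomp b e j) as [o gs]. destruct (bcomps b es _) as [os gs']. simpl in *.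
    exists (n1 ++ n2). rewrite map_app, ext_app, E1, E2, app_assoc.
    split; [easy|]. split; [rewrite length_app; unfold bsizes in *; simpl; lia|]. split.
    + rewrite (app_nth1 (vals ++ n1) n2) by easy. rewrite V1, V2. f_equal.
      apply map_ext_in. intros a Ha. apply beval_app. rewrite Forall_forall in Hes. auto.
    + constructor; [|easy]. rewrite (length_app (vals ++ n1)). lia.
Qed.

(** Shannon expansion is exponential in the number of leaves. It is applied only to leaf lists whose
    length does not depend on the input of the reduction. *)
Fixpoint shannon (ls : list bexp) (f : list bool -> bool) : bexp :=
  match ls with
  | [] => BConst (f [])
  | l :: ls' =>
      BOp false (BOp true l (shannon ls' (fun v => f (true :: v))))
        (BOp true (BNot l) (shannon ls' (fun v => f (false :: v))))
  end.

Lemma shannon_eval env inp vals ls : forall f,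
  beval env inp vals (shannon ls f) = f (map (beval env inp vals) ls).
Proof.
  induction ls as [|l ls IH]; intro f; simpl; [easy|].
  rewrite !IH. destruct (beval env inp vals l); simpl; [apply orb_false_r|easy].
Qed.

Lemma shannon_refs env n ls : Forall (refs_below env n) ls ->
  forall f, refs_below env n (shannon ls f).
Proof. induction 1 as [|l ls Hl Hls IH]; intro f; simpl; auto. Qed.

Definition vec_exps (ls : list bexp) (F : list bool -> list bool) (g : nat) : list bexp :=
  map (fun i => shannon ls (fun v => nth i (F v) false)) (seq 0 g).

(* A block computes [F] on its leaves; its last [g] gates carry the result. *)
Definition block (b pad : nat) (ls : list bexp) (F : list bool -> list bool) (g : nat) : list tgate :=
  let p := bcomps b (vec_exps ls F g) pad in
  repeat (TConst false) pad ++ snd p ++ map (fun o => TOp false o o) (fst p).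

Definition core_size (ls : list bexp) (F : list bool -> list bool) (g : nat) : nat :=
  bsizes (vec_exps ls F g) + g.

Lemma block_length b pad ls F g : length (block b pad ls F g) = pad + core_size ls F g.
Proof.
  unfold block, core_size. destruct (bcomps_length b (vec_exps ls F g) pad) as [H1 H2].
  rewrite !length_app, repeat_length, length_map, H1, H2. unfold vec_exps.
  rewrite length_map, length_seq. lia.
Qed.

Lemma ext_consts inp env n : forall vals,
  ext inp vals (map (inst env) (repeat (TConst false) n)) = vals ++ repeat false n.
Proof.
  induction n as [|n IH]; intro vals; [simpl; now rewrite app_nil_r|]. cbn [repeat map].
  change (ext inp vals (?g :: ?C)) with (ext inp (vals ++ [gate_val inp vals g]) C).
  rewrite IH. now rewrite <- app_assoc.
Qed.

(** A disjunction of an operand with itself is a copy gate. Copies are needed because the value of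
    an expression may sit anywhere, even on a leaf, while a block has to deliver its result in its
    last gates. *)
Lemma ext_copies inp env os : forall vals, Forall (fun o => oval env o < length vals) os ->
  ext inp vals (map (inst env) (map (fun o => TOp false o o) os)) =
  vals ++ map (fun o => nth (oval env o) vals false) os.
Proof.
  induction os as [|o os IH]; intros vals H; [simpl; now rewrite app_nil_r|].
  inversion_clear H as [|? ? Ho Hos]. cbn [map].
  change (ext inp vals (?g :: ?C)) with (ext inp (vals ++ [gate_val inp vals g]) C).
  rewrite IH.
  - rewrite <- app_assoc, gate_val_nth. simpl. rewrite orb_diag. do 2 f_equal.
    apply map_ext_in. intros a Ha. rewrite Forall_forall in Hos. apply app_nth1. auto.
  - eapply Forall_impl; [|exact Hos]. simpl. intros a Ha. rewrite length_app. lia.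
Qed.

Lemma block_eval b pad ls F g env inp vals : length vals = env SU + b ->
  Forall (refs_below env (length vals)) ls -> length (F (map (beval env inp vals) ls)) = g ->
  exists junk, length junk = pad + bsizes (vec_exps ls F g) /\
    ext inp vals (map (inst env) (block b pad ls F g)) = vals ++ junk ++ F (map (beval env inp vals) ls).
Proof.
  intros Hl Hr Hg. unfold block. rewrite !map_app, !ext_app, ext_consts.
  destruct (bcomps_correct b env inp (vec_exps ls F g) pad (vals ++ repeat false pad))
    as (new & E & L & V & B).
  { rewrite length_app, repeat_length. lia. }
  { unfold vec_exps. apply Forall_map, Forall_forall. intros i _. apply shannon_refs.
    eapply Forall_impl; [|exact Hr]. intro a. apply refs_below_le. rewrite length_app. lia. }
  rewrite E, ext_copies, V by easy.
  exists (repeat false pad ++ new). split; [rewrite length_app, repeat_length; lia|].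
  rewrite <- !app_assoc. do 3 f_equal. unfold vec_exps. rewrite map_map.
  set (v := map (beval env inp vals) ls) in *.
  transitivity (map (fun i => nth i (F v) false) (seq 0 g)).
  - apply map_ext. intro i. rewrite shannon_eval. f_equal. f_equal.
    apply map_ext_in. intros a Ha. apply beval_app. rewrite Forall_forall in Hr. auto.
  - rewrite <- Hg. clear. induction (F v) as [|c l IH]; [easy|]. simpl. f_equal.
    rewrite <- seq_shift, map_map. exact IH.
Qed.

(* After the blocks whose results are listed in [L], each of size [G], have been evaluated. *)
Definition tabulates (G g : nat) (vals : list bool) (L : list (list bool)) : Prop :=
  length vals = G * length L /\ Forall (fun v => length v = g) L /\
  forall p i, p < length L -> i < g ->
    nth (G * p + (G - g) + i) vals false = nth i (nth p L []) false.

Lemma tabulates_nil G g : tabulates G g [] [].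
Proof. split; [simpl; lia|]. split; [easy|]. simpl. lia. Qed.

Definition cell_refs (G g : nat) (s : src) (d : nat) : list bexp :=
  map (fun i => BRef (s, d + (G - g) + i)) (seq 0 g).

Lemma map_nth_seq {A} (l : list A) d : map (fun i => nth i l d) (seq 0 (length l)) = l.
Proof.
  induction l as [|c l IH]; [easy|]. simpl. f_equal. rewrite <- seq_shift, map_map. exact IH.
Qed.

Lemma cell_refs_eval G g vals L env inp s d p : tabulates G g vals L ->
  p < length L -> env s + d = G * p ->
  map (beval env inp vals) (cell_refs G g s d) = nth p L [].
Proof.
  intros (HL & HF & HN) Hp He. rewrite Forall_forall in HF.
  rewrite <- (map_nth_seq (nth p L []) false), (HF (nth p L [])) by now apply nth_In.
  unfold cell_refs. rewrite map_map. apply map_ext_in. intros i Hi. apply in_seq in Hi.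
  simpl. rewrite <- HN by lia. f_equal. unfold oval. simpl. lia.
Qed.

Lemma cell_refs_below G g vals L env s d p : tabulates G g vals L -> g <= G ->
  p < length L -> env s + d = G * p ->
  Forall (refs_below env (length vals)) (cell_refs G g s d).
Proof.
  intros (HL & _) Hg Hp He. apply Forall_map, Forall_forall. intros i Hi. apply in_seq in Hi.
  simpl. unfold oval. simpl. rewrite HL. nia.
Qed.

(** Padding comes first, so the result stays at the end of the block. *)
Definition padded (G b : nat) (ls : list bexp) (F : list bool -> list bool) (g : nat) : list tgate :=
  block b (G - core_size ls F g) ls F g.

Lemma padded_length G b ls F g : core_size ls F g <= G -> length (padded G b ls F g) = G.
Proof. intro H. unfold padded. rewrite block_length. lia. Qed.

Lemma tabulates_step G b ls F g env inp vals L : tabulates G g vals L ->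
  core_size ls F g <= G -> env SU + b = G * length L ->
  Forall (refs_below env (length vals)) ls -> length (F (map (beval env inp vals) ls)) = g ->
  tabulates G g (ext inp vals (map (inst env) (padded G b ls F g))) (L ++ [F (map (beval env inp vals) ls)]).
Proof.
  intros (HL & HF & HN) Hs He Hr Hg.
  destruct (block_eval b (G - core_size ls F g) ls F g env inp vals) as (junk & Hj & E); auto; [lia|].
  unfold padded. rewrite E. unfold core_size in *.
  assert (Hj' : length junk = G - g) by lia. split; [|split].
  - rewrite !length_app. simpl length. nia.
  - apply Forall_app. auto.
  - intros p i Hp Hi. rewrite length_app in Hp. simpl in Hp.
    destruct (Nat.eq_dec p (length L)) as [->|Hne].
    + rewrite (app_nth2 L) by lia. rewrite Nat.sub_diag. simpl.
      rewrite app_nth2 by lia. rewrite app_nth2 by lia. f_equal. lia.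
    + rewrite (app_nth1 L) by lia. rewrite app_nth1 by nia. apply HN; lia.
Qed.

Lemma final_block b ls F env inp vals : length vals = env SU + b ->
  Forall (refs_below env (length vals)) ls ->
  last (ext inp vals (map (inst env) (block b 0 ls (fun v => [F v]) 1))) false =
  F (map (beval env inp vals) ls).
Proof.
  intros Hl Hr.
  destruct (block_eval b 0 ls (fun v => [F v]) 1 env inp vals Hl Hr eq_refl) as (junk & _ & E).
  rewrite E, app_assoc. apply last_last.
Qed.

(** * The helical tableau *)

Definition zconf : Type := nat * Z * (Z -> sym).

(** A halted configuration repeats itself, so that the tableau can have a fixed number of rows. *)
Definition znext (N : TM) (c : zconf) : zconf :=
  let '(q, p, T) := c in
  match lookup N q (T p) with
  | None => c
  | Some r => (r_q' r, move (r_d r) p, zupd T p (r_w r))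
  end.

Fixpoint ziter (N : TM) (t : nat) (c : zconf) : zconf :=
  match t with 0 => c | S t' => znext N (ziter N t' c) end.

Definition is_none {A} (o : option A) : bool := match o with None => true | _ => false end.

(** [output] begins at the head cell, so acceptance is visible in one cell: no rule applies and the
    scanned symbol is [true]. *)
Definition accepting (N : TM) (q : nat) (s : sym) : bool :=
  is_none (lookup N q s) && sym_eqb s (Some true).

Definition zaccepting (N : TM) (c : zconf) : bool :=
  let '(q, p, T) := c in accepting N q (T p).

(** Besides the symbol and, under the head, the state, a cell carries two disjunctions accumulated
    from block to block: [c_acc] for an accepting cell met so far, [c_nz] for a coin equal to 1. The
    last block thus knows both without any tree of gates. *)
Record tcell : Type := mkCell { c_acc : bool; c_nz : bool; c_sym : sym; c_state : option nat }.

Definition blank_cell : tcell := mkCell false false None None.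

Section Tableau.
Variable N : TM.
Variable Qn : nat.
Hypothesis states_ok : forall r, In r N -> r_q' r < Qn.

Definition csz : nat := 4 + Qn.

Definition enc_cell (c : tcell) : list bool :=
  [c_acc c; c_nz c; negb (is_none (c_sym c)); sym_eqb (c_sym c) (Some true)] ++
  map (fun q => match c_state c with Some q' => q =? q' | None => false end) (seq 0 Qn).

Definition dec_cell (v : list bool) : tcell :=
  mkCell (nth 0 v false) (nth 1 v false)
    (if nth 2 v false then Some (nth 3 v false) else None)
    (find (fun q => nth (4 + q) v false) (seq 0 Qn)).

Definition cell_ok (c : tcell) : Prop :=
  match c_state c with Some q => q < Qn | None => True end.

Lemma enc_cell_length c : length (enc_cell c) = csz.
Proof. unfold enc_cell, csz. now rewrite length_app, length_map, length_seq. Qed.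

Lemma dec_enc_cell c : cell_ok c -> dec_cell (enc_cell c) = c.
Proof.
  intro H. destruct c as [a z s h]. unfold dec_cell, enc_cell. cbn [nth app c_acc c_nz c_sym c_state].
  f_equal; [destruct s as [[]|]; reflexivity|].
  set (onehot := fun q => match h with Some q' => q =? q' | None => false end).
  change (find (fun q => nth q (map onehot (seq 0 Qn)) false) (seq 0 Qn) = h).
  assert (E : forall q, In q (seq 0 Qn) -> nth q (map onehot (seq 0 Qn)) false = onehot q).
  { intros q Hq. apply in_seq in Hq.
    rewrite (nth_indep _ false (onehot 0)) by (rewrite length_map, length_seq; lia).
    rewrite map_nth, seq_nth by lia. reflexivity. }
  unfold cell_ok in H. simpl in H. destruct h as [q|].
  - apply find_unique.
    + apply in_seq. lia.
    + cbv beta. rewrite E by (apply in_seq; lia). unfold onehot. apply Nat.eqb_refl.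
    + intros r Hr. cbv beta. rewrite E by easy. apply Nat.eqb_eq.
  - destruct (find _ _) as [q|] eqn:F; [|easy]. apply find_some in F. destruct F as [F1 F2].
    rewrite E in F2 by easy. discriminate.
Qed.

Definition cell_rule (c : tcell) : option rule :=
  match c_state c with Some q => lookup N q (c_sym c) | None => None end.

(** [l], [m], [r] are the neighbours one row up and [pr] is the preceding block. Since [c_acc]
    inspects [m], acceptance is recorded one row late. *)
Definition local (l m r pr : tcell) : tcell :=
  mkCell
    (c_acc pr || match c_state m with Some q => accepting N q (c_sym m) | None => false end)
    (c_nz pr)
    (match cell_rule m with Some ru => r_w ru | None => c_sym m end)
    (match c_state m, cell_rule m with
     | Some q, None => Some q
     | Some _, Some (mkRule _ _ q' _ DS) => Some q'
     | Some _, _ => None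
     | None, _ =>
         match cell_rule l, cell_rule r with
         | Some (mkRule _ _ q' _ DR), _ => Some q'
         | _, Some (mkRule _ _ q' _ DL) => Some q'
         | _, _ => None
         end
     end).

Lemma cell_rule_ok c ru : cell_rule c = Some ru -> r_q' ru < Qn.
Proof.
  unfold cell_rule, lookup. destruct (c_state c); [|easy].
  intro H. apply find_some in H. now apply states_ok.
Qed.

Lemma local_ok l m r pr : cell_ok m -> cell_ok (local l m r pr).
Proof.
  intro Hm. unfold cell_ok, local. simpl.
  pose proof (cell_rule_ok l) as Hl. pose proof (cell_rule_ok r) as Hr. pose proof (cell_rule_ok m) as Hm'.
  unfold cell_ok in Hm.
  destruct (c_state m) as [q|].
  - destruct (cell_rule m) as [[? ? ? ? []]|]; try easy. now apply (Hm' _ eq_refl).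
  - destruct (cell_rule l) as [[? ? ? ? []]|]; try (now apply (Hl _ eq_refl));
      destruct (cell_rule r) as [[? ? ? ? []]|]; try easy; now apply (Hr _ eq_refl).
Qed.

Variable W : nat.

Definition grow1 (L : list tcell) : list tcell :=
  let P := length L in
  let at_ i := nth i L blank_cell in
  L ++ [local (at_ (P - W - 1)) (at_ (P - W)) (at_ (P - W + 1)) (at_ (P - 1))].

Fixpoint grow (k : nat) (L : list tcell) : list tcell :=
  match k with 0 => L | S k' => grow1 (grow k' L) end.

Lemma grow_length k L : length (grow k L) = length L + k.
Proof. induction k as [|k IH]; simpl; [lia|]. unfold grow1. rewrite length_app, IH. simpl. lia. Qed.

Variable c0 : zconf.
Variable j0 : Z.
Definition conf (t : nat) : zconf := ziter N t c0.
Definition zpos (t : nat) : Z := snd (fst (conf t)).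
Definition zstate (t : nat) : nat := fst (fst (conf t)).
Definition ztape (t : nat) : Z -> sym := snd (conf t).

Hypothesis pos_inside : forall t, (1 < zpos t + j0 < Z.of_nat W)%Z.

Definition faithful (c : tcell) (t : nat) (z : Z) : Prop :=
  c_sym c = ztape t z /\ c_state c = if Z.eqb (zpos t) z then Some (zstate t) else None.

(** Block 0 is a dummy; block [t * W + j] with 1 <= j <= W is column j of row t and shows tape cell
    [j - j0]. The range of [existsb] reflects the delay of [c_acc]: block [W + k] has taken account
    of blocks 1 to k. *)
Definition tableau_inv (k : nat) (nzW : bool) (L : list tcell) : Prop :=
  length L = W + 1 + k /\ Forall cell_ok L /\ c_state (nth 0 L blank_cell) = None /\
  (forall t j, 1 <= j <= W -> t * W + j < length L ->
     faithful (nth (t * W + j) L blank_cell) t (Z.of_nat j - j0)) /\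
  c_acc (nth (W + k) L blank_cell) =
    existsb (fun p => match c_state (nth p L blank_cell) with
       | Some q => accepting N q (c_sym (nth p L blank_cell)) | None => false end) (seq 1 k) /\
  c_nz (nth (W + k) L blank_cell) = nzW.

Lemma faithful_rule c t z : faithful c t z ->
  cell_rule c = if Z.eqb (zpos t) z then lookup N (zstate t) (ztape t (zpos t)) else None.
Proof.
  intros [H1 H2]. unfold cell_rule. rewrite H1, H2.
  destruct (Z.eqb_spec (zpos t) z) as [->|]; reflexivity.
Qed.

Lemma conf_succ t : conf (S t) = znext N (zstate t, zpos t, ztape t).
Proof. unfold zstate, zpos, ztape. unfold conf. simpl. now destruct (ziter N t c0) as [[q p] T]. Qed.

(** The side neighbours are constrained only through the rule they fire, because at a row end they
    are cells of another row and are not faithful to the adjacent position. *)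
Lemma local_faithful l m r pr t z : faithful m t z ->
  cell_rule l = (if Z.eqb (zpos t) (z - 1) then lookup N (zstate t) (ztape t (zpos t)) else None) ->
  cell_rule r = (if Z.eqb (zpos t) (z + 1) then lookup N (zstate t) (ztape t (zpos t)) else None) ->
  faithful (local l m r pr) (S t) z.
Proof.
  intros Hm Hl Hr. pose proof (faithful_rule _ _ _ Hm) as Hm'. destruct Hm as [Hs Hh].
  unfold faithful, zpos, zstate, ztape. rewrite conf_succ. unfold local. cbn [c_sym c_state].
  rewrite Hm', Hl, Hr, Hs, Hh. unfold znext.
  destruct (lookup N (zstate t) (ztape t (zpos t))) as [[rq rs q' w d]|] eqn:E; cbn [fst snd r_q' r_w r_d].
  - destruct (Z.eqb_spec (zpos t) z) as [<-|Hz].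
    + rewrite zupd_same. split; [easy|].
      destruct d; simpl;
        [destruct (Z.eqb_spec (zpos t - 1) (zpos t)) |destruct (Z.eqb_spec (zpos t + 1) (zpos t))|rewrite Z.eqb_refl]; lia || easy.
    + rewrite zupd_other by congruence. split; [easy|].
      destruct (Z.eqb_spec (zpos t) (z - 1)) as [E1|E1];
      destruct (Z.eqb_spec (zpos t) (z + 1)) as [E2|E2]; try lia;
      destruct d; simpl; 
        repeat match goal with |- context [Z.eqb ?a ?b] => destruct (Z.eqb_spec a b) end; lia || easy.
  - split.
    + now destruct (Z.eqb (zpos t) z).
    + destruct (Z.eqb_spec (zpos t) z); [easy|].
      destruct (Z.eqb_spec (zpos t) (z - 1)), (Z.eqb_spec (zpos t) (z + 1)); easy.
Qed.

Lemma tableau_step k nzW L : tableau_inv k nzW L -> tableau_inv (S k) nzW (grow1 L).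
Proof.
  intros (HL & Hok & H0 & Hf & Ha & Hn).
  assert (HW : 1 < W) by (specialize (pos_inside 0); lia).
  unfold grow1. set (P := length L) in *.
  assert (Hnew : forall c, nth P (L ++ [c]) blank_cell = c) by (intro c; unfold P; rewrite app_nth2, Nat.sub_diag by lia; reflexivity).
  assert (Hold : forall c p, p < P -> nth p (L ++ [c]) blank_cell = nth p L blank_cell) by (intros c p Hp; now apply app_nth1).
  set (c := local _ _ _ _).
  split; [|split; [|split; [|split; [|split]]]].
  - rewrite length_app. simpl. lia.
  - apply Forall_app. split; [easy|]. constructor; [|easy]. apply local_ok.
    rewrite Forall_forall in Hok. apply Hok, nth_In. lia.
  - rewrite Hold by lia. easy.
  - intros t j Hj Hlt. rewrite length_app in Hlt. fold P in Hlt. simpl in Hlt.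
    destruct (Nat.eq_dec (t * W + j) P) as [HP|HP]; [|rewrite Hold by lia; apply Hf; fold P; lia].
    rewrite HP, Hnew. destruct t as [|t]; [lia|]. unfold c.
    apply local_faithful.
    + replace (P - W) with (t * W + j) by lia. apply Hf; fold P; lia.
    (* The block left of column 1 is the last cell of the row before, or the dummy block. Neither
       carries the head, so it fires no rule, just like the true neighbour outside the row. *)
    + destruct (Nat.eq_dec j 1) as [->|Hj1].
      * assert (Hno : c_state (nth (P - W - 1) L blank_cell) = None).
        { destruct t as [|t].
          - replace (P - W - 1) with 0 by lia. easy.
          - replace (P - W - 1) with (t * W + W) by lia.
            destruct (Hf t W) as [_ ->]; [lia|fold P; lia|].
            specialize (pos_inside t). destruct (Z.eqb_spec (zpos t) (Z.of_nat W - j0)); [lia|easy]. }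
        unfold cell_rule at 1. rewrite Hno.
        specialize (pos_inside t). destruct (Z.eqb_spec (zpos t) (Z.of_nat 1 - j0 - 1)); [lia|easy].
      * replace (Z.of_nat j - j0 - 1)%Z with (Z.of_nat (j - 1) - j0)%Z by lia.
        apply faithful_rule. replace (P - W - 1) with (t * W + (j - 1)) by lia. apply Hf; fold P; lia.
    (* The block right of column W is the first cell of the next row, where the head never stands
       either. *)
    + destruct (Nat.eq_dec j W) as [->|HjW].
      * assert (Hno : c_state (nth (P - W + 1) L blank_cell) = None).
        { replace (P - W + 1) with (S t * W + 1) by lia.
          destruct (Hf (S t) 1) as [_ ->]; [lia|fold P; lia|].
          specialize (pos_inside (S t)). destruct (Z.eqb_spec (zpos (S t)) (Z.of_nat 1 - j0)); [lia|easy]. }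
        unfold cell_rule at 1. rewrite Hno.
        specialize (pos_inside t). destruct (Z.eqb_spec (zpos t) (Z.of_nat W - j0 + 1)); [lia|easy].
      * replace (Z.of_nat j - j0 + 1)%Z with (Z.of_nat (j + 1) - j0)%Z by lia.
        apply faithful_rule. replace (P - W + 1) with (t * W + (j + 1)) by lia. apply Hf; fold P; lia.
  - replace (W + S k) with P by lia. rewrite Hnew. unfold c. cbn [local c_acc].
    rewrite seq_S, existsb_app. cbn [existsb]. rewrite orb_false_r.
    replace (P - 1) with (W + k) by lia. rewrite Ha. f_equal.
    + clear Ha. assert (HI : forall p, In p (seq 1 k) -> p < P) by (intros p Hp; apply in_seq in Hp; lia).
      induction (seq 1 k) as [|p l IH]; [easy|]. simpl. rewrite IH by (intros; apply HI; now right).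
      now rewrite Hold by (apply HI; now left).
    + replace (P - W) with (1 + k) by lia. now rewrite Hold by lia.
  - replace (W + S k) with P by lia. rewrite Hnew. unfold c. cbn [local c_nz].
    replace (P - 1) with (W + k) by lia. easy.
Qed.

Lemma tableau_grow k nzW L : tableau_inv 0 nzW L -> tableau_inv k nzW (grow k L).
Proof. intro H. induction k as [|k IH]; simpl; [easy|]. now apply tableau_step. Qed.

Lemma tableau_result nzW L : tableau_inv 0 nzW L ->
  let L' := grow (W * W) L in
  let c := nth (W + W * W) L' blank_cell in
  Forall cell_ok L' /\ c_nz c = nzW /\
  (c_acc c = true <-> exists t, t < W /\ zaccepting N (conf t) = true).
Proof.
  intro H. assert (HW : 1 < W) by (specialize (pos_inside 0); lia).
  destruct (tableau_grow (W * W) nzW L H) as (HL & Hok & H0 & Hf & Ha & Hn).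
  split; [easy|]. split; [easy|]. rewrite Ha, existsb_exists. split.
  - intros (p & Hp & E). apply in_seq in Hp.
    (* Columns are counted from 1, so block p lies in row [(p - 1) / W]. *)
    pose proof (Nat.div_mod_eq (p - 1) W) as D.
    pose proof (Nat.mod_upper_bound (p - 1) W ltac:(lia)) as B.
    set (t := (p - 1) / W) in *. set (j := (p - 1) mod W) in *.
    assert (Ep : p = t * W + (j + 1)) by lia.
    assert (Ht : t < W) by nia.
    destruct (Hf t (j + 1)) as [F1 F2]; [lia|nia|]. rewrite <- Ep in F1, F2. rewrite F1, F2 in E.
    exists t. split; [easy|].
    destruct (Z.eqb_spec (zpos t) (Z.of_nat (j + 1) - j0)) as [Ez|]; [|discriminate].
    rewrite <- Ez in E. unfold zaccepting, zstate, zpos, ztape in *. now destruct (conf t) as [[q z] T].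
  - intros (t & Ht & E). specialize (pos_inside t).
    set (j := Z.to_nat (zpos t + j0)).
    exists (t * W + j). split; [apply in_seq; unfold j; nia|].
    destruct (Hf t j) as [F1 F2]; [unfold j; lia|unfold j; nia|]. rewrite F1, F2.
    replace (Z.of_nat j - j0)%Z with (zpos t) by (unfold j; lia). rewrite Z.eqb_refl.
    unfold zaccepting, zstate, zpos, ztape in *. now destruct (conf t) as [[q z] T].
Qed.
End Tableau.

(** * Acceptance in terms of iterated configurations *)

Definition zstart (l : list sym) : zconf := (0, 0%Z, word_tape l).

Definition zshows (c : config) (z : zconf) : Prop := let '(q, p, T) := z in shows c q p T.
Definition zhalted (M : TM) (z : zconf) : bool := let '(q, p, T) := z in is_none (lookup M q (T p)).

Lemma znext_halted M z : zhalted M z = true -> znext M z = z.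
Proof.
  destruct z as [[q p] T]. simpl. destruct (lookup M q (T p)); easy.
Qed.

Lemma zshows_step M c z : zshows c z ->
  match step M c with
  | None => zhalted M z = true
  | Some c' => zhalted M z = false /\ zshows c' (znext M z)
  end.
Proof.
  destruct z as [[q p] T]. simpl. intro H. pose proof (shows_step M c q p T H) as Hs.
  destruct (lookup M q (T p)) as [r|].
  - destruct Hs as (c' & -> & Hc). auto.
  - now rewrite Hs.
Qed.

Lemma ziter_succ M t z : ziter M (S t) z = ziter M t (znext M z).
Proof. induction t as [|t IH]; [easy|]. simpl in *. now rewrite IH. Qed.

Lemma run_trace M T : forall c cfg z, run M T c = Some cfg -> zshows c z ->
  exists t, t <= T /\ zshows cfg (ziter M t z) /\ zhalted M (ziter M t z) = true /\
    forall u, u < t -> zhalted M (ziter M u z) = false.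
Proof.
  induction T as [|T IH]; intros c cfg z Hr Hz; simpl in Hr; pose proof (zshows_step M c z Hz) as Hs;
    destruct (step M c) as [c'|].
  - discriminate.
  - injection Hr as <-. exists 0. repeat split; auto; lia.
  - destruct Hs as [H1 H2]. destruct (IH c' cfg (znext M z) Hr H2) as (t & Ht & A1 & A2 & A3).
    exists (S t). rewrite !ziter_succ. split; [lia|]. split; [easy|]. split; [easy|].
    intros [|u] Hu; [easy|]. rewrite ziter_succ. apply A3. lia.
  - injection Hr as <-. exists 0. repeat split; auto; lia.
Qed.

Lemma ziter_stable M z t u : zhalted M (ziter M t z) = true -> t <= u -> ziter M u z = ziter M t z.
Proof.
  intros H Hu. induction Hu as [|u Hu IH]; [easy|]. simpl. rewrite IH. now apply znext_halted.
Qed.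

Definition zp (z : zconf) : Z := snd (fst z).

Lemma ziter_pos M z t : (Z.abs (zp (ziter M t z) - zp z) <= Z.of_nat t)%Z.
Proof.
  induction t as [|t IH]; simpl ziter; [lia|].
  destruct (ziter M t z) as [[q p] T]. unfold zp in *. simpl in *.
  destruct (lookup M q (T p)) as [r|]; simpl; [|lia]. destruct (r_d r); simpl; lia.
Qed.

(** Before the halt nothing is accepting, and afterwards the configuration is constant, so every
    horizon [B > T] gives the same verdict. The head moves at most one cell per step and stops with
    the run. *)
Lemma accepts_iff_zaccepting M T l B : run M T (init l) <> None -> T < B ->
  (accepts_within M T l = true <-> exists t, t < B /\ zaccepting M (ziter M t (zstart l)) = true) /\
  forall t, (Z.abs (zp (ziter M t (zstart l))) <= Z.of_nat T)%Z.
Proof.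
  intros Hrun HB. unfold accepts_within.
  destruct (run M T (init l)) as [cfg|] eqn:E; [|easy]. clear Hrun.
  destruct (run_trace M T _ _ _ E (init_shows l 0 eq_refl : zshows _ (zstart l))) as (t & Ht & H1 & H2 & H3).
  assert (Hacc : zaccepting M (ziter M t (zstart l)) = match output cfg with true :: _ => true | _ => false end).
  { destruct (ziter M t (zstart l)) as [[q p] tp]. simpl in *. destruct H1 as (_ & Hh & _).
    unfold accepting, output. rewrite H2, Hh. simpl. now destruct (tp p) as [[]|]. }
  split.
  - rewrite <- Hacc. split.
    + intro A. exists t. split; [lia|easy].
    + intros (u & Hu & A). destruct (Nat.lt_ge_cases u t) as [Hlt|Hge].
      * specialize (H3 u Hlt). destruct (ziter M u (zstart l)) as [[q p] tp]. simpl in *.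
        unfold accepting in A. rewrite H3 in A. discriminate.
      * now rewrite <- (ziter_stable M _ t u H2 Hge).
  - intro u. destruct (Nat.le_ge_cases u t) as [Hle|Hge].
    + pose proof (ziter_pos M (zstart l) u) as P. unfold zstart at 2 in P. unfold zp at 2 in P. simpl in P. lia.
    + rewrite (ziter_stable M _ t u H2 Hge).
      pose proof (ziter_pos M (zstart l) t) as P. unfold zstart at 2 in P. unfold zp at 2 in P. simpl in P. lia.
Qed.

(* [booted M] starts on the blank cell left of the input, in the fresh state
   [boot_state M], so that no input cell of the first tableau row carries the head. *)
Definition boot_state (M : TM) : nat := S (list_max (map r_q M ++ map r_q' M)).
Definition booted (M : TM) : TM := mkRule (boot_state M) None 0 None DR :: M.

Lemma booted_states M r : In r (booted M) -> r_q' r < S (boot_state M).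
Proof.
  intros [<-|H]; [simpl; lia|]. unfold boot_state.
  enough (r_q' r <= list_max (map r_q M ++ map r_q' M)) by lia.
  apply list_max_in, in_or_app. right. now apply in_map.
Qed.

Lemma lookup_booted M q s : q < boot_state M -> lookup (booted M) q s = lookup M q s.
Proof.
  intro H. unfold lookup, booted. cbn [find r_q].
  destruct (Nat.eqb_spec (boot_state M) q); [lia|easy].
Qed.

Lemma ziter_state M z t : fst (fst z) < boot_state M -> fst (fst (ziter M t z)) < boot_state M.
Proof.
  intro H. induction t as [|t IH]; [easy|]. simpl. destruct (ziter M t z) as [[q p] T]. simpl in *.
  destruct (lookup M q (T p)) as [r|] eqn:E; [|easy]. simpl. unfold lookup in E.
  apply find_some in E. destruct E as [E _]. unfold boot_state.
  enough (r_q' r <= list_max (map r_q M ++ map r_q' M)) by lia.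
  apply list_max_in, in_or_app. right. now apply in_map.
Qed.

Definition zboot (M : TM) (l : list sym) : zconf := (boot_state M, (-1)%Z, word_tape l).

Lemma znext_booted M z : fst (fst z) < boot_state M -> znext (booted M) z = znext M z.
Proof. destruct z as [[q p] T]. cbn [fst]. intro H. unfold znext. now rewrite lookup_booted. Qed.

(** The new rule rewrites a blank by a blank and leads to the ordinary start; it never fires again,
    since its state exceeds all states of [M]. *)
Lemma ziter_booted M l t : ziter (booted M) (S t) (zboot M l) = ziter M t (zstart l).
Proof.
  rewrite ziter_succ.
  assert (E : znext (booted M) (zboot M l) = zstart l).
  { unfold zboot, booted. simpl. rewrite Nat.eqb_refl. simpl. unfold zstart. f_equal.
    apply functional_extensionality; intro z. unfold zupd.
    destruct (Z.eqb_spec z (-1)); [now subst|easy]. }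
  rewrite E. induction t as [|t IH]; [easy|]. simpl. rewrite IH. apply znext_booted.
  apply ziter_state. unfold boot_state. simpl. lia.
Qed.

(** Booting costs one step and starts one cell to the left, whence [T + 1] in both bounds. *)
Lemma booted_accepts M T l B : run M T (init l) <> None -> T + 1 < B ->
  (accepts_within M T l = true <->
     exists t, t < B /\ zaccepting (booted M) (ziter (booted M) t (zboot M l)) = true) /\
  forall t, (Z.abs (zp (ziter (booted M) t (zboot M l))) <= Z.of_nat T + 1)%Z.
Proof.
  intros Hrun HB. destruct (accepts_iff_zaccepting M T l (B - 1) Hrun ltac:(lia)) as [H1 H2].
  assert (Hz : forall z, fst (fst z) < boot_state M -> zaccepting (booted M) z = zaccepting M z).
  { intros [[q p] tp] Hq. unfold zaccepting, accepting. now rewrite lookup_booted. }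
  assert (Hst : forall t, fst (fst (ziter M t (zstart l))) < boot_state M).
  { intro t. apply ziter_state. unfold boot_state. simpl. lia. }
  split.
  - rewrite H1. split.
    + intros (t & Ht & A). exists (S t). split; [lia|]. rewrite ziter_booted, Hz; auto.
    + intros ([|t] & Ht & A).
      * simpl in A. unfold accepting, booted, lookup in A. cbn [find] in A.
        simpl in A. rewrite Nat.eqb_refl in A. discriminate.
      * exists t. split; [lia|]. rewrite ziter_booted in A. now rewrite <- Hz.
  - intros [|t].
    + simpl. unfold zp. simpl. lia.
    + rewrite ziter_booted. specialize (H2 t). lia.
Qed.

(** * The two circuits *)

Definition mkenv (u e v z : nat) (s : src) : nat :=
  match s with SU => u | SE => e | SV => v | SZ => z | S0 => 0 end.

(* A block template with the bases [SE], [SV], [SZ] at which it is instantiated. *)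
Definition entry : Type := list tgate * (nat * nat * nat).

Definition inst_entry (u : nat) (b : entry) : circuit :=
  let '(t, (e, v, z)) := b in map (inst (mkenv u e v z)) t.

Fixpoint chain (G u : nat) (bl : list entry) : circuit :=
  match bl with
  | [] => []
  | b :: bl' => inst_entry u b ++ chain G (u + G) bl'
  end.

Lemma chain_app G bl bl' : forall u,
  chain G u (bl ++ bl') = chain G u bl ++ chain G (u + G * length bl) bl'.
Proof.
  induction bl as [|b bl IH]; intro u; simpl.
  - now rewrite Nat.mul_0_r, Nat.add_0_r.
  - rewrite IH, app_assoc. do 2 f_equal. lia.
Qed.

Lemma chain_snoc G u bl b :
  chain G u (bl ++ [b]) = chain G u bl ++ inst_entry (u + G * length bl) b.
Proof. rewrite chain_app. simpl. now rewrite app_nil_r. Qed.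

Lemma chain_length G bl : (forall b, In b bl -> length (fst b) = G) ->
  forall u, length (chain G u bl) = G * length bl.
Proof.
  induction bl as [|b bl IH]; intros H u; simpl; [lia|].
  rewrite length_app, IH by (intros; apply H; now right).
  pose proof (H b (or_introl eq_refl)) as Hb. destruct b as [t [[e v] z]].
  simpl in *. rewrite length_map. lia.
Qed.

Lemma bsize_shannon ls ls' : map bsize ls = map bsize ls' ->
  forall f, bsize (shannon ls f) = bsize (shannon ls' f).
Proof.
  revert ls'. induction ls as [|l ls IH]; intros [|l' ls'] H f; try easy.
  injection H as H1 H2. simpl. now rewrite H1, !(IH ls' H2).
Qed.

(** Leaf offsets involve the block length, which in turn is defined from core sizes. The circle is
    broken because a size depends only on the sizes of the leaves. *)
Lemma core_size_ext ls ls' F g : map bsize ls = map bsize ls' ->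
  core_size ls F g = core_size ls' F g.
Proof.
  intro H. unfold core_size, bsizes, vec_exps. f_equal. f_equal. rewrite !map_map.
  apply map_ext. intro i. now apply bsize_shannon.
Qed.

Lemma cell_refs_bsize G G' g s s' d d' :
  map bsize (cell_refs G g s d) = map bsize (cell_refs G' g s' d').
Proof. unfold cell_refs. now rewrite !map_map. Qed.

Definition tag_vars (s : src) : list bexp := [BVar (s, 0); BVar (s, 1); BVar (s, 2); BVar (s, 3)].

Definition tag_class (t : list bool) : nat :=
  if nth 0 t false then 2 else if nth 1 t false then 1 else 0.

(* With two of the three tag patterns of class 0 guarded by [acc] and one by
   [nz], class 0 has 2A + (2^m - 1) points, class 1 has 2^(m+1), and class 2 as
   many as the two together. *)
Definition member (acc nz : bool) (t : list bool) : bool :=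
  if nth 1 t false then negb (nth 3 t false)
  else if nth 2 t false then negb (nth 3 t false) && nz
  else acc.

Section MembershipCircuit.
Variable M : TM.

Definition Nst : nat := S (boot_state M).
Definition gw : nat := csz Nst.
#[local] Arguments gw : simpl never.
#[local] Arguments Nst : simpl never.
#[local] Arguments csz : simpl never.
Notation enc := (enc_cell Nst).
Notation dec := (dec_cell Nst).
Notation ok := (cell_ok Nst).

Definition init_cell (s : sym) (h : option nat) (b : bool) (pr : tcell) : tcell :=
  mkCell false (c_nz pr || b) s h.

Definition chunk (i : nat) (v : list bool) : list bool := firstn gw (skipn (gw * i) v).

Definition F_fix (s : sym) (h : option nat) (v : list bool) : list bool :=
  enc (init_cell s h false (dec v)).
Definition F_rand (v : list bool) : list bool :=
  enc (init_cell (Some (hd false v)) None (hd false v) (dec (tl v))).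
Definition F_step (v : list bool) : list bool :=
  enc (local (booted M) (dec (chunk 0 v)) (dec (chunk 1 v)) (dec (chunk 2 v)) (dec (chunk 3 v))).
Definition F_dummy (v : list bool) : list bool := enc blank_cell.

Definition prev (G : nat) : list bexp := cell_refs G gw SU 0.
Definition rand_leaves (G : nat) : list bexp := BVar (SV, 0) :: prev G.
(** [SE] is the base of the upper left neighbour, so the other two cells of that row follow at
    distances [G] and [2 * G]. *)
Definition step_leaves (G : nat) : list bexp :=
  cell_refs G gw SE 0 ++ cell_refs G gw SE G ++ cell_refs G gw SE (2 * G) ++ prev G.

Definition size_fix s h : nat := core_size (prev 0) (F_fix s h) gw.
(* The size of a block does not depend on its operands, so they can be taken at block size 0 here. *)
Definition GD : nat :=
  size_fix None None + size_fix None (Some (boot_state M)) +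
  size_fix (Some false) None + size_fix (Some true) None +
  core_size (rand_leaves 0) F_rand gw + core_size (step_leaves 0) F_step gw +
  core_size [] F_dummy gw.

#[local] Arguments GD : simpl never.

Definition t_fix (s : sym) (h : option nat) : list tgate := padded GD GD (prev GD) (F_fix s h) gw.
Definition t_rand : list tgate := padded GD GD (rand_leaves GD) F_rand gw.
Definition t_step : list tgate := padded GD GD (step_leaves GD) F_step gw.
Definition t_dummy : list tgate := padded GD 0 [] F_dummy gw.
Definition final_leaves : list bexp := prev GD ++ tag_vars S0.
Definition F_final (v : list bool) : bool :=
  let c := dec (chunk 0 v) in member (c_acc c) (c_nz c) (skipn gw v).
Definition t_final : list tgate := block GD 0 final_leaves (fun v => [F_final v]) 1.

Lemma core_prev s h : core_size (prev GD) (F_fix s h) gw = size_fix s h.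
Proof. apply core_size_ext, cell_refs_bsize. Qed.
Lemma core_rand : core_size (rand_leaves GD) F_rand gw <= GD.
Proof.
  rewrite (core_size_ext _ (rand_leaves 0)); [unfold GD; lia|].
  unfold rand_leaves. cbn [map]. f_equal. apply cell_refs_bsize.
Qed.
Lemma core_step : core_size (step_leaves GD) F_step gw <= GD.
Proof.
  rewrite (core_size_ext _ (step_leaves 0)); [unfold GD; lia|].
  unfold step_leaves, prev. rewrite !map_app. f_equal; [|f_equal; [|f_equal]]; apply cell_refs_bsize.
Qed.
Lemma core_dummy : core_size [] F_dummy gw <= GD.
Proof. unfold GD; lia. Qed.
Lemma gw_le : gw <= GD.
Proof. pose proof core_dummy. unfold core_size in *. lia. Qed.

Lemma fix_sizes : (forall b, size_fix (Some b) None <= GD) /\ size_fix None None <= GD /\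
  size_fix None (Some (boot_state M)) <= GD.
Proof. unfold GD. split; [intros []|split]; lia. Qed.

Lemma enc_length c : length (enc c) = gw.
Proof. apply enc_cell_length. Qed.

#[local] Opaque GD gw core_size.

Definition spec : Type := sym * option nat * bool.

Fixpoint scan (pr : tcell) (sp : list spec) : list tcell :=
  match sp with
  | [] => []
  | (s, h, b) :: sp' => let c := init_cell s h b pr in c :: scan c sp'
  end.

(** The base handed over is that of the block of [pr], the last one present: [SU] always lies one
    block behind the block being added. *)
Definition realizes (inp : list bool) (b : entry) (sp : spec) : Prop :=
  let '(s, h, nz) := sp in
  forall vals L pr, tabulates GD gw vals (map enc (L ++ [pr])) -> Forall ok (L ++ [pr]) ->
    ok (init_cell s h nz pr) /\
    tabulates GD gw (ext inp vals (inst_entry (GD * length L) b))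
      (map enc (L ++ [pr; init_cell s h nz pr])).

Lemma prev_eval env inp vals L pr : tabulates GD gw vals (map enc (L ++ [pr])) ->
  env SU = GD * length L ->
  map (beval env inp vals) (prev GD) = enc pr /\ Forall (refs_below env (length vals)) (prev GD).
Proof.
  intros H He. split.
  - unfold prev. erewrite cell_refs_eval with (p := length L); [|exact H| |].
    + rewrite map_app, app_nth2, length_map, Nat.sub_diag by (rewrite length_map; lia). reflexivity.
    + rewrite length_map, length_app. simpl. lia.
    + lia.
  - eapply cell_refs_below with (p := length L); [exact H|apply gw_le| |].
    + rewrite length_map, length_app. simpl. lia.
    + lia.
Qed.

Lemma app_snoc2 {A} (L : list A) a b : L ++ [a; b] = (L ++ [a]) ++ [b].
Proof. now rewrite <- app_assoc. Qed.

Lemma realizes_block inp ls F e v z s h nz :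
  core_size ls F gw <= GD -> (forall pr, ok (init_cell s h nz pr)) ->
  (forall env vals pr, env SV = v -> map (beval env inp vals) (prev GD) = enc pr -> ok pr ->
     Forall (refs_below env (length vals)) (prev GD) ->
     Forall (refs_below env (length vals)) ls /\
     F (map (beval env inp vals) ls) = enc (init_cell s h nz pr)) ->
  realizes inp (padded GD GD ls F gw, (e, v, z)) (s, h, nz).
Proof.
  intros Hsz Hc HF vals L pr HT Hok. split; [apply Hc|].
  set (env := mkenv (GD * length L) e v z).
  destruct (prev_eval env inp vals L pr HT eq_refl) as [E1 E2].
  assert (Hpr : ok pr) by (rewrite Forall_forall in Hok; apply Hok, in_or_app; right; now left).
  destruct (HF env vals pr eq_refl E1 Hpr E2) as [H1 H2].
  rewrite app_snoc2, map_app. cbn [map]. rewrite <- H2.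
  apply (tabulates_step GD GD ls F gw env inp vals _ HT); auto.
  - rewrite length_map, length_app. unfold env. cbn [mkenv length]. lia.
  - rewrite H2. apply enc_length.
Qed.

Lemma realizes_fix inp s h e v z : size_fix s h <= GD ->
  match h with Some q => q < Nst | None => True end ->
  realizes inp (t_fix s h, (e, v, z)) (s, h, false).
Proof.
  intros Hsz Hh. apply realizes_block; [now rewrite core_prev|easy|].
  intros env vals pr _ E Hpr Hr. split; [easy|]. rewrite E. unfold F_fix. now rewrite dec_enc_cell.
Qed.

Lemma realizes_rand inp e v z :
  realizes inp (t_rand, (e, v, z)) (Some (nth v inp false), None, nth v inp false).
Proof.
  apply realizes_block; [apply core_rand|easy|].
  intros env vals pr Hv E Hpr Hr. split; [now constructor|].
  unfold rand_leaves. cbn [map beval]. rewrite E. unfold F_rand, oval. cbn [fst snd hd tl].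
  now rewrite dec_enc_cell, Nat.add_0_r, Hv.
Qed.

Lemma chain_init inp bl sp : Forall2 (realizes inp) bl sp -> forall vals L pr,
  tabulates GD gw vals (map enc (L ++ [pr])) -> Forall ok (L ++ [pr]) ->
  Forall ok (L ++ pr :: scan pr sp) /\
  tabulates GD gw (ext inp vals (chain GD (GD * length L) bl)) (map enc (L ++ pr :: scan pr sp)).
Proof.
  induction 1 as [|b [[s h] nz] bl sp Hb Hbl IH]; intros vals L pr HT Hok; [easy|].
  simpl. destruct (Hb vals L pr HT Hok) as [Hc HT'].
  rewrite ext_app. set (c := init_cell s h nz pr) in *.
  rewrite app_snoc2 in HT'.
  destruct (IH _ (L ++ [pr]) c HT') as [I1 I2].
  { apply Forall_app. auto. }
  rewrite length_app in I2. simpl in I2. rewrite Nat.mul_add_distr_l, Nat.mul_1_r in I2.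
  rewrite <- app_assoc in I1, I2. auto.
Qed.

Lemma chunk_app0 a b : length a = gw -> chunk 0 (a ++ b) = a.
Proof.
  intro H. unfold chunk. rewrite Nat.mul_0_r. simpl.
  rewrite <- H, firstn_app, Nat.sub_diag, firstn_all. simpl. now rewrite app_nil_r.
Qed.

Lemma chunk_appS i a b : length a = gw -> chunk (S i) (a ++ b) = chunk i b.
Proof.
  intro H. unfold chunk. f_equal. rewrite skipn_app, H.
  rewrite skipn_all2 by nia. simpl. f_equal. lia.
Qed.

Definition step_entries (v k : nat) : list entry :=
  map (fun i => (t_step, (GD * i, v, 0))) (seq 0 k).

Lemma chain_steps inp vals L v W k : length L = W + 1 -> 1 < W ->
  (forall k, Forall ok (grow (booted M) W k L)) ->
  tabulates GD gw vals (map enc L) ->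
  tabulates GD gw (ext inp vals (chain GD (GD * W) (step_entries v k)))
    (map enc (grow (booted M) W k L)).
Proof.
  intros HL HW Hok HT. induction k as [|k IH]; [easy|].
  unfold step_entries in *. rewrite seq_S, map_app. cbn [map]. rewrite chain_snoc, ext_app.
  rewrite length_map, length_seq. cbn [inst_entry grow]. cbn [Nat.add].
  pose proof (grow_length (booted M) W k L) as HP.
  specialize (Hok k).
  set (vals' := ext inp vals _) in *. set (L' := grow (booted M) W k L) in *.
  (* As [L'] has W + 1 + k blocks, none of the truncated subtractions cuts off: the sources are
     blocks k, k + 1, k + 2 and W + k. *)
  unfold grow1. replace (length L' - W - 1) with k by lia. replace (length L' - W) with (k + 1) by lia.
  replace (k + 1 + 1) with (k + 2) by lia. replace (length L' - 1) with (W + k) by lia.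
  set (c := local _ _ _ _ _). rewrite map_app.
  set (env := mkenv (GD * W + GD * k) (GD * k) v 0).
  assert (HR : forall s d p, p < length L' -> env s + d = GD * p ->
    map (beval env inp vals') (cell_refs GD gw s d) = enc (nth p L' blank_cell) /\
    Forall (refs_below env (length vals')) (cell_refs GD gw s d)).
  { intros s d p Hp He. split.
    - erewrite cell_refs_eval; [|exact IH|rewrite length_map; exact Hp|exact He].
      rewrite (nth_indep _ [] (enc blank_cell)) by now rewrite length_map. apply map_nth.
    - eapply cell_refs_below; [exact IH|apply gw_le|rewrite length_map; exact Hp|exact He]. }
  assert (Hnok : forall p, ok (nth p L' blank_cell)).
  { intro p. destruct (Nat.lt_ge_cases p (length L')).
    - rewrite Forall_forall in Hok. now apply Hok, nth_In.
    - now rewrite nth_overflow. }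
  destruct (HR SE 0 k) as [A1 B1]; [lia|unfold env; cbn [mkenv]; lia|].
  destruct (HR SE GD (k + 1)) as [A2 B2]; [lia|unfold env; cbn [mkenv]; lia|].
  destruct (HR SE (2 * GD) (k + 2)) as [A3 B3]; [lia|unfold env; cbn [mkenv]; lia|].
  destruct (HR SU 0 (W + k)) as [A4 B4]; [lia|unfold env; cbn [mkenv]; lia|].
  pose proof (tabulates_step GD GD (step_leaves GD) F_step gw env inp vals' _ IH core_step) as S.
  assert (EF : F_step (map (beval env inp vals') (step_leaves GD)) = enc c).
  { unfold step_leaves, prev. rewrite !map_app, A1, A2, A3, A4. unfold F_step.
    rewrite !chunk_appS, !chunk_app0 by apply enc_length.
    rewrite <- (app_nil_r (enc (nth (W + k) L' blank_cell))), chunk_app0 by apply enc_length.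
    now rewrite !dec_enc_cell by apply Hnok. }
  rewrite EF in S. apply S.
  - rewrite length_map. unfold env. cbn [mkenv]. rewrite HP, HL. lia.
  - unfold step_leaves. rewrite !Forall_app. auto.
  - apply enc_length.
Qed.

Definition blank_spec : spec := (None, None, false).
(** The row consists of a margin, the boot cell holding the head, the input, the separating blank of
    [pair_input], the coins and another margin. Only coins contribute to [c_nz]. *)
Definition init_specs (x r : list bool) (K : nat) : list spec :=
  repeat blank_spec K ++ [(None, Some (boot_state M), false)] ++
  map (fun b => (Some b, None, false)) x ++ [blank_spec] ++
  map (fun b => (Some b, None, b)) r ++ repeat blank_spec K.

(** Coin i is input variable [4 + i], behind the tag bits. Blocks that read no variable still record
    the value of [SV]: it is what the register of the printing program holds at that moment. *)
Definition init_entries (x : list bool) (m K : nat) : list entry :=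
  repeat (t_fix None None, (0, 4, 0)) K ++
  [(t_fix None (Some (boot_state M)), (0, 4, 0))] ++
  map (fun b => (t_fix (Some b) None, (0, 4, 0))) x ++
  [(t_fix None None, (0, 4, 0))] ++
  map (fun i => (t_rand, (0, 4 + i, 0))) (seq 0 m) ++
  repeat (t_fix None None, (0, 4 + m, 0)) K.

Definition circuit_D (x : list bool) (m K W : nat) : circuit :=
  inst_entry 0 (t_dummy, (0, 4, 0)) ++
  chain GD 0 (init_entries x m K ++ step_entries (4 + m) (W * W)) ++
  inst_entry (GD * (W + W * W)) (t_final, (GD * (W * W), 4 + m, 0)).

(** The summand 2 counts the boot cell and the separating blank. *)
Definition row_width (n m K : nat) : nat := 2 * K + n + m + 2.

Lemma init_realized x t r K : length t = 4 ->
  Forall2 (realizes (t ++ r)) (init_entries x (length r) K) (init_specs x r K).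
Proof.
  intro Ht. unfold init_entries, init_specs.
  destruct fix_sizes as (Hsz & H0 & H1).
  assert (Hrep : forall v, Forall2 (realizes (t ++ r)) (repeat (t_fix None None, (0, v, 0)) K) (repeat blank_spec K)).
  { intro v. induction K; simpl; constructor; auto. now apply realizes_fix. }
  apply Forall2_app; [apply Hrep|].
  apply Forall2_app; [constructor; [|constructor]; apply realizes_fix; unfold Nst; auto|].
  apply Forall2_app; [induction x; simpl; constructor; auto; now apply realizes_fix|].
  apply Forall2_app; [constructor; [|constructor]; now apply realizes_fix|].
  apply Forall2_app; [|apply Hrep].
  rewrite <- (map_nth_seq r false) at 3. rewrite map_map.
  assert (Hn : forall i, nth (4 + i) (t ++ r) false = nth i r false).
  { intro i. rewrite app_nth2 by lia. f_equal. lia. }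
  induction (seq 0 (length r)) as [|i l IH]; simpl; constructor; auto.
  rewrite <- Hn. apply realizes_rand.
Qed.

Lemma scan_length sp : forall pr, length (scan pr sp) = length sp.
Proof. induction sp as [|[[s h] b] sp IH]; intro pr; simpl; auto. Qed.

Lemma scan_nth sp : forall pr i, i < length sp ->
  c_sym (nth i (scan pr sp) blank_cell) = nth i (map (fun q => fst (fst q)) sp) None /\
  c_state (nth i (scan pr sp) blank_cell) = nth i (map (fun q => snd (fst q)) sp) None.
Proof.
  induction sp as [|[[s h] b] sp IH]; intros pr i Hi; simpl in Hi; [lia|].
  destruct i as [|i]; simpl; [easy|]. apply IH. lia.
Qed.

Lemma scan_last sp : forall pr, c_acc pr = false ->
  c_acc (nth (length sp) (pr :: scan pr sp) blank_cell) = false /\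
  c_nz (nth (length sp) (pr :: scan pr sp) blank_cell) = c_nz pr || existsb snd sp.
Proof.
  induction sp as [|[[s h] b] sp IH]; intros pr Ha; [simpl; now rewrite orb_false_r|].
  cbn [length scan]. destruct (IH (init_cell s h b pr) eq_refl) as [I1 I2].
  cbn [nth]. split; [exact I1|]. cbn [nth] in I2. 
  rewrite I2. simpl. now rewrite orb_assoc.
Qed.

Lemma init_specs_length x r K : length (init_specs x r K) = row_width (length x) (length r) K.
Proof.
  unfold init_specs, row_width. rewrite !length_app, !repeat_length, !length_map. simpl. lia.
Qed.

Lemma existsb_init_specs x r K : existsb snd (init_specs x r K) = existsb (fun b => b) r.
Proof.
  unfold init_specs. rewrite !existsb_app.
  assert (H1 : @existsb spec snd (repeat blank_spec K) = false) by (induction K; auto).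
  assert (H2 : @existsb spec snd (@map bool spec (fun b => (Some b, None, false)) x) = false) by (induction x; auto).
  assert (H3 : @existsb spec snd (@map bool spec (fun b => (Some b, None, b)) r) = existsb (fun b => b) r).
  { induction r as [|b r IH]; simpl; [easy|]. now rewrite IH. }
  unfold spec, sym in *. rewrite H1, H2, H3. simpl. apply orb_false_r.
Qed.

Lemma nth_repeat_any {A} (a : A) k i : nth i (repeat a k) a = a.
Proof. revert i. induction k; intros [|i]; simpl; auto. Qed.

Lemma word_tape_padded l a b j :
  nth j (repeat None a ++ l ++ repeat None b) None = word_tape l (Z.of_nat j - Z.of_nat a).
Proof.
  unfold word_tape. destruct (Nat.lt_ge_cases j a).
  - rewrite app_nth1 by (rewrite repeat_length; lia).
    destruct (Z.leb_spec 0 (Z.of_nat j - Z.of_nat a)); [lia|]. apply nth_repeat_any.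
  - rewrite app_nth2, repeat_length by (rewrite repeat_length; lia).
    destruct (Z.leb_spec 0 (Z.of_nat j - Z.of_nat a)); [|lia].
    replace (Z.to_nat (Z.of_nat j - Z.of_nat a)) with (j - a) by lia.
    destruct (Nat.lt_ge_cases (j - a) (length l)).
    + now rewrite app_nth1.
    + rewrite app_nth2 by easy. rewrite nth_repeat_any. now rewrite nth_overflow.
Qed.

Lemma init_specs_sym x r K j :
  nth j (map (fun q => fst (fst q)) (init_specs x r K)) None =
  word_tape (pair_input x r) (Z.of_nat j - Z.of_nat (K + 1)).
Proof.
  rewrite <- (word_tape_padded _ _ K). f_equal. unfold init_specs, pair_input.
  rewrite !map_app, !map_map. cbn [map fst blank_spec]. rewrite !map_repeat. cbn [fst blank_spec].
  rewrite repeat_app. simpl repeat at 3. rewrite <- !app_assoc. reflexivity.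
Qed.

Lemma nth_map_none {A} (l : list A) i : nth i (map (fun _ => @None nat) l) None = None.
Proof. revert i. induction l; intros [|i]; simpl; auto. Qed.

Lemma init_specs_state x r K j :
  nth j (map (fun q => snd (fst q)) (init_specs x r K)) None =
  if j =? K then Some (boot_state M) else None.
Proof.
  unfold init_specs. rewrite map_app, map_repeat. cbn [fst snd blank_spec].
  destruct (Nat.lt_ge_cases j K).
  - rewrite app_nth1 by (rewrite repeat_length; lia). rewrite nth_repeat_any.
    destruct (Nat.eqb_spec j K); [lia|easy].
  - rewrite app_nth2, repeat_length by (rewrite repeat_length; lia).
    destruct (Nat.eqb_spec j K) as [->|].
    + now rewrite Nat.sub_diag.
    + destruct (j - K) as [|i] eqn:E; [lia|]. cbn [app map nth]. clear.
      set (l := map _ x ++ _).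
      assert (Hl : forall q, In q l -> snd (fst q) = None).
      { intros q Hq. unfold l in Hq. apply in_app_or in Hq. destruct Hq as [Hq|[<-|Hq]].
        - apply in_map_iff in Hq. now destruct Hq as (b & <- & _).
        - easy.
        - apply in_app_or in Hq. destruct Hq as [Hq|Hq].
          + apply in_map_iff in Hq. now destruct Hq as (b & <- & _).
          + now rewrite (repeat_spec _ _ _ Hq). }
      etransitivity; [|apply (nth_map_none l i)]. f_equal. apply map_ext_in. exact Hl.
Qed.

Definition first_row (x r : list bool) (K : nat) : list tcell :=
  blank_cell :: scan blank_cell (init_specs x r K).

(** The shift is [K + 2] because the boot cell is column K + 1, behind the dummy and K blanks, and
    shows tape cell -1. *)
Lemma first_row_inv x r K :
  Forall ok (first_row x r K) ->
  tableau_inv (booted M) Nst (row_width (length x) (length r) K)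
    (zboot M (pair_input x r)) (Z.of_nat (K + 2)) 0 (existsb (fun b => b) r) (first_row x r K).
Proof.
  intros Hok. set (W := row_width _ _ _).
  assert (HW : length (init_specs x r K) = W) by apply init_specs_length.
  unfold tableau_inv, first_row in *. split; [|split; [|split; [|split; [|split]]]].
  - simpl. rewrite scan_length. lia.
  - exact Hok.
  - reflexivity.
  - intros t j Hj Hlt. simpl in Hlt. rewrite scan_length, HW in Hlt.
    assert (t = 0) by nia. subst t. rewrite Nat.mul_0_l, Nat.add_0_l.
    destruct j as [|j]; [lia|]. cbn [nth].
    destruct (scan_nth (init_specs x r K) blank_cell j ltac:(lia)) as [S1 S2].
    unfold faithful. rewrite S1, S2, init_specs_sym, init_specs_state.
    unfold ztape, zpos, zstate, conf. simpl ziter. cbn [zboot fst snd].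
    split.
    + f_equal. lia.
    + destruct (Nat.eqb_spec j K), (Z.eqb_spec (-1) (Z.of_nat (S j) - Z.of_nat (K + 2))); lia || easy.
  - rewrite Nat.add_0_r, <- HW. now apply scan_last.
  - rewrite Nat.add_0_r, <- HW.
    destruct (scan_last (init_specs x r K) blank_cell eq_refl) as [_ ->].
    now rewrite existsb_init_specs.
Qed.

Lemma circuit_D_correct x r t T K : length t = 4 -> run M T (init (pair_input x r)) <> None -> T + 1 < K ->
  eval_circ (circuit_D x (length r) K (row_width (length x) (length r) K)) (t ++ r) =
  member (accepts_within M T (pair_input x r)) (existsb (fun b => b) r) t.
Proof.
  intros Ht Hrun HK. set (W := row_width _ _ _).
  set (inp := t ++ r). set (l := pair_input x r).
  rewrite eval_circ_ext. unfold circuit_D. rewrite chain_app, !ext_app.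
  assert (H0 : tabulates GD gw (ext inp [] (inst_entry 0 (t_dummy, (0, 4, 0)))) (map enc ([] ++ [blank_cell]))).
  { pose proof (tabulates_step GD 0 [] F_dummy gw (mkenv 0 0 4 0) inp [] [] (tabulates_nil _ _) core_dummy) as S.
    apply S; [simpl; lia|easy|apply enc_length]. }
  destruct (chain_init inp _ _ (init_realized x t r K Ht) _ _ _ H0) as [Hok H1].
  { constructor; [exact I|constructor]. }
  fold inp in H1. simpl length in H1. rewrite Nat.mul_0_r in H1.
  cbn [app] in Hok, H1. fold (first_row x r K) in Hok, H1.
  set (vals1 := ext inp _ (chain GD 0 (init_entries x (length r) K))) in *.
  assert (Hlen : length (init_entries x (length r) K) = W).
  { unfold init_entries, W, row_width. rewrite !length_app, !repeat_length, !length_map, length_seq. simpl. lia. }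
  rewrite Hlen, Nat.add_0_l.
  destruct (booted_accepts M T l W Hrun) as [Hacc Hpos]; [unfold W, row_width; lia|].
  (* The head stays within distance T + 1 < K of column K + 2, hence strictly between the row
     ends. *)
  assert (Hin : forall u, (1 < zpos (booted M) (zboot M l) u + Z.of_nat (K + 2) < Z.of_nat W)%Z).
  { intro u. specialize (Hpos u). unfold zp in Hpos. unfold zpos, conf, W, row_width. lia. }
  pose proof (first_row_inv x r K Hok) as Hinv. fold W l in Hinv.
  pose proof (tableau_result (booted M) Nst (booted_states M) W _ _ Hin _ _ Hinv) as HR.
  assert (Hoks : forall k, Forall ok (grow (booted M) W k (first_row x r K))).
  { intro k. destruct (tableau_grow (booted M) Nst (booted_states M) W _ _ Hin k _ _ Hinv) as (_ & Hk & _). exact Hk. }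
  assert (HLen : length (first_row x r K) = W + 1).
  { unfold first_row. simpl. rewrite scan_length, init_specs_length. fold W. lia. }
  pose proof (chain_steps inp vals1 (first_row x r K) (4 + length r) W (W * W) HLen ltac:(unfold W, row_width; lia) Hoks H1) as H2.
  set (vals2 := ext inp vals1 _) in *. set (L := grow _ _ _ _) in *.
  cbv zeta in HR. destruct HR as (_ & Hn & Ha).
  set (c := nth (W + W * W) L blank_cell) in *.
  assert (HL : length L = W + W * W + 1) by (unfold L; rewrite grow_length, HLen; lia).
  set (env := mkenv (GD * (W + W * W)) (GD * (W * W)) (4 + length r) 0).
  assert (Hp : W + W * W < length (map enc L)) by (rewrite length_map; lia).
  assert (E1 : map (beval env inp vals2) (prev GD) = enc c).
  { unfold prev. rewrite (cell_refs_eval GD gw vals2 (map enc L) env inp SU 0 (W + W * W) H2 Hp) by (unfold env; cbn [mkenv]; lia).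
    rewrite (nth_indep _ [] (enc blank_cell)) by easy. apply map_nth. }
  assert (Hokc : ok c).
  { pose proof (Hoks (W * W)) as Hk. rewrite Forall_forall in Hk. apply Hk, nth_In. fold L. lia. }
  unfold inst_entry, t_final. fold env. rewrite final_block.
  - unfold final_leaves. rewrite map_app, E1. unfold F_final. rewrite chunk_app0 by apply enc_length.
    rewrite dec_enc_cell by easy. rewrite Hn.
    replace (skipn gw _) with t.
    2:{ rewrite skipn_app, skipn_all2 by (rewrite enc_length; easy).
        rewrite enc_length, Nat.sub_diag. unfold inp.
        destruct t as [|t0 [|t1 [|t2 [|t3 [|]]]]]; try discriminate. reflexivity. }
    f_equal. apply eq_true_iff_eq. rewrite Ha. unfold conf. now rewrite Hacc.
  - destruct H2 as (Hv & _). rewrite Hv, length_map, HL. unfold env. cbn [mkenv]. lia.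
  - unfold final_leaves. apply Forall_app. split; [|repeat constructor].
    apply (cell_refs_below GD gw vals2 (map enc L) env SU 0 (W + W * W) H2 gw_le Hp). unfold env. cbn [mkenv]. lia.
Qed.

(** The encoding of a circuit begins with its number of gates, which must therefore be printed
    before any gate. *)
Lemma circuit_D_length x m K W : W = row_width (length x) m K ->
  length (circuit_D x m K W) = GD * (1 + W + W * W) + core_size final_leaves (fun v => [F_final v]) 1.
Proof.
  intro HW. unfold circuit_D. rewrite !length_app.
  assert (Hf : forall s h, size_fix s h <= GD -> length (t_fix s h) = GD).
  { intros s h Hs. apply padded_length. now rewrite core_prev. }
  destruct fix_sizes as (Hsz & H0 & H1).
  rewrite chain_length.
  - unfold inst_entry, t_final, t_dummy, init_entries, step_entries.
    rewrite !length_map, block_length, !length_app, !length_map, !repeat_length, !length_seq.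
    rewrite padded_length by apply core_dummy. cbn [length].
    subst W. unfold row_width. ring.
  - intros b Hb. unfold init_entries, step_entries in Hb. rewrite !in_app_iff in Hb.
    destruct Hb as [[Hb|[[<-|[]]|[Hb|[[<-|[]]|[Hb|Hb]]]]]|Hb]; simpl; auto.
    + rewrite (repeat_spec _ _ _ Hb). simpl. auto.
    + apply in_map_iff in Hb. destruct Hb as (a & <- & _). simpl. auto.
    + apply in_map_iff in Hb. destruct Hb as (a & <- & _). simpl. apply padded_length, core_rand.
    + rewrite (repeat_spec _ _ _ Hb). simpl. auto.
    + apply in_map_iff in Hb. destruct Hb as (a & <- & _). simpl. apply padded_length, core_step.
Qed.
End MembershipCircuit.

(** * The order circuit: comparison of binary numbers *)

Fixpoint value (y : list bool) (k : nat) : nat :=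
  match k with 0 => 0 | S k' => value y k' + Nat.b2n (nth k' y false) * 2 ^ k' end.

Lemma value_lt y k : value y k < 2 ^ k.
Proof.
  induction k as [|k IH]; simpl; [lia|]. destruct (nth k y false); simpl; lia.
Qed.

Lemma value_inj y z k : value y k = value z k ->
  forall i, i < k -> nth i y false = nth i z false.
Proof.
  induction k as [|k IH]; intros H i Hi; [lia|]. simpl in H.
  pose proof (value_lt y k). pose proof (value_lt z k).
  assert (E : nth k y false = nth k z false /\ value y k = value z k).
  { destruct (nth k y false), (nth k z false); simpl in H; split; try easy; lia. }
  destruct E as [E1 E2]. destruct (Nat.eq_dec i k) as [->|]; [easy|]. apply IH; [easy|lia].
Qed.

(** Since [value] takes bit 0 as the lowest, a scan in index order compares two strings with one
    carried bit: unequal new bits decide, equal ones keep the verdict [p] on the lower bits. *)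
Definition le_bit (v : list bool) : bool :=
  let p := nth 0 v false in let a := nth 1 v false in let b := nth 2 v false in
  (negb a && b) || (Bool.eqb a b && p).

Lemma le_bit_value y z k :
  le_bit [value y k <=? value z k; nth k y false; nth k z false] = (value y (S k) <=? value z (S k)).
Proof.
  unfold le_bit. cbn [nth value]. pose proof (value_lt y k). pose proof (value_lt z k).
  destruct (nth k y false), (nth k z false); simpl;
    destruct (Nat.leb_spec (value y k) (value z k));
    symmetry; (apply Nat.leb_le || apply Nat.leb_gt); lia.
Qed.

Definition F_le (v : list bool) : list bool := [le_bit v].
Definition F_true (v : list bool) : list bool := [true].
Definition le_leaves (G : nat) : list bexp := cell_refs G 1 SU 0 ++ [BVar (SV, 0); BVar (SZ, 0)].
Definition GC : nat := core_size [] F_true 1 + core_size (le_leaves 0) F_le 1.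
#[local] Arguments GC : simpl never.

Definition t_true : list tgate := padded GC 0 [] F_true 1.
Definition t_le : list tgate := padded GC GC (le_leaves GC) F_le 1.
Definition F_ord (v : list bool) : bool :=
  (tag_class (firstn 4 (tl v)) =? tag_class (skipn 4 (tl v))) && hd false v.
Definition ord_leaves : list bexp := cell_refs GC 1 SU 0 ++ tag_vars S0 ++ tag_vars SV.
Definition t_ord : list tgate := block GC 0 ord_leaves (fun v => [F_ord v]) 1.

Definition le_entries (N k : nat) : list entry := map (fun i => (t_le, (0, i, N + i))) (seq 0 k).

Definition circuit_C (N : nat) : circuit :=
  inst_entry 0 (t_true, (0, 0, N)) ++ chain GC 0 (le_entries N N) ++
  inst_entry (GC * N) (t_ord, (0, N, N + N)).

Lemma core_le : core_size (le_leaves GC) F_le 1 <= GC.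
Proof. rewrite (core_size_ext _ (le_leaves 0)) by reflexivity. unfold GC. lia. Qed.
Lemma core_true : core_size [] F_true 1 <= GC.
Proof. unfold GC. lia. Qed.
Lemma GC_pos : 1 <= GC.
Proof. pose proof core_true. unfold core_size in *. lia. Qed.

#[local] Opaque GC core_size.

(** Block i holds the verdict on the first i bits; block 0 is the constant [true], since empty
    prefixes have equal values. *)
Lemma chain_le y z N k : length y = N -> length z = N -> k <= N ->
  tabulates GC 1 (ext (y ++ z) [] (inst_entry 0 (t_true, (0, 0, N)) ++ chain GC 0 (le_entries N k)))
    (map (fun i => [value y i <=? value z i]) (seq 0 (S k))).
Proof.
  intros Hy Hz. set (inp := y ++ z). induction k as [|k IH]; intro Hk.
  - simpl chain. rewrite app_nil_r.
    pose proof (tabulates_step GC 0 [] F_true 1 (mkenv 0 0 0 N) inp [] [] (tabulates_nil _ _) core_true) as S.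
    apply S; [simpl; lia|easy|easy].
  - specialize (IH ltac:(lia)). unfold le_entries in *. rewrite seq_S, map_app, chain_app, app_assoc, ext_app.
    rewrite (seq_S (S k)), map_app, length_map, length_seq. simpl chain. rewrite app_nil_r, Nat.add_0_l.
    set (vals := ext inp [] _) in *. set (L := map _ (seq 0 (S k))) in *.
    assert (HL : length L = S k) by (unfold L; now rewrite length_map, length_seq).
    set (env := mkenv (GC * k) 0 k (N + k)).
    pose proof (tabulates_step GC GC (le_leaves GC) F_le 1 env inp vals L IH core_le) as S.
    assert (E : map (beval env inp vals) (le_leaves GC) = [value y k <=? value z k; nth k y false; nth k z false]).
    { unfold le_leaves. rewrite map_app.
      rewrite (cell_refs_eval GC 1 vals L env inp SU 0 k IH) by (unfold env; cbn [mkenv]; lia).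
      unfold L. rewrite (nth_indep _ [] [value y 0 <=? value z 0]) by (rewrite length_map, length_seq; lia).
      rewrite (map_nth (fun i => [value y i <=? value z i])), seq_nth by lia. simpl.
      unfold inp. unfold oval; cbn [fst snd env mkenv]. rewrite !Nat.add_0_r.
      assert (E1 : nth k (y ++ z) false = nth k y false) by (apply app_nth1; lia).
      assert (E2 : nth (N + k) (y ++ z) false = nth k z false) by (rewrite app_nth2 by lia; f_equal; lia).
      now rewrite E1, E2. }
    rewrite E in S. unfold F_le in S at 2 3. rewrite le_bit_value in S.
    apply S; [unfold env; cbn [mkenv]; lia| |easy].
    unfold le_leaves. apply Forall_app. split; [|repeat constructor].
    apply (cell_refs_below GC 1 vals L env SU 0 k IH GC_pos); unfold env; cbn [mkenv]; lia.
Qed.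

Lemma tag_class_firstn t : tag_class (firstn 4 t) = tag_class t.
Proof. now destruct t as [|? [|? [|? [|]]]]. Qed.

Lemma map_tag_vars env inp vals s : map (beval env inp vals) (tag_vars s) =
  [nth (env s) inp false; nth (env s + 1) inp false; nth (env s + 2) inp false; nth (env s + 3) inp false].
Proof. unfold tag_vars. cbn [map beval]. unfold oval. cbn [fst snd]. now rewrite Nat.add_0_r. Qed.

Lemma circuit_C_correct N y z : length y = N -> length z = N -> 4 <= N ->
  eval_circ (circuit_C N) (y ++ z) = (tag_class y =? tag_class z) && (value y N <=? value z N).
Proof.
  intros Hy Hz HN. rewrite eval_circ_ext. unfold circuit_C. rewrite app_assoc, ext_app.
  pose proof (chain_le y z N N Hy Hz (Nat.le_refl _)) as HT.
  set (inp := y ++ z) in *. set (vals := ext inp [] _) in *. set (L := map _ (seq 0 (S N))) in *.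
  assert (HL : length L = S N) by (unfold L; now rewrite length_map, length_seq).
  unfold inst_entry, t_ord. set (env := mkenv (GC * N) 0 N (N + N)).
  rewrite final_block.
  - unfold ord_leaves. rewrite !map_app, !map_tag_vars.
    rewrite (cell_refs_eval GC 1 vals L env inp SU 0 N HT) by (unfold env; cbn [mkenv]; lia).
    unfold L. rewrite (nth_indep _ [] [value y 0 <=? value z 0]) by (rewrite length_map, length_seq; lia).
    rewrite (map_nth (fun i => [value y i <=? value z i])), seq_nth by lia.
    unfold F_ord. cbn [app tl hd firstn skipn env mkenv Nat.add].
    f_equal. f_equal.
    + unfold inp. rewrite !app_nth1 by lia.
      rewrite <- (tag_class_firstn y). destruct y as [|? [|? [|? [|]]]]; simpl in Hy; try lia; reflexivity.
    + unfold inp. rewrite !app_nth2 by lia. rewrite Hy, Nat.sub_diag.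
      replace (N + 1 - N) with 1 by lia. replace (N + 2 - N) with 2 by lia. replace (N + 3 - N) with 3 by lia.
      rewrite <- (tag_class_firstn z). destruct z as [|? [|? [|? [|]]]]; simpl in Hz; try lia; reflexivity.
  - destruct HT as (Hv & _). rewrite Hv, HL. unfold env. cbn [mkenv]. lia.
  - unfold ord_leaves. rewrite !Forall_app. split; [|repeat constructor].
    apply (cell_refs_below GC 1 vals L env SU 0 N HT GC_pos); unfold env; cbn [mkenv]; lia.
Qed.

Lemma circuit_C_length N : length (circuit_C N) = GC * (N + 1) + core_size ord_leaves (fun v => [F_ord v]) 1.
Proof.
  unfold circuit_C. rewrite !length_app, chain_length.
  - unfold inst_entry, t_ord, t_true, le_entries. rewrite !length_map, block_length, length_seq.
    rewrite padded_length by apply core_true. lia.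
  - intros b Hb. apply in_map_iff in Hb. destruct Hb as (i & <- & _). apply padded_length, core_le.
Qed.

(** * Three-heap Nim *)

(** After division by 2^k with k the top bit of [s], the number [s] becomes 1 and [h] becomes odd,
    so the exclusive or strictly lowers the quotient. *)
Lemma lxor_lt_of_bit h s : s <> 0 -> Nat.testbit h (Nat.log2 s) = true -> Nat.lxor h s < h.
Proof.
  intros Hs Hb. set (k := Nat.log2 s) in *.
  assert (Hk : 2 ^ k <> 0) by (apply Nat.pow_nonzero; lia).
  assert (H1 : s / 2 ^ k = 1).
  { destruct (Nat.log2_spec s) as [L1 L2]; [lia|]. fold k in L1, L2. rewrite Nat.pow_succ_r' in L2.
    symmetry. apply Nat.div_unique with (r := s - 2 ^ k); lia. }
  assert (H2 : Nat.lxor h s / 2 ^ k = Nat.lxor (h / 2 ^ k) 1).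
  { pose proof (Nat.shiftr_lxor h s k) as H2. now rewrite !Nat.shiftr_div_pow2, H1 in H2. }
  assert (H3 : Nat.odd (h / 2 ^ k) = true) by (now rewrite <- Nat.shiftr_div_pow2, <- Nat.testbit_odd).
  apply Nat.odd_spec in H3. destruct H3 as [w Hw].
  assert (H4 : Nat.lxor (h / 2 ^ k) 1 = 2 * w).
  { rewrite Hw. rewrite Nat.add_nocarry_lxor.
    - now rewrite Nat.lxor_assoc, Nat.lxor_nilpotent, Nat.lxor_0_r.
    - change 1 with (Nat.ones 1). rewrite Nat.land_ones. simpl (2 ^ 1).
      rewrite Nat.mul_comm. now apply Nat.Div0.mod_mul. }
  destruct (Nat.lt_ge_cases (Nat.lxor h s) h) as [|Hge]; [easy|].
  apply Nat.Div0.div_le_mono with (c := 2 ^ k) in Hge. lia.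
Qed.

Lemma nim_move a b d : Nat.lxor (Nat.lxor a b) d <> 0 ->
  (exists a', a' < a /\ Nat.lxor (Nat.lxor a' b) d = 0) \/
  (exists b', b' < b /\ Nat.lxor (Nat.lxor a b') d = 0) \/
  (exists d', d' < d /\ Nat.lxor (Nat.lxor a b) d' = 0).
Proof.
  set (s := Nat.lxor (Nat.lxor a b) d). intro Hs.
  assert (HS : forall i, xorb (xorb (Nat.testbit a i) (Nat.testbit b i)) (Nat.testbit d i) = Nat.testbit s i)
    by (intro i; unfold s; now rewrite !Nat.lxor_spec).
  assert (Hx : forall x y z, (forall i, xorb (xorb (Nat.testbit x i) (Nat.testbit y i)) (Nat.testbit z i) = false) ->
    Nat.lxor (Nat.lxor x y) z = 0).
  { intros x y z H. apply Nat.bits_inj. intro i. now rewrite !Nat.lxor_spec, H, Nat.bits_0. }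
  pose proof (HS (Nat.log2 s)) as H. rewrite Nat.bit_log2 in H by easy.
  destruct (Nat.testbit a (Nat.log2 s)) eqn:Ea; [left; exists (Nat.lxor a s)|right;
    destruct (Nat.testbit b (Nat.log2 s)) eqn:Eb; [left; exists (Nat.lxor b s)|right; exists (Nat.lxor d s)]];
    (split; [apply lxor_lt_of_bit; [easy|now destruct (Nat.testbit d (Nat.log2 s))]|]);
    apply Hx; intro i; rewrite Nat.lxor_spec, <- HS;
    now destruct (Nat.testbit a i), (Nat.testbit b i), (Nat.testbit d i).
Qed.

Lemma lxor_pow2 B k : B < 2 ^ k -> Nat.lxor B (2 ^ k) = B + 2 ^ k.
Proof.
  intro H. symmetry. apply Nat.add_nocarry_lxor. apply Nat.bits_inj. intro i.
  rewrite Nat.land_spec, Nat.pow2_bits_eqb, Nat.bits_0.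
  destruct (Nat.eqb_spec k i) as [<-|]; [|apply andb_false_r].
  rewrite <- (Nat.mod_small B (2 ^ k)) by easy. now rewrite Nat.mod_pow2_bits_high.
Qed.

(** Below 2^k the sum has no carry and agrees with the exclusive or. From 2^k up to the bound, the
    exclusive or removes the top bit instead, giving B - 2^k, which differs from B + 2^k. *)
Lemma three_heaps B k : B < 2 * 2 ^ k ->
  (Nat.lxor (Nat.lxor B (2 ^ k)) (B + 2 ^ k) = 0 <-> B < 2 ^ k).
Proof.
  intro HB. split.
  - intro H. destruct (Nat.lt_ge_cases B (2 ^ k)) as [|Hge]; [easy|].
    assert (E : Nat.lxor B (2 ^ k) = B - 2 ^ k).
    { replace B with (Nat.lxor (B - 2 ^ k) (2 ^ k)) at 1.
      - now rewrite Nat.lxor_assoc, Nat.lxor_nilpotent, Nat.lxor_0_r.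
      - rewrite lxor_pow2; lia. }
    rewrite E in H. apply Nat.lxor_eq in H. lia.
  - intro H. rewrite lxor_pow2 by easy. apply Nat.lxor_nilpotent.
Qed.

Lemma filter_filter {A} (f g : A -> bool) l :
  filter f (filter g l) = filter (fun x => g x && f x) l.
Proof.
  induction l as [|a l IH]; [easy|]. simpl. destruct (g a); simpl; now rewrite IH.
Qed.

Lemma max_value {A} (v : A -> nat) R : R <> [] -> exists x, In x R /\ forall y, In y R -> v y <= v x.
Proof.
  induction R as [|a R IH]; [easy|]. intros _. destruct R as [|b R].
  - exists a. split; [now left|]. intros y [<-|[]]. lia.
  - destruct IH as (x & Hx & Hm); [easy|]. destruct (Nat.le_ge_cases (v a) (v x)).
    + exists x. split; [now right|]. intros y [<-|Hy]; auto.
    + exists a. split; [now left|]. intros y [<-|Hy]; [lia|]. specialize (Hm y Hy). lia.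
Qed.

(** This provides the moves of Nim: taking the element of rank h leaves a heap of size h. The
    induction removes the maximum, which has rank n - 1. *)
Lemma exists_rank {A} (v : A -> nat) n : forall R, length R = n -> NoDup R ->
  (forall x y, In x R -> In y R -> v x = v y -> x = y) ->
  forall h, h < n -> exists x, In x R /\ length (filter (fun y => v y <? v x) R) = h.
Proof.
  induction n as [|n IH]; intros R HR Hnd Hinj h Hh; [lia|].
  destruct (max_value v R) as (x & Hx & Hm); [now destruct R|].
  assert (Hlen : length (filter (fun y => v y <? v x) R) = n).
  { pose proof (filter_length (fun y => v y <? v x) R) as HF.
    assert (Hin : forall y, In y (filter (fun y => negb (v y <? v x)) R) -> y = x).
    { intros y Hy. apply filter_In in Hy. destruct Hy as [Hy Hv].
      apply negb_true_iff, Nat.ltb_ge in Hv. specialize (Hm y Hy). apply Hinj; auto. lia. }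
    assert (Hnd' : NoDup (filter (fun y => negb (v y <? v x)) R)) by now apply NoDup_filter.
    assert (Hx' : In x (filter (fun y => negb (v y <? v x)) R)).
    { apply filter_In. now rewrite Nat.ltb_irrefl. }
    destruct (filter (fun y => negb (v y <? v x)) R) as [|p [|q l]]; [easy|simpl in HF; lia|].
    exfalso. inversion_clear Hnd' as [|? ? Hp _]. apply Hp.
    rewrite (Hin p) by now left. rewrite (Hin q) by (right; now left). now left. }
  destruct (Nat.eq_dec h n) as [->|Hne]; [now exists x|].
  destruct (IH (filter (fun y => v y <? v x) R) Hlen) with (h := h) as (z & Hz & Hc).
  - now apply NoDup_filter.
  - intros a b Ha Hb. apply filter_In in Ha, Hb. now apply Hinj.
  - lia.
  - apply filter_In in Hz. destruct Hz as [Hz Hv]. apply Nat.ltb_lt in Hv.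
    exists z. split; [easy|]. rewrite <- Hc, filter_filter. f_equal.
    apply filter_ext. intro y.
    destruct (Nat.ltb_spec (v y) (v z)), (Nat.ltb_spec (v y) (v x)); easy || lia.
Qed.

Section ThreeChains.
Variable le : list bool -> list bool -> bool.
Variable N : nat.
Hypothesis le_char : forall y z, length y = N -> length z = N ->
  le y z = (tag_class y =? tag_class z) && (value y N <=? value z N).

Definition heap (i : nat) (Q : list (list bool)) : nat :=
  length (filter (fun y => tag_class y =? i) Q).
Definition nim_sum (Q : list (list bool)) : nat :=
  Nat.lxor (Nat.lxor (heap 0 Q) (heap 1 Q)) (heap 2 Q).
Definition after (x : list bool) (Q : list (list bool)) : list (list bool) :=
  filter (fun y => negb (le x y)) Q.
Definition position (Q : list (list bool)) : Prop :=
  NoDup Q /\ forall y, In y Q -> length y = N.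

Lemma value_eq y z : length y = N -> length z = N -> value y N = value z N -> y = z.
Proof.
  intros Hy Hz H. apply nth_ext with (d := false) (d' := false); [lia|].
  intros i Hi. apply (value_inj y z N); [easy|lia].
Qed.

Lemma position_after x Q : position Q -> position (after x Q).
Proof.
  intros [H1 H2]. split; [now apply NoDup_filter|].
  intros y Hy. apply filter_In in Hy. now apply H2.
Qed.

Lemma heap_after_other x Q i : position Q -> In x Q -> i <> tag_class x ->
  heap i (after x Q) = heap i Q.
Proof.
  intros [_ HN] Hx Hi. unfold heap, after. rewrite filter_filter. f_equal.
  apply filter_ext_in. intros y Hy. rewrite le_char by auto.
  destruct (Nat.eqb_spec (tag_class y) i); [|apply andb_false_r].
  destruct (Nat.eqb_spec (tag_class x) (tag_class y)); [congruence|easy].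
Qed.

Lemma heap_after_same x Q : position Q -> In x Q ->
  heap (tag_class x) (after x Q) =
  length (filter (fun y => value y N <? value x N) (filter (fun y => tag_class y =? tag_class x) Q)).
Proof.
  intros [_ HN] Hx. unfold heap, after. rewrite !filter_filter. f_equal.
  apply filter_ext_in. intros y Hy. rewrite le_char by auto.
  rewrite (Nat.eqb_sym (tag_class x)). destruct (tag_class y =? tag_class x); [|apply andb_false_r].
  rewrite andb_true_r. simpl. now rewrite Nat.ltb_antisym.
Qed.

Lemma filter_length_lt {A} (f : A -> bool) l x : In x l -> f x = false -> length (filter f l) < length l.
Proof.
  intros Hx Hf. induction l as [|a l IH]; [easy|]. simpl.
  destruct Hx as [->|Hx].
  - rewrite Hf. apply Nat.lt_succ_r, filter_length_le.
  - specialize (IH Hx). destruct (f a); simpl; lia.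
Qed.

Lemma heap_after_lt x Q : position Q -> In x Q -> heap (tag_class x) (after x Q) < heap (tag_class x) Q.
Proof.
  intros HQ Hx. rewrite heap_after_same by easy. unfold heap.
  apply filter_length_lt with (x := x).
  - apply filter_In. now rewrite Nat.eqb_refl.
  - apply Nat.ltb_irrefl.
Qed.

Lemma after_shorter x Q : position Q -> In x Q -> length (after x Q) < length Q.
Proof.
  intros [_ HN] Hx. apply filter_length_lt with (x := x); [easy|].
  rewrite le_char by auto. now rewrite Nat.eqb_refl, Nat.leb_refl.
Qed.

Lemma exists_move Q i h : position Q -> h < heap i Q ->
  exists x, In x Q /\ tag_class x = i /\ heap i (after x Q) = h.
Proof.
  intros HQ Hh. destruct HQ as [Hnd HN].
  destruct (exists_rank (fun y => value y N) (heap i Q) (filter (fun y => tag_class y =? i) Q) eq_refl)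
    with (h := h) as (x & Hx & Hc); auto.
  - now apply NoDup_filter.
  - intros y z Hy Hz. apply filter_In in Hy, Hz. apply value_eq; apply HN; tauto.
  - apply filter_In in Hx. destruct Hx as [Hx Hi]. apply Nat.eqb_eq in Hi. subst i.
    exists x. split; [easy|]. split; [easy|]. rewrite heap_after_same by easy. exact Hc.
Qed.

Lemma tag_class_cases t : tag_class t = 0 \/ tag_class t = 1 \/ tag_class t = 2.
Proof. unfold tag_class. destruct (nth 0 t false), (nth 1 t false); auto. Qed.

Lemma lxor_cancel_r a b c : Nat.lxor a c = Nat.lxor b c -> a = b.
Proof.
  intro H. apply (f_equal (fun x => Nat.lxor x c)) in H.
  now rewrite !Nat.lxor_assoc, Nat.lxor_nilpotent, !Nat.lxor_0_r in H.
Qed.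

(** A move changes exactly one heap, and exclusive or is cancellative. *)
Lemma nim_sum_after x Q : position Q -> In x Q -> nim_sum (after x Q) <> nim_sum Q.
Proof.
  intros HQ Hx. pose proof (heap_after_lt x Q HQ Hx) as Hlt.
  unfold nim_sum. destruct (tag_class_cases x) as [E|[E|E]]; rewrite E in Hlt;
    rewrite ?(heap_after_other x Q 0), ?(heap_after_other x Q 1), ?(heap_after_other x Q 2) by (easy || lia);
    intro H.
  - apply lxor_cancel_r, lxor_cancel_r in H. lia.
  - apply lxor_cancel_r in H. rewrite !(Nat.lxor_comm (heap 0 Q)) in H. apply lxor_cancel_r in H. lia.
  - rewrite !(Nat.lxor_comm (Nat.lxor _ _)) in H. apply lxor_cancel_r in H. lia.
Qed.

Lemma nim_outcome n : forall Q, length Q <= n -> position Q ->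
  (nim_sum Q <> 0 -> FirstWins le Q) /\ (nim_sum Q = 0 -> FirstLoses le Q).
Proof.
  induction n as [|n IH]; intros Q Hn HQ.
  - destruct Q; [|simpl in Hn; lia]. split; [easy|]. intros _. constructor. easy.
  - assert (Hnext : forall x, In x Q -> (nim_sum (after x Q) <> 0 -> FirstWins le (after x Q)) /\
      (nim_sum (after x Q) = 0 -> FirstLoses le (after x Q))).
    { intros x Hx. apply IH; [|now apply position_after]. pose proof (after_shorter x Q HQ Hx). lia. }
    split.
    + intro H. apply nim_move in H.
      assert (HM : exists x, In x Q /\ nim_sum (after x Q) = 0).
      { destruct H as [(h & Hh & E)|[(h & Hh & E)|(h & Hh & E)]];
          destruct (exists_move Q _ h HQ Hh) as (x & Hx & Hc & Hheap);
          exists x; (split; [easy|]); rewrite <- E; unfold nim_sum; rewrite Hheap;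
          rewrite ?(heap_after_other x Q 0), ?(heap_after_other x Q 1), ?(heap_after_other x Q 2) by (easy || lia);
          reflexivity. }
      destruct HM as (x & Hx & E). apply fw_move with (x := x); [easy|]. now apply Hnext.
    + intro H. constructor. intros x Hx. apply Hnext; [easy|]. rewrite <- H. now apply nim_sum_after.
Qed.

(** Both predicates are inductive, so their exclusion needs the decrease in the number of points; it
    supplies the negative instances. *)
Lemma not_both n : forall Q, length Q <= n -> position Q -> FirstWins le Q -> FirstLoses le Q -> False.
Proof.
  induction n as [|n IH]; intros Q Hn HQ HW HL.
  - destruct Q; [|simpl in Hn; lia]. now inversion HW.
  - inversion_clear HW as [? x Hx HLx]. inversion_clear HL as [? Hall].
    apply (IH (after x Q)); auto; [|now apply position_after|now apply Hall].
    pose proof (after_shorter x Q HQ Hx). lia.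
Qed.

Lemma first_wins_iff Q : position Q -> (FirstWins le Q <-> nim_sum Q <> 0).
Proof.
  intro HQ. destruct (nim_outcome (length Q) Q (Nat.le_refl _) HQ) as [H1 H2].
  split; [|easy]. intros HW H0. apply (not_both (length Q) Q); auto.
Qed.
End ThreeChains.

(** * Counting points and the outcome of the constructed game *)

Lemma in_all_bits n : forall y, In y (all_bits n) <-> length y = n.
Proof.
  induction n as [|n IH]; intro y; simpl.
  - destruct y; simpl; split; intro H; auto; [now destruct H|discriminate].
  - rewrite in_app_iff, !in_map_iff. split.
    + intros [(z & <- & Hz)|(z & <- & Hz)]; apply IH in Hz; simpl; lia.
    + intro H. destruct y as [|[] y]; [discriminate|right|left]; injection H as H;
        exists y; (split; [easy|]); now apply IH.
Qed.

Lemma NoDup_all_bits n : NoDup (all_bits n).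
Proof.
  induction n as [|n IH]; simpl; [repeat constructor; easy|].
  apply NoDup_app.
  - apply NoDup_map_NoDup_ForallPairs; [|easy]. intros ? ? _ _ H. now injection H.
  - apply NoDup_map_NoDup_ForallPairs; [|easy]. intros ? ? _ _ H. now injection H.
  - intros a Ha Hb. apply in_map_iff in Ha, Hb.
    destruct Ha as (u & <- & _), Hb as (w & E & _). discriminate.
Qed.

Definition count (f : list bool -> bool) (n : nat) : nat := length (filter f (all_bits n)).

Lemma count_S f n : count f (S n) = count (fun y => f (false :: y)) n + count (fun y => f (true :: y)) n.
Proof.
  unfold count. simpl. rewrite filter_app, length_app.
  f_equal; induction (all_bits n) as [|a l IH]; simpl; try easy;
    (destruct (f _); simpl; now rewrite IH).
Qed.

Lemma count_ext f g n : (forall y, length y = n -> f y = g y) -> count f n = count g n.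
Proof.
  intro H. unfold count. f_equal. apply filter_ext_in. intros y Hy. apply H. now apply in_all_bits.
Qed.

Lemma count_true n : count (fun _ => true) n = 2 ^ n.
Proof. induction n as [|n IH]; [easy|]. rewrite count_S, IH. simpl. lia. Qed.

Lemma count_false n : count (fun _ => false) n = 0.
Proof. induction n as [|n IH]; [easy|]. now rewrite count_S, IH. Qed.

Lemma count_nonzero n : count (existsb (fun b => b)) n + 1 = 2 ^ n.
Proof.
  induction n as [|n IH]; [easy|]. rewrite count_S. simpl existsb. rewrite count_true.
  change (fun y => existsb (fun b => b) y) with (existsb (fun b : bool => b)). simpl. lia.
Qed.

Theorem majority_instance (I : instance) (m : nat) (acc : list bool -> bool) :
  inst_n I = 4 + m ->
  (forall y z, length y = 4 + m -> length z = 4 + m ->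
     eval_circ (inst_C I) (y ++ z) = (tag_class y =? tag_class z) && (value y (4 + m) <=? value z (4 + m))) ->
  (forall t r, length t = 4 -> length r = m ->
     eval_circ (inst_D I) (t ++ r) = member (acc r) (existsb (fun b => b) r) t) ->
  promise I /\ (exists_game I <-> 2 * count acc m > 2 ^ m).
Proof.
  intros Hn HC HD. set (N := 4 + m) in *.
  assert (Hpos : position N (points I)).
  { unfold points. rewrite Hn. split; [apply NoDup_filter, NoDup_all_bits|].
    intros y Hy. apply filter_In in Hy. now apply in_all_bits. }
  destruct Hpos as [Hnd Hlen].
  assert (Hle : forall y z, In y (points I) -> In z (points I) ->
    le_rel I y z = (tag_class y =? tag_class z) && (value y N <=? value z N)).
  { intros y z Hy Hz. apply HC; auto. }
  split; [split|].
  - split; [|split].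
    + intros x Hx. rewrite Hle by easy. now rewrite Nat.eqb_refl, Nat.leb_refl.
    + intros x y Hx Hy. rewrite !Hle by easy. rewrite !andb_true_iff, !Nat.leb_le.
      intros [_ H1] [_ H2]. apply (value_eq N); auto. lia.
    + intros x y z Hx Hy Hz. rewrite !Hle by easy.
      rewrite !andb_true_iff, !Nat.leb_le, !Nat.eqb_eq. lia.
  (* Two elements below the same [b] share its class and hence lie in one chain, which contradicts
     the incomparability of [a] and [c]. *)
  - intros (a & b & c & d & Ha & Hb & Hc & Hd & [Hab _] & _ & [Hcb _] & [Hac Hca] & _).
    rewrite Hle in Hab, Hcb, Hac, Hca by easy.
    apply andb_true_iff in Hab, Hcb. rewrite !Nat.eqb_eq in *.
    apply andb_false_iff in Hac, Hca. rewrite !Nat.leb_gt, !Nat.eqb_neq in *. lia.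
  - unfold exists_game. rewrite (first_wins_iff (le_rel I) N HC) by easy.
    assert (Hheap : forall i, heap i (points I) =
      count (fun y => eval_circ (inst_D I) y && (tag_class y =? i)) N).
    { intro i. unfold heap, points, count. rewrite filter_filter. now rewrite Hn. }
    assert (Htag : forall t i, length t = 4 ->
      count (fun r => eval_circ (inst_D I) (t ++ r) && (tag_class (t ++ r) =? i)) m =
      count (fun r => member (acc r) (existsb (fun b => b) r) t && (tag_class t =? i)) m).
    { intros t i Ht. apply count_ext. intros r Hr. rewrite HD by easy. f_equal.
      destruct t as [|? [|? t]]; try discriminate. reflexivity. }
    assert (Hcount : forall i, heap i (points I) =
      list_sum (map (fun t => count (fun r => member (acc r) (existsb (fun b => b) r) t && (tag_class t =? i)) m)
        (all_bits 4))).
    (* Splitting off four leading bits turns the count over all strings into a sum over the 16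
       tags. *)
    { intro i. rewrite Hheap. unfold N. change (4 + m) with (S (S (S (S m)))).
      rewrite !count_S. cbn [all_bits map app list_sum fold_right]. rewrite <- !Htag by reflexivity.
      cbn [app]. lia. }
    assert (Hsimp : forall f, count (fun r => f r && false) m = 0).
    { intro f. rewrite <- (count_false m). apply count_ext. intros. apply andb_false_r. }
    assert (Hsimp' : forall f, count (fun r => f r && true) m = count f m).
    { intro f. apply count_ext. intros. apply andb_true_r. }
    pose proof (count_nonzero m) as Hz. pose proof (count_true m) as HT. pose proof (count_false m) as HF.
    set (Z := count (existsb (fun b => b)) m) in *.
    assert (H0 : heap 0 (points I) = 2 * count acc m + Z).
    { rewrite Hcount. cbn [all_bits map app list_sum fold_right].
      unfold member, tag_class. cbn [nth negb andb Nat.eqb].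
      rewrite ?Hsimp, ?Hsimp', ?HF. 
      fold Z. lia. }
    assert (H1 : heap 1 (points I) = 2 ^ (S m)).
    { rewrite Hcount. cbn [all_bits map app list_sum fold_right].
      unfold member, tag_class. cbn [nth negb andb Nat.eqb].
      rewrite ?Hsimp, ?Hsimp', ?HF, ?HT. simpl. lia. }
    assert (H2 : heap 2 (points I) = 2 * count acc m + Z + 2 ^ (S m)).
    { rewrite Hcount. cbn [all_bits map app list_sum fold_right].
      unfold member, tag_class. cbn [nth negb andb Nat.eqb].
      rewrite ?Hsimp, ?Hsimp', ?HF, ?HT. 
      fold Z. simpl. lia. }
    (* This gives B <= 3 * 2^m - 1, below 2 * 2^(m+1) as [three_heaps] demands. *)
    assert (HA : count acc m <= 2 ^ m).
    { rewrite <- HT. unfold count.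
      assert (E : filter (fun _ : list bool => true) (all_bits m) = all_bits m)
        by (induction (all_bits m); simpl; congruence).
      rewrite E. apply filter_length_le. }
    unfold nim_sum. rewrite H0, H1, H2. rewrite three_heaps by (simpl; lia). simpl. lia.
Qed.

(** * Emitting encoded circuits *)

Lemma nat_bits_odd h : nat_bits (2 * h + 1) = true :: nat_bits h.
Proof.
  unfold nat_bits. replace (N.of_nat (2 * h + 1)) with (N.succ_double (N.of_nat h)) by lia.
  now destruct (N.of_nat h).
Qed.

Lemma nat_bits_even h : h <> 0 -> nat_bits (2 * h) = false :: nat_bits h.
Proof.
  intro H. unfold nat_bits. replace (N.of_nat (2 * h)) with (N.double (N.of_nat h)) by lia.
  destruct (N.of_nat h) eqn:E; [lia|easy].
Qed.

Lemma ev_conv c s s' t s1 s1' : ev c s s' t -> s = s1 -> s' = s1' -> ev c s1 s1' t.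
Proof. now intros H <- <-. Qed.

Fixpoint incs (k r : nat) : cmd := match k with 0 => Skip | S k' => Seq (incs k' r) (Inc r) end.

Lemma ev_incs k r s : ev (incs k r) s (setr s r (k + hr s r)) k.
Proof.
  induction k as [|k IH]; simpl.
  - rewrite setr_id. constructor.
  - eapply ev_le with (t := k + 1); [|lia]. eapply ev_seq; [exact IH|].
    eapply ev_conv; [apply ev_inc|reflexivity|].
    now rewrite setr_setr, setr_same.
Qed.

Lemma ev_clear r v : forall s, hr s r = v -> ev (Loop r Skip) s (setr s r 0) (v + 1).
Proof.
  induction v as [|v IH]; intros s Hv.
  - replace (setr s r 0) with s by (rewrite <- Hv; symmetry; apply setr_id). now constructor.
  - eapply ev_le; [eapply ev_loopS; [exact Hv|constructor|]|].
    + eapply ev_conv; [apply (IH (setr s r v)); apply setr_same|reflexivity|apply setr_setr].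
    + lia.
Qed.

(* Registers 0 to 3 are scratch. *)
Definition scratch (s : hstate) (a b c d : nat) : hstate :=
  mkH (fun j => match j with 0 => a | 1 => b | 2 => c | 3 => d | _ => hr s j end) (hx s) (ho s).

Definition clean (s : hstate) : Prop := hr s 0 = 0 /\ hr s 1 = 0 /\ hr s 2 = 0 /\ hr s 3 = 0.

Ltac eqbs := repeat match goal with
  | |- context [Nat.eqb ?a ?b] => destruct (Nat.eqb_spec a b)
  end.
Ltac regs := unfold setr, scratch, out; cbn [hr hx ho]; f_equal;
  apply functional_extensionality; intro; eqbs; subst; try reflexivity; try lia; try congruence.

Lemma setr_comm s r q v w : r <> q -> setr (setr s r v) q w = setr (setr s q w) r v.
Proof. intro H. regs. Qed.

Lemma scratch_clean s : clean s -> scratch s 0 0 0 0 = s.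
Proof.
  intros (H0 & H1 & H2 & H3). destruct s as [f x o]. unfold scratch. simpl in *. f_equal.
  apply functional_extensionality. intros [|[|[|[|]]]]; congruence.
Qed.

Ltac scratch_tac :=
  unfold setr, scratch; simpl; f_equal; apply functional_extensionality; now intros [|[|[|[|]]]].

Lemma scratch_set0 s a b c d v : setr (scratch s a b c d) 0 v = scratch s v b c d.
Proof. scratch_tac. Qed.
Lemma scratch_set1 s a b c d v : setr (scratch s a b c d) 1 v = scratch s a v c d.
Proof. scratch_tac. Qed.
Lemma scratch_set2 s a b c d v : setr (scratch s a b c d) 2 v = scratch s a b v d.
Proof. scratch_tac. Qed.
Lemma scratch_set3 s a b c d v : setr (scratch s a b c d) 3 v = scratch s a b c v.
Proof. scratch_tac. Qed.
Lemma scratch_set s a b c d r v : 4 <= r -> setr (scratch s a b c d) r v = scratch (setr s r v) a b c d.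
Proof.
  intro H. unfold setr, scratch. simpl. f_equal. apply functional_extensionality. intros j.
  destruct (Nat.eqb_spec j r) as [->|]; [|easy]. destruct r as [|[|[|[|]]]]; easy || lia.
Qed.
Lemma scratch_hr s a b c d r : 4 <= r -> hr (scratch s a b c d) r = hr s r.
Proof. destruct r as [|[|[|[|]]]]; easy || lia. Qed.

(** Halving in unary: register 2 toggles with each unit of register 1, and register 3 counts the
    completed pairs. *)
Definition parity_loop : cmd := Loop 1 (IfZ 2 (Inc 2) (Seq (Loop 2 Skip) (Inc 3))).

Lemma ev_parity u : forall s f h, f <= 1 -> exists f' h', f' <= 1 /\ f' + 2 * h' = f + u + 2 * h /\
  ev parity_loop (scratch s 0 u f h) (scratch s 0 0 f' h') (6 * u + 1).
Proof.
  induction u as [|u IH]; intros s f h Hf.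
  - exists f, h. split; [easy|]. split; [lia|]. now constructor.
  - destruct f as [|[|]]; [| |lia].
    + destruct (IH s 1 h (le_n 1)) as (f' & h' & H1 & H2 & H3).
      exists f', h'. split; [easy|]. split; [lia|].
      eapply ev_le; [eapply ev_loopS; [reflexivity| |exact H3]|].
      * rewrite scratch_set1. apply ev_ifz; [reflexivity|].
        eapply ev_conv; [apply ev_inc|reflexivity|]. apply scratch_set2.
      * lia.
    + destruct (IH s 0 (S h) (Nat.le_0_l 1)) as (f' & h' & H1 & H2 & H3).
      exists f', h'. split; [easy|]. split; [lia|].
      eapply ev_le; [eapply ev_loopS; [reflexivity| |exact H3]|].
      * rewrite scratch_set1. apply ev_ifs; [easy|]. eapply ev_seq; [apply (ev_clear 2 1); reflexivity|].
        rewrite scratch_set2. eapply ev_conv; [apply ev_inc|reflexivity|]. apply scratch_set3.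
      * lia.
Qed.

(** [Loop] has already taken one unit from v when the halving starts, so the roles of the parities
    are exchanged: if v - 1 is even, the bit is 1 and the pairs counted are half of v - 1; if it is
    odd, the bit is 0 and one more unit completes v / 2. *)
Definition digits : cmd :=
  Loop 1 (Seq (Emit true) (Seq parity_loop
    (Seq (IfZ 2 (Emit true) (Seq (Emit false) (Seq (Loop 2 Skip) (Inc 3)))) (Loop 3 (Inc 1))))).

Lemma ev_move31 h : forall s b, ev (Loop 3 (Inc 1)) (scratch s 0 b 0 h) (scratch s 0 (b + h) 0 0) (2 * h + 1).
Proof.
  induction h as [|h IH]; intros s b.
  - rewrite Nat.add_0_r. now constructor.
  - eapply ev_le; [eapply ev_loopS; [reflexivity| |]|].
    + rewrite scratch_set3. eapply ev_conv; [apply ev_inc|reflexivity|]. apply scratch_set1.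
    + cbn [hr scratch]. replace (b + S h) with (S b + h) by lia. apply IH.
    + lia.
Qed.

Lemma out_nil s : out s [] = s.
Proof. destruct s. unfold out. simpl. now rewrite app_nil_r. Qed.

Lemma out_out s l l' : out (out s l) l' = out s (l ++ l').
Proof. unfold out. simpl. now rewrite app_assoc. Qed.

Lemma out_scratch s a b c d l : out (scratch s a b c d) l = scratch (out s l) a b c d.
Proof. reflexivity. Qed.

(** The bound [n] makes the induction strong, as each round continues with about half of the value.
    Halving sums the linear costs of the rounds to a linear total. *)
Lemma ev_digits n : forall v s, v <= n ->
  ev digits (scratch s 0 v 0 0)
    (scratch (out s (flat_map (fun b => [true; b]) (nat_bits v))) 0 0 0 0) (30 * v + 2).
Proof.
  induction n as [|n IH]; intros v s Hv.
  - assert (v = 0) by lia. subst v. simpl flat_map. rewrite out_nil.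
    eapply ev_le; [apply ev_loop0; reflexivity|lia].
  - destruct v as [|u]; [apply IH; lia|].
    set (s1 := out s [true]).
    destruct (ev_parity u s1 0 0 (Nat.le_0_l 1)) as (f' & h' & H1 & H2 & H3).
    pose (bit := f' =? 0). pose (half := if bit then h' else S h').
    assert (Hbits : nat_bits (S u) = bit :: nat_bits half).
    { unfold half, bit. destruct f' as [|[|]]; [| |lia]; simpl Nat.eqb; cbv iota.
      - rewrite <- nat_bits_odd. f_equal. lia.
      - rewrite <- nat_bits_even by lia. f_equal. lia. }
    assert (Hhalf : half <= n /\ 2 * half <= S u).
    { unfold half, bit. destruct f' as [|[|]]; simpl; lia. }
    eapply ev_le; [eapply ev_loopS; [reflexivity| |]|].
    + rewrite scratch_set1. eapply ev_seq; [apply ev_emit|]. rewrite out_scratch. fold s1.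
      eapply ev_seq; [exact H3|]. eapply ev_seq.
      * instantiate (2 := scratch (out s1 [bit]) 0 0 0 half). instantiate (1 := 6).
        unfold half, bit. destruct f' as [|[|]]; [| |lia]; simpl Nat.eqb; cbv iota.
        -- eapply ev_le; [apply ev_ifz; [reflexivity|apply ev_emit]|lia].
        -- eapply ev_le; [apply ev_ifs; [easy|]; eapply ev_seq; [apply ev_emit|]|].
           ++ rewrite out_scratch. eapply ev_seq; [apply (ev_clear 2 1); reflexivity|].
              rewrite scratch_set2. eapply ev_conv; [apply ev_inc|reflexivity|]. apply scratch_set3.
           ++ lia.
      * apply ev_move31.
    + cbn [Nat.add]. eapply ev_conv; [apply (IH half (out s1 [bit])); apply Hhalf|reflexivity|].
      unfold s1. rewrite !out_out, Hbits. reflexivity.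
    + lia.
Qed.

(** Loops destroy their register, so the value is copied into registers 0 and 1: the first copy
    restores [r], the second is printed. *)
Definition emit_nat (r k : nat) : cmd :=
  Seq (Loop r (Seq (Inc 0) (Inc 1))) (Seq (Loop 0 (Inc r)) (Seq (incs k 1) (Seq digits (Emit false)))).

Lemma ev_split v : forall r s a b, 4 <= r -> hr s r = v ->
  ev (Loop r (Seq (Inc 0) (Inc 1))) (scratch s a b 0 0) (scratch (setr s r 0) (v + a) (v + b) 0 0) (3 * v + 1).
Proof.
  induction v as [|v IH]; intros r s a b Hr Hv.
  - replace (setr s r 0) with s by (rewrite <- Hv; symmetry; apply setr_id).
    constructor. now rewrite scratch_hr.
  - eapply ev_le; [eapply ev_loopS; [rewrite scratch_hr; eassumption| |]|].
    + rewrite scratch_set by easy. eapply ev_seq; apply ev_inc.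
    + cbn [hr scratch]. rewrite scratch_set0, scratch_set1.
      eapply ev_conv; [apply (IH r (setr s r v) (S a) (S b) Hr); apply setr_same|reflexivity|].
      rewrite setr_setr. f_equal; lia.
    + lia.
Qed.

Lemma ev_restore a : forall r s b, 4 <= r ->
  ev (Loop 0 (Inc r)) (scratch s a b 0 0) (scratch (setr s r (a + hr s r)) 0 b 0 0) (2 * a + 1).
Proof.
  induction a as [|a IH]; intros r s b Hr.
  - simpl. rewrite setr_id. now constructor.
  - eapply ev_le; [eapply ev_loopS; [reflexivity| |]|].
    + rewrite scratch_set0. apply ev_inc.
    + rewrite scratch_set, scratch_hr by easy.
      eapply ev_conv; [apply IH; easy|reflexivity|]. rewrite setr_setr, setr_same. do 2 f_equal. lia.
    + lia.
Qed.

Lemma ev_emit_nat r k s : 4 <= r -> clean s ->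
  ev (emit_nat r k) s (out s (enc_nat (hr s r + k))) (40 * (k + 1) * (hr s r + 1)).
Proof.
  intros Hr Hs. set (v := hr s r).
  eapply ev_le.
  - eapply ev_conv with (s := scratch s 0 0 0 0); [|now apply scratch_clean|].
    + eapply ev_seq; [apply (ev_split v); auto|].
      eapply ev_seq; [apply ev_restore; easy|].
      eapply ev_seq; [apply ev_incs|]. rewrite scratch_set1. cbn [hr scratch].
      eapply ev_seq; [apply (ev_digits (k + (v + 0))); lia|]. apply ev_emit.
    + rewrite out_scratch, out_out, setr_setr, setr_same, Nat.add_0_r.
      unfold v at 1. rewrite Nat.add_0_r, setr_id.
      rewrite scratch_clean by (destruct Hs as (? & ? & ? & ?); repeat split; assumption).
      unfold enc_nat, v. now rewrite !Nat.add_0_r, (Nat.add_comm k).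
  - nia.
Qed.

(** Register 17 is one that no command changes; it stays 0 and serves as the absolute base. *)
Definition reg (q : src) : nat :=
  match q with SU => 8 | SE => 9 | SV => 10 | SZ => 11 | S0 => 17 end.

Definition emit_op (o : operand) : cmd := emit_nat (reg (fst o)) (snd o).

Fixpoint emit_bits (l : list bool) : cmd :=
  match l with [] => Skip | b :: l' => Seq (Emit b) (emit_bits l') end.

Lemma ev_emit_bits l : forall s, ev (emit_bits l) s (out s l) (length l).
Proof.
  induction l as [|b l IH]; intro s; simpl.
  - rewrite out_nil. constructor.
  - change (S (length l)) with (1 + length l). eapply ev_seq; [apply ev_emit|].
    eapply ev_conv; [apply IH|reflexivity|]. now rewrite out_out.
Qed.

Definition emit_gate (g : tgate) : cmd :=
  match g with
  | TVar o => Seq (emit_bits [false; false; false]) (emit_op o)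
  | TConst b => emit_bits [false; false; true; b]
  | TNot o => Seq (emit_bits [false; true; false]) (emit_op o)
  | TOp op o1 o2 => Seq (emit_bits [negb op; op; op]) (Seq (emit_op o1) (emit_op o2))
  end.

Fixpoint emit_tmpl (l : list tgate) : cmd :=
  match l with [] => Skip | g :: l' => Seq (emit_gate g) (emit_tmpl l') end.

Definition gcost (g : tgate) : nat :=
  4 + match g with
      | TVar o | TNot o => 40 * (snd o + 1)
      | TConst _ => 0
      | TOp _ o1 o2 => 40 * (snd o1 + 1) + 40 * (snd o2 + 1)
      end.
Definition tcost (l : list tgate) : nat := list_sum (map gcost l).

Definition env_of (s : hstate) : src -> nat := fun q => hr s (reg q).

Lemma ev_emit_op o s B : clean s -> (forall q, hr s (reg q) <= B) ->
  ev (emit_op o) s (out s (enc_nat (oval (env_of s) o))) (40 * (snd o + 1) * (B + 1)).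
Proof.
  intros Hs HB. eapply ev_le; [apply ev_emit_nat; [|easy]|].
  - destruct (fst o); simpl; lia.
  - apply Nat.mul_le_mono_l. specialize (HB (fst o)). lia.
Qed.

Lemma ev_emit_gate g s B : clean s -> (forall q, hr s (reg q) <= B) ->
  ev (emit_gate g) s (out s (enc_gate (inst (env_of s) g))) (gcost g * (B + 1)).
Proof.
  intros Hs HB.
  assert (H1 : forall pre o, length pre = 3 -> ev (Seq (emit_bits pre) (emit_op o)) s
     (out s (pre ++ enc_nat (oval (env_of s) o))) ((4 + 40 * (snd o + 1)) * (B + 1))).
  { intros pre o Hp. eapply ev_le; [eapply ev_seq; [apply ev_emit_bits|]|].
    - eapply ev_conv; [apply (ev_emit_op o (out s pre) B); easy|reflexivity|]. now rewrite out_out.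
    - rewrite Hp. lia. }
  assert (H2 : forall pre o o', length pre = 3 -> ev (Seq (emit_bits pre) (Seq (emit_op o) (emit_op o'))) s
     (out s (pre ++ enc_nat (oval (env_of s) o) ++ enc_nat (oval (env_of s) o')))
     ((4 + (40 * (snd o + 1) + 40 * (snd o' + 1))) * (B + 1))).
  { intros pre o o' Hp. eapply ev_le; [eapply ev_seq; [apply ev_emit_bits|eapply ev_seq]|].
    - apply (ev_emit_op o (out s pre) B); easy.
    - eapply ev_conv; [apply (ev_emit_op o' (out (out s pre) (enc_nat (oval (env_of s) o))) B); easy|reflexivity|].
      now rewrite !out_out.
    - rewrite Hp. lia. }
  destruct g as [o|b|o|op o1 o2]; cbn [emit_gate inst enc_gate].
  - now apply H1.
  - eapply ev_le; [apply ev_emit_bits|]. simpl. lia.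
  - now apply H1.
  - destruct op; now apply H2.
Qed.

Lemma ev_emit_tmpl l B : forall s, clean s -> (forall q, hr s (reg q) <= B) ->
  ev (emit_tmpl l) s (out s (flat_map enc_gate (map (inst (env_of s)) l))) (tcost l * (B + 1)).
Proof.
  induction l as [|g l IH]; intros s Hs HB; simpl.
  - rewrite out_nil. constructor.
  - eapply ev_le with (t := gcost g * (B + 1) + tcost l * (B + 1)); [|unfold tcost; simpl; lia].
    eapply ev_seq; [now apply ev_emit_gate|].
    eapply ev_conv; [apply (IH (out s (enc_gate (inst (env_of s) g))) Hs HB)|reflexivity|].
    now rewrite out_out.
Qed.

(* Unlike [Loop], this preserves the value of [r]; [c] is the loop counter. *)
Definition For (r c : nat) (body : cmd) : cmd :=
  Seq (Loop r (Seq (Inc 0) (Inc c))) (Seq (Loop 0 (Inc r)) (Loop c body)).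

Definition for_time (n t : nat) : nat := n * (t + 6) + 3.

(** The states [s i] describe the rounds apart from the counter; the body must work for every
    counter value [v], which permits it to be analysed without knowing the remaining rounds. *)
Lemma ev_for r c body (s : nat -> hstate) n t : r <> 0 -> c <> 0 -> r <> c ->
  hr (s 0) r = n -> hr (s 0) 0 = 0 -> hr (s 0) c = 0 -> hr (s n) c = 0 ->
  (forall i v, i < n -> ev body (setr (s i) c v) (setr (s (S i)) c v) t) ->
  ev (For r c body) (s 0) (s n) (for_time n t).
Proof.
  intros Hr0 Hc0 Hrc Hn H0 Hc Hcn Hbody.
  assert (A1 : forall v a, ev (Loop r (Seq (Inc 0) (Inc c)))
    (setr (setr (setr (s 0) r v) 0 a) c a)
    (setr (setr (setr (s 0) r 0) 0 (v + a)) c (v + a)) (3 * v + 1)).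
  { induction v as [|v IH]; intro a.
    - simpl. constructor. now rewrite !setr_other, setr_same by congruence.
    - eapply ev_le; [eapply ev_loopS; [now rewrite !setr_other, setr_same by congruence| |]|].
      + eapply ev_seq; apply ev_inc.
      + eapply ev_conv; [apply (IH (S a))| |].
        * regs; simpl; eqbs; congruence.
        * now replace (v + S a) with (S v + a) by lia.
      + lia. }
  assert (A2 : forall a w b, ev (Loop 0 (Inc r))
    (setr (setr (setr (s 0) r w) 0 a) c b)
    (setr (setr (setr (s 0) r (a + w)) 0 0) c b) (2 * a + 1)).
  { induction a as [|a IH]; intros w b.
    - simpl. constructor. now rewrite !setr_other, setr_same by congruence.
    - eapply ev_le; [eapply ev_loopS; [now rewrite !setr_other, setr_same by congruence| |]|].
      + apply ev_inc.
      + eapply ev_conv; [apply (IH (S w) b)| |].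
        * regs; simpl; eqbs; congruence.
        * now replace (a + S w) with (S a + w) by lia.
      + lia. }
  assert (A3 : forall k i, i + k = n -> ev (Loop c body) (setr (s i) c k) (s n) (k * (t + 1) + 1)).
  { induction k as [|k IH]; intros i Hi.
    - assert (i = n) by lia. subst i.
      replace (setr (s n) c 0) with (s n) by (rewrite <- Hcn; symmetry; apply setr_id).
      now constructor.
    - eapply ev_le; [eapply ev_loopS; [apply setr_same| |apply (IH (S i)); lia]|].
      + rewrite setr_setr. apply Hbody. lia.
      + lia. }
  assert (Er : setr (s 0) r n = s 0) by (rewrite <- Hn; apply setr_id).
  assert (E0 : setr (s 0) 0 0 = s 0) by (transitivity (setr (s 0) 0 (hr (s 0) 0)); [now rewrite H0|apply setr_id]).
  assert (Ec : setr (s 0) c 0 = s 0) by (transitivity (setr (s 0) c (hr (s 0) c)); [now rewrite Hc|apply setr_id]).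
  eapply ev_le.
  - eapply ev_conv with (s := setr (setr (setr (s 0) r n) 0 0) c 0); [| |reflexivity].
    + eapply ev_seq; [apply A1|]. eapply ev_seq; [apply A2|].
      eapply ev_conv; [apply (A3 n 0); lia| |reflexivity].
      rewrite !Nat.add_0_r, Er, E0. reflexivity.
    + rewrite Er, E0. exact Ec.
  - unfold for_time. nia.
Qed.

(** * The generator *)

Lemma setr_eq s r v : hr s r = v -> setr s r v = s.
Proof. intros <-. apply setr_id. Qed.

(** Register 4 holds n and register 15 the power; multiplication by n accumulates in register 16,
    which is then poured back. *)
Fixpoint power_cmd (k : nat) : cmd :=
  match k with
  | 0 => Inc 15
  | S k' => Seq (power_cmd k') (Seq (Loop 15 (For 4 13 (Inc 16))) (Loop 16 (Inc 15)))
  end.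

Fixpoint power_time (k n : nat) : nat :=
  match k with
  | 0 => 1
  | S k' => power_time k' n + (n ^ k' * (for_time n 1 + 1) + 1 + (2 * (n ^ k' * n) + 1))
  end.

Lemma ev_mult n s : hr s 4 = n -> hr s 0 = 0 -> hr s 13 = 0 -> forall p q,
  ev (Loop 15 (For 4 13 (Inc 16))) (setr (setr s 15 p) 16 q) (setr (setr s 15 0) 16 (q + p * n))
    (p * (for_time n 1 + 1) + 1).
Proof.
  intros Hn H0 H13. induction p as [|p IH]; intro q.
  - simpl. rewrite Nat.add_0_r. now constructor.
  - eapply ev_le; [eapply ev_loopS; [reflexivity| |]|].
    + eapply ev_conv; [apply (ev_for 4 13 (Inc 16) (fun i => setr (setr s 15 p) 16 (q + i)) n 1)| |];
        try easy; [|regs].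
      intros i v _. eapply ev_conv; [apply ev_inc|reflexivity|]. simpl. regs.
    + cbv beta. eapply ev_conv; [apply (IH (q + n))|reflexivity|]. f_equal. lia.
    + lia.
Qed.

Lemma ev_drain s : forall q p,
  ev (Loop 16 (Inc 15)) (setr (setr s 15 p) 16 q) (setr (setr s 15 (p + q)) 16 0) (2 * q + 1).
Proof.
  induction q as [|q IH]; intro p.
  - rewrite Nat.add_0_r. now constructor.
  - eapply ev_le; [eapply ev_loopS; [reflexivity|apply ev_inc|]|].
    + eapply ev_conv; [apply (IH (S p))| |].
      * simpl. regs.
      * do 2 f_equal. lia.
    + lia.
Qed.

Lemma ev_power k : forall n s, hr s 4 = n -> hr s 0 = 0 -> hr s 13 = 0 -> hr s 15 = 0 -> hr s 16 = 0 ->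
  ev (power_cmd k) s (setr s 15 (n ^ k)) (power_time k n).
Proof.
  intros n s Hn H0 H13 H15 H16.
  assert (E16 : forall p, setr (setr s 15 p) 16 0 = setr s 15 p).
  { intro p. transitivity (setr (setr s 15 p) 16 (hr (setr s 15 p) 16)); [|apply setr_id].
    simpl. now rewrite H16. }
  induction k as [|k IH]; cbn [power_cmd power_time].
  - eapply ev_conv; [apply ev_inc|reflexivity|]. now rewrite H15.
  - eapply ev_seq; [exact IH|]. eapply ev_seq.
    + eapply ev_conv; [apply (ev_mult n s Hn H0 H13 (n ^ k) 0)|apply E16|reflexivity].
    + eapply ev_conv; [apply (ev_drain s (0 + n ^ k * n) 0)|reflexivity|].
      rewrite E16. f_equal. rewrite Nat.pow_succ_r'. lia.
Qed.

Lemma ev_scale a r : r <> 15 -> forall p s, hr s 15 = p ->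
  ev (Loop 15 (incs a r)) s (setr (setr s 15 0) r (p * a + hr s r)) (p * (a + 1) + 1).
Proof.
  intro Hr. induction p as [|p IH]; intros s Hp.
  - rewrite (setr_eq s 15 0 Hp). simpl. rewrite setr_id. now constructor.
  - eapply ev_le; [eapply ev_loopS; [exact Hp|apply ev_incs|]|].
    + eapply ev_conv; [apply (IH (setr (setr s 15 p) r (a + hr (setr s 15 p) r)))|reflexivity|].
      { now rewrite setr_other, setr_same by auto. }
      rewrite setr_same, setr_other by easy.
      rewrite (setr_comm _ r 15), !setr_setr by easy. f_equal. lia.
    + lia.
Qed.

Definition poly_cmd (a k r : nat) : cmd :=
  Seq (power_cmd k) (Seq (Loop 15 (incs a r)) (incs a r)).
Definition poly_time (a k n : nat) : nat := power_time k n + (n ^ k * (a + 1) + 1 + a).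

Lemma ev_poly a k r n s : hr s 4 = n -> hr s 0 = 0 -> hr s 13 = 0 -> hr s 15 = 0 -> hr s 16 = 0 ->
  r <> 15 -> ev (poly_cmd a k r) s (setr s r (poly a k n + hr s r)) (poly_time a k n).
Proof.
  intros Hn H0 H13 H15 H16 Hr. unfold poly_cmd, poly_time.
  eapply ev_seq; [now apply ev_power|].
  eapply ev_seq; [apply ev_scale; [easy|apply setr_same]|].
  eapply ev_conv; [apply ev_incs|reflexivity|].
  rewrite setr_same, !setr_setr, setr_other by easy.
  rewrite (setr_eq s 15 0 H15).
  f_equal. unfold poly. lia.
Qed.

Fixpoint lset (r v : nat) (l : list nat) : list nat :=
  match r, l with
  | 0, [] => [v]
  | 0, _ :: l' => v :: l'
  | S r', [] => 0 :: lset r' v []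
  | S r', a :: l' => a :: lset r' v l'
  end.

(** With registers given by an explicit list, equality of two states reduces to entrywise
    arithmetic. *)
Definition st (l : list nat) (x o : list bool) : hstate := mkH (fun r => nth r l 0) x o.

Lemma nth_lset r v : forall l j, nth j (lset r v l) 0 = if j =? r then v else nth j l 0.
Proof.
  induction r as [|r IH]; intros [|a l] [|j]; simpl; try easy.
  - now destruct j.
  - rewrite IH. now destruct j.
Qed.

Lemma setr_st l x o r v : setr (st l x o) r v = st (lset r v l) x o.
Proof.
  unfold setr, st. simpl. f_equal. apply functional_extensionality. intro j. now rewrite nth_lset.
Qed.

Notation enc_gates := (flat_map enc_gate).

Lemma enc_chain_succ G u (f : nat -> entry) k (o : list bool) :
  (o ++ enc_gates (chain G u (map f (seq 0 k)))) ++ enc_gates (inst_entry (u + G * k) (f k)) =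
  o ++ enc_gates (chain G u (map f (seq 0 (S k)))).
Proof.
  rewrite seq_S, map_app. cbn [map]. rewrite chain_snoc, length_map, length_seq, flat_map_app.
  now rewrite app_assoc.
Qed.

(** [base] and [X] give registers and unread input by rounds. The hypothesis on the body is stated
    for any previous output, so only the newly printed block has to be identified. *)
Lemma ev_chain_loop G r c body f (base : nat -> list nat) (X : nat -> list bool) u o n t :
  r <> 0 -> c <> 0 -> r <> c -> nth r (base 0) 0 = n -> nth 0 (base 0) 0 = 0 ->
  nth c (base 0) 0 = 0 -> nth c (base n) 0 = 0 ->
  (forall i v o', i < n -> ev body (st (lset c v (base i)) (X i) o')
     (st (lset c v (base (S i))) (X (S i)) (o' ++ enc_gates (inst_entry (u + G * i) (f i)))) t) ->
  ev (For r c body) (st (base 0) (X 0) o)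
    (st (base n) (X n) (o ++ enc_gates (chain G u (map f (seq 0 n))))) (for_time n t).
Proof.
  intros Hr Hc Hrc Hn H0 Hc0 Hcn Hbody.
  eapply ev_conv; [apply (ev_for r c body
    (fun i => st (base i) (X i) (o ++ enc_gates (chain G u (map f (seq 0 i))))) n t)| |]; try easy.
  - intros i v Hi. rewrite !setr_st. eapply ev_conv; [apply (Hbody i v (o ++ enc_gates (chain G u (map f (seq 0 i)))) Hi)|reflexivity|].
    now rewrite enc_chain_succ.
  - simpl. now rewrite app_nil_r.
Qed.

(** Registers 0 to 3 are scratch, 8 to 11 are the movable bases, 12 accumulates a gate count, 13 and
    14 are loop counters, 15 and 16 serve the computation of powers. *)
Definition regs_list (n m K W U E V Z L v w : nat) : list nat :=
  [0; 0; 0; 0; n; m; K; W; U; E; V; Z; L; v; w; 0; 0].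

Lemma ev_entry t n m K W U E V Z L v w x o B : U <= B -> E <= B -> V <= B -> Z <= B ->
  ev (emit_tmpl t) (st (regs_list n m K W U E V Z L v w) x o)
    (st (regs_list n m K W U E V Z L v w) x (o ++ enc_gates (inst_entry U (t, (E, V, Z)))))
    (tcost t * (B + 1)).
Proof.
  intros. eapply ev_conv; [apply (ev_emit_tmpl t B)|reflexivity|].
  - repeat split.
  - intros []; simpl; lia.
  - unfold inst_entry. replace (mkenv U E V Z) with (env_of (st (regs_list n m K W U E V Z L v w) x o)).
    + reflexivity.
    + apply functional_extensionality. now intros [].
Qed.

Lemma ev_incs_st k r l x o : ev (incs k r) (st l x o) (st (lset r (k + nth r l 0) l) x o) k.
Proof. eapply ev_conv; [apply ev_incs|reflexivity|]. apply setr_st. Qed.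

Lemma ev_clear_st r l x o : ev (Loop r Skip) (st l x o) (st (lset r 0 l) x o) (nth r l 0 + 1).
Proof. eapply ev_conv; [apply (ev_clear r (nth r l 0) (st l x o) eq_refl)|reflexivity|]. apply setr_st. Qed.

Lemma ev_emit_nat_st r k l x o : 4 <= r -> nth 0 l 0 = 0 -> nth 1 l 0 = 0 -> nth 2 l 0 = 0 -> nth 3 l 0 = 0 ->
  ev (emit_nat r k) (st l x o) (st l x (o ++ enc_nat (nth r l 0 + k))) (40 * (k + 1) * (nth r l 0 + 1)).
Proof. intros. now apply (ev_emit_nat r k (st l x o)). Qed.

Lemma ev_for_incs r c a q l x o n : r <> 0 -> c <> 0 -> r <> c -> q <> r -> q <> c -> q <> 0 ->
  nth r l 0 = n -> nth 0 l 0 = 0 -> nth c l 0 = 0 ->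
  ev (For r c (incs a q)) (st l x o) (st (lset q (n * a + nth q l 0) l) x o) (for_time n a).
Proof.
  intros Hr Hc Hrc Hqr Hqc Hq0 Hn H0 Hc0. rewrite <- !setr_st.
  eapply ev_conv; [apply (ev_for r c (incs a q) (fun i => setr (st l x o) q (i * a + nth q l 0)) n a)| |]; try easy.
  - now rewrite setr_other by congruence.
  - now rewrite setr_other by congruence.
  - now rewrite setr_other by congruence.
  - now rewrite setr_other by congruence.
  - intros i v _. eapply ev_conv; [apply ev_incs|reflexivity|].
    rewrite (setr_other _ c v q) by easy. rewrite setr_same.
    rewrite (setr_comm _ c q), setr_setr by congruence.
    rewrite (setr_comm _ q c), setr_comm by congruence. f_equal. f_equal. lia.
  - apply (setr_id (st l x o) q).
Qed.

Lemma cons_eq {A} (a b : A) l l' : a = b -> l = l' -> a :: l = b :: l'.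
Proof. congruence. Qed.

Lemma st_eq l l' x x' o o' : l = l' -> x = x' -> o = o' -> st l x o = st l' x' o'.
Proof. congruence. Qed.

Lemma ev_post c s s1 s' t : ev c s s1 t -> s1 = s' -> ev c s s' t.
Proof. now intros H <-. Qed.

Ltac ev_seqs := repeat match goal with |- ev (Seq _ _) _ _ _ => eapply ev_seq end.

Ltac regs_eq := unfold regs_list; cbn [lset nth hr st];
  repeat (apply cons_eq; [first [reflexivity | lia]|]); reflexivity.
Ltac st_solve := apply st_eq; [regs_eq | try reflexivity | try reflexivity].

Tactic Notation "reach_st" constr(s) "by" tactic3(t) :=
  eapply ev_post; [t|instantiate (1 := s); st_solve].

Section Generator.
Variable M : TM.
Variables a b c k : nat.

Notation G := (GD M).
Definition size_ord : nat := core_size ord_leaves (fun v => [F_ord v]) 1.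
Definition size_final : nat := core_size (final_leaves M) (fun v => [F_final M v]) 1.

#[local] Opaque GD GC core_size tcost t_fix t_rand t_step t_dummy t_final t_true t_le t_ord.

Definition num_coins (n : nat) : nat := poly a b n.
(** The least K with T + 1 < K, where T is the running time. *)
Definition margin (n : nat) : nat := poly c k n + 2.
Definition row_cells (n : nat) : nat := row_width n (num_coins n) (margin n).

Definition setup_cmd : cmd :=
  Seq (poly_cmd a b 5) (Seq (poly_cmd c k 6) (Seq (incs 2 6)
    (Seq (For 6 13 (incs 2 7)) (Seq (For 4 13 (incs 1 7)) (Seq (For 5 13 (incs 1 7)) (incs 2 7)))))).

Definition setup_time (n : nat) : nat :=
  poly_time a b n + poly_time c k n + for_time (margin n) 2 + for_time n 1 +
  for_time (num_coins n) 1 + 4.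

Lemma ev_setup n x o :
  ev setup_cmd (st (regs_list n 0 0 0 0 0 0 0 0 0 0) x o)
    (st (regs_list n (num_coins n) (margin n) (row_cells n) 0 0 0 0 0 0 0) x o) (setup_time n).
Proof.
  unfold setup_time, row_cells, row_width.
  remember (num_coins n) as m eqn:Em. remember (margin n) as K eqn:EK.
  unfold num_coins in Em. unfold margin in EK.
  eapply ev_le; [unfold setup_cmd; ev_seqs|].
  - eapply ev_post; [apply (ev_poly a b 5 n); easy|].
    instantiate (1 := st (regs_list n m 0 0 0 0 0 0 0 0 0) x o). rewrite setr_st. st_solve.
  - eapply ev_post; [apply (ev_poly c k 6 n); easy|].
    instantiate (1 := st (regs_list n m (poly c k n) 0 0 0 0 0 0 0 0) x o). rewrite setr_st. st_solve.
  - reach_st (st (regs_list n m K 0 0 0 0 0 0 0 0) x o) by (apply ev_incs_st).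
  - reach_st (st (regs_list n m K (2 * K) 0 0 0 0 0 0 0) x o) by (apply (ev_for_incs 6 13 2 7 _ x o K); easy).
  - reach_st (st (regs_list n m K (2 * K + n) 0 0 0 0 0 0 0) x o) by (apply (ev_for_incs 4 13 1 7 _ x o n); easy).
  - reach_st (st (regs_list n m K (2 * K + n + m) 0 0 0 0 0 0 0) x o) by (apply (ev_for_incs 5 13 1 7 _ x o m); easy).
  - eapply ev_post; [apply ev_incs_st|].
    st_solve.
  - lia.
Qed.

(** The constant in [emit_nat] comes from the gate count [GC * (N + 1) + size_ord] with N = m + 4.
    The trailing loops reset the bases for the second circuit. *)
Definition order_cmd : cmd :=
  Seq (For 5 13 (incs GC 12)) (Seq (emit_nat 12 (GC * 5 + size_ord)) (Seq (Loop 12 Skip)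
  (Seq (For 5 13 (incs 1 11)) (Seq (incs 4 11) (Seq (emit_tmpl t_true)
  (Seq (For 11 13 (Seq (emit_tmpl t_le) (Seq (incs GC 8) (Seq (incs 1 10) (incs 1 11)))))
  (Seq (emit_tmpl t_ord) (Seq (Loop 8 Skip) (Seq (Loop 10 Skip) (Loop 11 Skip)))))))))).

Definition order_time (m B : nat) : nat :=
  for_time m GC + 40 * (GC * 5 + size_ord + 1) * (m * GC + 1) + (m * GC + 1) + for_time m 1 + 4 +
  tcost t_true * (B + 1) + for_time (4 + m) (tcost t_le * (B + 1) + GC + 2) +
  tcost t_ord * (B + 1) + (GC * (4 + m) + 1) + (4 + m + 1) + (2 * (4 + m) + 1).

Lemma ev_order n m K W x o B : GC * (4 + m) <= B -> 2 * (4 + m) <= B ->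
  ev order_cmd (st (regs_list n m K W 0 0 0 0 0 0 0) x o)
    (st (regs_list n m K W 0 0 0 0 0 0 0) x (o ++ enc_circ (circuit_C (4 + m)))) (order_time m B).
Proof.
  intros HB1 HB2. set (N := 4 + m).
  set (o1 := o ++ enc_nat (length (circuit_C N))).
  set (o2 := o1 ++ enc_gates (inst_entry 0 (t_true, (0, 0, N)))).
  set (o3 := o2 ++ enc_gates (chain GC 0 (le_entries N N))).
  set (o4 := o3 ++ enc_gates (inst_entry (GC * N) (t_ord, (0, N, N + N)))).
  eapply ev_le; [unfold order_cmd; ev_seqs|].
  - reach_st (st (regs_list n m K W 0 0 0 0 (m * GC) 0 0) x o) by (apply (ev_for_incs 5 13 GC 12 _ x o m); easy).
  - reach_st (st (regs_list n m K W 0 0 0 0 (m * GC) 0 0) x o1) by (apply ev_emit_nat_st; easy || lia).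
    unfold o1. do 2 f_equal. rewrite circuit_C_length. fold size_ord. unfold N. cbn [nth regs_list]. lia.
  - reach_st (st (regs_list n m K W 0 0 0 0 0 0 0) x o1) by (apply ev_clear_st).
  - reach_st (st (regs_list n m K W 0 0 0 m 0 0 0) x o1) by (apply (ev_for_incs 5 13 1 11 _ x o1 m); easy).
  - reach_st (st (regs_list n m K W 0 0 0 N 0 0 0) x o1) by (apply ev_incs_st).
  - apply (ev_entry t_true) with (B := B); lia.
  - fold o2. eapply ev_conv; [apply (ev_chain_loop GC 11 13 _ (fun i => (t_le, (0, i, N + i)))
      (fun i => regs_list n m K W (GC * i) 0 i (N + i) 0 0 0) (fun _ => x) 0 o2 N
      (tcost t_le * (B + 1) + GC + 2)); try easy|st_solve|].
    + intros i v o' Hi. eapply ev_le; [ev_seqs|].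
      * eapply (ev_entry t_le n m K W (GC * i) 0 i (N + i) 0 v 0 x o' B); try lia; nia.
      * apply ev_incs_st.
      * apply ev_incs_st.
      * eapply ev_post; [apply ev_incs_st|]. st_solve.
      * lia.
    + instantiate (1 := st (regs_list n m K W (GC * N) 0 N (N + N) 0 0 0) x o3). reflexivity.
  - apply (ev_entry t_ord) with (B := B); lia.
  - fold o4. apply ev_clear_st.
  - apply ev_clear_st.
  - eapply ev_post; [apply ev_clear_st|]. st_solve.
    unfold o4, o3, o2, o1, enc_circ, circuit_C. rewrite !flat_map_app, <- !app_assoc. reflexivity.
  - cbn [nth regs_list lset]. unfold order_time. fold N. lia.
Qed.

Definition block_cmd (t : list tgate) : cmd := Seq (emit_tmpl t) (incs G 8).
Definition input_block_cmd : cmd :=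
  Seq (CaseX (emit_tmpl (t_fix M (Some false) None)) (emit_tmpl (t_fix M (Some true) None))) (incs G 8).
Definition coin_block_cmd : cmd := Seq (emit_tmpl (t_rand M)) (Seq (incs G 8) (incs 1 10)).
Definition step_block_cmd : cmd := Seq (emit_tmpl (t_step M)) (Seq (incs G 8) (incs G 9)).

Notation t_blank := (t_fix M None None).
Notation t_boot := (t_fix M None (Some (boot_state M))).

(** The count G(1 + W + W^2) + [size_final] needs a product of two input-dependent numbers, hence
    the nested loops. *)
Definition member_length_cmd : cmd :=
  Seq (For 7 13 (Seq (incs G 12) (For 7 14 (incs G 12)))) (emit_nat 12 (G + size_final)).

Definition member_cmd : cmd :=
  Seq member_length_cmd (Seq (incs 4 10) (Seq (emit_tmpl (t_dummy M))
  (Seq (For 6 13 (block_cmd t_blank)) (Seq (block_cmd t_boot) (Seq (For 4 13 input_block_cmd)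
  (Seq (block_cmd t_blank) (Seq (For 5 13 coin_block_cmd) (Seq (For 6 13 (block_cmd t_blank))
  (Seq (For 7 13 (For 7 14 step_block_cmd)) (emit_tmpl (t_final M))))))))))).

Definition block_time (t : list tgate) (B : nat) : nat := tcost t * (B + 1) + G + 1.
Definition input_time (B : nat) : nat :=
  block_time (t_fix M (Some false) None) B + block_time (t_fix M (Some true) None) B.
Definition step_time (B : nat) : nat := block_time (t_step M) B + G.

Definition member_length_time (W : nat) : nat :=
  for_time W (G + for_time W G) + 40 * (G + size_final + 1) * ((G + W * G) * W + 1).

Definition member_time (n m K W B : nat) : nat :=
  member_length_time W + 4 + tcost (t_dummy M) * (B + 1) +
  for_time K (block_time t_blank B) + block_time t_boot B + for_time n (input_time B) +
  block_time t_blank B + for_time m (block_time (t_rand M) B) + for_time K (block_time t_blank B) +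
  for_time W (for_time W (step_time B)) + tcost (t_final M) * (B + 1).

Lemma ev_member_length n m K W x o :
  ev member_length_cmd (st (regs_list n m K W 0 0 0 0 0 0 0) x o)
    (st (regs_list n m K W 0 0 0 0 ((G + W * G) * W) 0 0) x
      (o ++ enc_nat (G * (1 + W + W * W) + size_final))) (member_length_time W).
Proof.
  unfold member_length_cmd, member_length_time. eapply ev_seq.
  - eapply ev_conv; [apply (ev_for 7 13 _ (fun i => st (regs_list n m K W 0 0 0 0 ((G + W * G) * i) 0 0) x o)
      W (G + for_time W G)); try easy| |reflexivity].
    + intros i v Hi. rewrite !setr_st. eapply ev_seq; [apply ev_incs_st|].
      eapply ev_post; [apply (ev_for_incs 7 14 G 12 _ x o W); easy|]. st_solve.
    + st_solve.
  - eapply ev_post; [apply ev_emit_nat_st; easy || lia|]. st_solve.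
    do 2 f_equal. cbn [nth regs_list]. lia.
Qed.

Lemma ev_block t n m K W U E V L v w x o B : U <= B -> E <= B -> V <= B ->
  ev (block_cmd t) (st (regs_list n m K W U E V 0 L v w) x o)
    (st (regs_list n m K W (U + G) E V 0 L v w) x (o ++ enc_gates (inst_entry U (t, (E, V, 0)))))
    (block_time t B).
Proof.
  intros H1 H2 H3. unfold block_cmd, block_time. eapply ev_le; [eapply ev_seq|].
  - apply (ev_entry t) with (B := B); lia.
  - eapply ev_post; [apply ev_incs_st|]. st_solve.
  - lia.
Qed.

Lemma repeat_as_map {A} (e : A) j : repeat e j = map (fun _ => e) (seq 0 j).
Proof. induction j as [|j IH]; [easy|]. simpl. rewrite <- seq_shift, map_map, IH. reflexivity. Qed.

Lemma ev_blank_loop n m K W U V L x o B : U + G * K <= B -> V <= B ->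
  ev (For 6 13 (block_cmd t_blank)) (st (regs_list n m K W U 0 V 0 L 0 0) x o)
    (st (regs_list n m K W (U + G * K) 0 V 0 L 0 0) x
      (o ++ enc_gates (chain G U (repeat (t_blank, (0, V, 0)) K))))
    (for_time K (block_time t_blank B)).
Proof.
  intros HB HV. rewrite repeat_as_map.
  eapply ev_conv; [apply (ev_chain_loop G 6 13 _ (fun _ => (t_blank, (0, V, 0)))
    (fun i => regs_list n m K W (U + G * i) 0 V 0 L 0 0) (fun _ => x) U o K (block_time t_blank B)); try easy
   |st_solve|reflexivity].
  intros i v o' Hi. eapply ev_post; [apply (ev_block t_blank n m K W (U + G * i) 0 V L v 0 x o' B); nia|]. st_solve.
Qed.

Lemma ev_input_loop n m K W U V L x o B : length x = n -> U + G * n <= B -> V <= B ->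
  ev (For 4 13 input_block_cmd) (st (regs_list n m K W U 0 V 0 L 0 0) x o)
    (st (regs_list n m K W (U + G * n) 0 V 0 L 0 0) []
      (o ++ enc_gates (chain G U (map (fun d => (t_fix M (Some d) None, (0, V, 0))) x))))
    (for_time n (input_time B)).
Proof.
  intros Hx HB HV. rewrite <- (map_nth_seq x false) at 2. rewrite map_map, Hx.
  eapply ev_conv; [apply (ev_chain_loop G 4 13 _ (fun i => (t_fix M (Some (nth i x false)) None, (0, V, 0)))
    (fun i => regs_list n m K W (U + G * i) 0 V 0 L 0 0) (fun i => skipn i x) U o n (input_time B)); try easy
   |st_solve|].
  - intros i v o' Hi. eapply ev_le with (t := (1 + (tcost (t_fix M (Some false) None) + tcost (t_fix M (Some true) None)) * (B + 1)) + G);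
      [|unfold input_time, block_time; lia]. unfold input_block_cmd. eapply ev_seq.
    + apply ev_casex with (b := nth i x false) (l := skipn (S i) x).
      * cbn [hx st]. clear -Hi Hx. revert i n Hx Hi. induction x as [|d y IH]; intros i n Hx Hi; [simpl in Hx; lia|].
        destruct i as [|i]; [easy|]. simpl in Hx. apply (IH i (n - 1)); lia.
      * eapply ev_le with (t := tcost (t_fix M (Some (nth i x false)) None) * (B + 1)); [|destruct (nth i x false); nia].
        replace (if nth i x false then emit_tmpl (t_fix M (Some true) None) else emit_tmpl (t_fix M (Some false) None))
          with (emit_tmpl (t_fix M (Some (nth i x false)) None)) by now destruct (nth i x false).
        apply (ev_entry _ n m K W (U + G * i) 0 V 0 L v 0 (skipn (S i) x) o' B); nia.
    + eapply ev_post; [apply ev_incs_st|]. st_solve.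
  - f_equal. rewrite <- Hx. apply skipn_all.
Qed.

Lemma ev_coin_loop n m K W U L x o B : U + G * m <= B -> 4 + m <= B ->
  ev (For 5 13 coin_block_cmd) (st (regs_list n m K W U 0 4 0 L 0 0) x o)
    (st (regs_list n m K W (U + G * m) 0 (4 + m) 0 L 0 0) x
      (o ++ enc_gates (chain G U (map (fun i => (t_rand M, (0, 4 + i, 0))) (seq 0 m)))))
    (for_time m (block_time (t_rand M) B)).
Proof.
  intros HB HV.
  eapply ev_conv; [apply (ev_chain_loop G 5 13 _ (fun i => (t_rand M, (0, 4 + i, 0)))
    (fun i => regs_list n m K W (U + G * i) 0 (4 + i) 0 L 0 0) (fun _ => x) U o m (block_time (t_rand M) B)); try easy
   |st_solve|reflexivity].
  intros i v o' Hi. unfold coin_block_cmd, block_time. eapply ev_le; [ev_seqs|].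
  - apply (ev_entry (t_rand M) n m K W (U + G * i) 0 (4 + i) 0 L v 0 x o' B); nia.
  - apply ev_incs_st.
  - eapply ev_post; [apply ev_incs_st|]. st_solve.
  - lia.
Qed.

Lemma ev_step_loop n m K W U V L x o B : U + G * (W * W) <= B -> V <= B ->
  ev (For 7 13 (For 7 14 step_block_cmd)) (st (regs_list n m K W U 0 V 0 L 0 0) x o)
    (st (regs_list n m K W (U + G * (W * W)) (G * (W * W)) V 0 L 0 0) x
      (o ++ enc_gates (chain G U (step_entries M V (W * W)))))
    (for_time W (for_time W (step_time B))).
Proof.
  intros HB HV.
  set (T := fun v w i => st (regs_list n m K W (U + G * i) (G * i) V 0 L v w) x
      (o ++ enc_gates (chain G U (step_entries M V i)))).
  assert (Hstep : forall v w i, i < W * W -> ev step_block_cmd (T v w i) (T v w (S i)) (step_time B)).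
  { intros v w i Hi. unfold step_block_cmd, step_time, block_time, T.
    eapply ev_le; [ev_seqs|].
    - apply (ev_entry (t_step M) n m K W (U + G * i) (G * i) V 0 L v w x _ B); nia.
    - apply ev_incs_st.
    - eapply ev_post; [apply ev_incs_st|]. st_solve.
      apply (enc_chain_succ G U (fun i => (t_step M, (G * i, V, 0)))).
    - lia. }
  eapply ev_conv; [apply (ev_for 7 13 _ (fun i => T 0 0 (W * i)) W (for_time W (step_time B))); try easy| |].
  - intros i v Hi. eapply ev_conv; [apply (ev_for 7 14 _ (fun j => T v 0 (W * i + j)) W (step_time B)); try easy| |].
    + intros j w Hj. unfold T at 1 2. rewrite !setr_st. rewrite Nat.add_succ_r. apply (Hstep v w (W * i + j)). nia.
    + unfold T. rewrite setr_st, Nat.add_0_r. reflexivity.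
    + unfold T. rewrite setr_st. replace (W * i + W) with (W * S i) by lia. reflexivity.
  - unfold T. rewrite Nat.mul_0_r. st_solve. simpl. apply app_nil_r.
  - reflexivity.
Qed.

(** Printing ends here, so the final registers are left as they are and only the output is
    described. *)
Lemma ev_member m K x o B : let n := length x in let W := row_width n m K in
  G * (W + W * W) <= B -> 4 + m <= B ->
  exists s, ev member_cmd (st (regs_list n m K W 0 0 0 0 0 0 0) x o) s (member_time n m K W B) /\
    ho s = o ++ enc_circ (circuit_D M x m K W).
Proof.
  intros n W HB HV. set (L := (G + W * G) * W).
  assert (HU : G * (2 * K + n + m + 2) <= B) by (unfold W, row_width in *; nia).
  set (o1 := o ++ enc_nat (length (circuit_D M x m K W))).
  set (o2 := o1 ++ enc_gates (inst_entry 0 (t_dummy M, (0, 4, 0)))).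
  set (b1 := repeat (t_blank, (0, 4, 0)) K : list entry).
  set (b2 := [(t_boot, (0, 4, 0))] : list entry).
  set (b3 := map (fun d => (t_fix M (Some d) None, (0, 4, 0))) x : list entry).
  set (b4 := [(t_blank, (0, 4, 0))] : list entry).
  set (b5 := map (fun i => (t_rand M, (0, 4 + i, 0))) (seq 0 m) : list entry).
  set (b6 := repeat (t_blank, (0, 4 + m, 0)) K : list entry).
  set (b7 := step_entries M (4 + m) (W * W)).
  eexists. split.
  - eapply ev_le; [unfold member_cmd; ev_seqs|].
    + reach_st (st (regs_list n m K W 0 0 0 0 L 0 0) x o1) by (apply ev_member_length).
      unfold o1. do 2 f_equal. rewrite circuit_D_length by reflexivity. reflexivity.
    + reach_st (st (regs_list n m K W 0 0 4 0 L 0 0) x o1) by (apply ev_incs_st).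
    + apply (ev_entry (t_dummy M)) with (B := B); lia.
    + fold o2. apply (ev_blank_loop n m K W 0 4 L x o2 B); nia.
    + apply ev_block with (B := B); nia.
    + apply ev_input_loop with (B := B); [easy|nia|lia].
    + apply ev_block with (B := B); nia.
    + apply ev_coin_loop with (B := B); nia.
    + apply ev_blank_loop with (B := B); nia.
    + apply ev_step_loop with (B := B); [|lia].
      eapply Nat.le_trans; [|exact HB]. unfold W at 3, row_width. lia.
    + apply ev_entry with (B := B); try lia.
      eapply Nat.le_trans; [|exact HB]. unfold W at 3, row_width. lia.
    + unfold member_time. lia.
  - cbn [ho st]. fold b1 b3 b5 b6 b7.
    unfold o2, o1, enc_circ, circuit_D, init_entries. fold b1 b2 b3 b4 b5 b6 b7.
    assert (L1 : length b1 = K) by apply repeat_length.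
    assert (L3 : length b3 = n) by apply length_map.
    assert (L5 : length b5 = m) by (unfold b5; now rewrite length_map, length_seq).
    assert (L6 : length b6 = K) by apply repeat_length.
    rewrite <- !app_assoc, !chain_app, !flat_map_app, L1, L3, L5, L6.
    unfold b2, b4. cbn [chain length]. rewrite !app_nil_r, Nat.mul_1_r.
    rewrite <- !app_assoc. do 10 f_equal.
    assert (EU : 0 + G * K + G + G * n + G + G * m + G * K + G * (W * W) = G * (W + W * W)).
    { rewrite Nat.mul_add_distr_l. f_equal. unfold W, row_width. lia. }
    now rewrite EU.
Qed.
End Generator.

Lemma poly_bounded_power_time k f : poly_bounded f -> poly_bounded (fun n => power_time k (f n)).
Proof.
  intro Hf. induction k as [|k IH]; [apply (poly_bounded_const 1)|].
  cbn [power_time]. unfold for_time.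
  repeat match goal with
  | |- poly_bounded (fun n => @?u n + @?v n) => apply (poly_bounded_add u v)
  | |- poly_bounded (fun n => @?u n * @?v n) => apply (poly_bounded_mul u v)
  | |- poly_bounded (fun n => @?u n ^ ?j) => apply (poly_bounded_pow u j)
  | |- poly_bounded (fun _ => ?j) => apply poly_bounded_const
  end; assumption.
Qed.

Ltac poly_bound := repeat match goal with
  | |- poly_bounded (fun n => @?u n + @?v n) => apply (poly_bounded_add u v)
  | |- poly_bounded (fun n => @?u n * @?v n) => apply (poly_bounded_mul u v)
  | |- poly_bounded (fun n => @?u n ^ ?j) => apply (poly_bounded_pow u j)
  | |- poly_bounded (fun n => power_time ?j (@?u n)) => apply (poly_bounded_power_time j u)
  | |- poly_bounded (fun n => poly ?j ?l n) => apply (poly_bounded_poly j l)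
  | |- poly_bounded (fun n => n) => apply poly_bounded_id
  | |- poly_bounded (fun _ => ?j) => apply poly_bounded_const
  end.

(** * The reduction and its polynomial running time *)

Section Reduction.
Variable M : TM.
Variables a b c k : nat.

Notation m := (num_coins a b).
Notation K := (margin c k).
Notation W := (row_cells a b c k).

Definition reduction_instance (x : list bool) : instance :=
  let n := length x in
  mkInstance (4 + m n) (circuit_C (4 + m n)) (circuit_D M x (m n) (K n) (W n)).

Definition generator : cmd :=
  Seq (setup_cmd a b c k) (Seq (emit_nat 5 4) (Seq order_cmd (member_cmd M))).

(** One common bound for every base occurring in either circuit; a sum avoids maxima and is visibly
    polynomial. *)
Definition register_bound (n : nat) : nat :=
  GC * (4 + m n) + 2 * (4 + m n) + GD M * (W n + W n * W n).

Definition generator_time (n : nat) : nat :=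
  setup_time a b c k n + (40 * (4 + 1) * (m n + 1) +
  (order_time (m n) (register_bound n) + member_time M n (m n) (K n) (W n) (register_bound n))).

Lemma generator_correct x : exists s,
  ev generator (input_state 4 x) s (generator_time (length x)) /\
  ho s = enc_instance (reduction_instance x).
Proof.
  set (n := length x).
  destruct (ev_member M (m n) (K n) x
     ((enc_nat (m n + 4)) ++ enc_circ (circuit_C (4 + m n))) (register_bound n)) as (s & Hs & Ho).
  { fold n. change (row_width n (m n) (K n)) with (W n). unfold register_bound. lia. }
  { unfold register_bound. lia. }
  exists s. split.
  - unfold generator, generator_time. fold n. eapply ev_seq; [|eapply ev_seq; [|eapply ev_seq; [|exact Hs]]].
    + eapply ev_conv; [apply (ev_setup a b c k n x [])| |reflexivity].
      unfold st, input_state, regs_list. f_equal. apply functional_extensionality.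
      intro j. do 17 (destruct j as [|j]; [reflexivity|]). now destruct j.
    + apply ev_emit_nat_st; easy || lia.
    + apply ev_order; unfold register_bound; lia.
  - rewrite Ho. unfold enc_instance, reduction_instance. cbn [inst_n inst_C inst_D].
    fold n. rewrite (Nat.add_comm (m n)), <- app_assoc. reflexivity.
Qed.

Lemma generator_time_bounded : poly_bounded generator_time.
Proof.
  unfold generator_time, setup_time, poly_time, order_time, member_time, member_length_time, input_time,
    step_time, block_time, for_time, register_bound, row_cells, row_width, num_coins, margin.
  poly_bound.
Qed.

Lemma reduction_computable : PolyTimeComputable (fun x => enc_instance (reduction_instance x)).
Proof.
  apply (cmd_computable 4 generator _ generator_time); [|apply generator_time_bounded].
  intro x. destruct (generator_correct x) as (s & Hs & Ho). exists s, (generator_time (length x)). auto.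
Qed.

Lemma reduction_correct x :
  (forall r, length r = m (length x) -> run M (poly c k (length x)) (init (pair_input x r)) <> None) ->
  promise (reduction_instance x) /\
  (exists_game (reduction_instance x) <->
   2 * count (fun r => accepts_within M (poly c k (length x)) (pair_input x r)) (m (length x)) > 2 ^ m (length x)).
Proof.
  intro Hrun. apply majority_instance; [reflexivity| |].
  - intros y z Hy Hz. apply circuit_C_correct; auto. lia.
  - intros t r Ht Hr. unfold reduction_instance. cbn [inst_D]. unfold row_cells. rewrite <- Hr.
    apply circuit_D_correct; [easy|now apply Hrun|unfold margin; lia].
Qed.
End Reduction.

Theorem mainTheorem15 : PP_hard NFree_yes NFree_no.
Proof.
  intros L (M & a & b & c & k & Hrun & HL).
  exists (fun x => enc_instance (reduction_instance M a b c k x)).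
  split; [apply reduction_computable|]. intro x.
  destruct (reduction_correct M a b c k x (fun r Hr => Hrun x r Hr)) as [Hp Hg].
  specialize (HL x). unfold count, num_coins in Hg.
  split; intro Hx; exists (reduction_instance M a b c k x); tauto.
Qed.
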